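(* Let $G=(V,E)$ be a vertex-capacitated graph with $n=|V|$, and let $\epsilon=\Omega(1/\log n)$. Then there exists a $t$-step length-constrained flow shortcut $E'$ of $G$ with length slack $O(1/\epsilon^3)$, congestion slack $O(n^{O(\epsilon)}\log^3 n/\epsilon^2)$, $t=2^{O(1/\epsilon)}$, and size $|E'|\le O(n^{1+O(\epsilon)}\log n/\epsilon^2)$ (all $O(\cdot)$'s hide absolute constants).
   Context: A vertex-capacitated graph is a finite undirected graph with a length function $\ell$ and capacity function $u$ on vertices and edges, with positive integer values bounded by $N=\mathrm{poly}(n)$. The length of a path is the sum of the lengths of its vertices and edges; the number of steps of a path is its number of edges. A demand is $D:V\times V\to\mathbb{R}_{\ge0}$. A flow $F$ assigns nonnegative values to simple paths; it routes $D$ if for every ordered pair $(v,w)$ the total value of its $v$–$w$ paths equals $D(v,w)$; its congestion is the maximum, over all vertices and edges $x$, of (total flow value on paths through $x$)$/u(x)$; its length (resp. step) is the maximum length (resp. number of edges) of a path with positive value. $D$ is routable with congestion $\gamma$, length $h$ and step $t$ if some flow routing $D$ has these bounds. A $t$-step flow shortcut of $G$ with length slack $\lambda$ and congestion slack $\kappa$ is a set $E'$ of edges, possibly incident to new vertices outside $V$ (new vertices and edges carrying positive lengths and capacities, forming the vertex-capacitated graph $G\cup E'$), such that (forward mapping) every demand routable in $G$ with congestion $1$ and length $h$ is routable in $G\cup E'$ with congestion $1$, length $\lambda h$ and maximum step $t$; and (backward mapping) every demand on $V$ routable in $G\cup E'$ with congestion $1$ and length $h$ is routable in $G$ with congestion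 $\kappa$ and length $h$.
   Formalization: The result is proved for n ≥ 2 and ε ≤ 1: for large ε a length slack O(1/ε³) would drop below 1, which is impossible, and 1/log n is undefined at n = 1. The hidden constants may depend on those in N = poly(n) and ε = Ω(1/log n). *)

(* Defs.v *)
From HB Require Import structures.
From mathcomp Require Import all_boot all_order all_algebra.
From mathcomp Require Import reals exp.
Set Implicit Arguments. Unset Strict Implicit. Unset Printing Implicit Defensive.
Import Order.TTheory GRing.Theory Num.Theory.
Local Open Scope ring_scope.

(* A vertex-capacitated (simple, undirected) graph on the finite vertex type V.
   Edges are 2-element subsets of V.  Lengths and capacities are nat-valued;
   positivity is imposed by [vc_wf]. *)
Record vcgraph (V : finType) := VCGraph {
  vedges : {set {set V}};
  vlen : V -> nat;
  vcap : V -> nat;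
  elen : {set V} -> nat;
  ecap : {set V} -> nat }.

Definition vc_wf (V : finType) (G : vcgraph V) : Prop :=
  (forall e, e \in vedges G -> #|e| = 2%N) /\
  (forall v, (0 < vlen G v)%N /\ (0 < vcap G v)%N) /\
  (forall e, e \in vedges G -> (0 < elen G e)%N /\ (0 < ecap G e)%N).

Definition vc_bounded (V : finType) (G : vcgraph V) (N : nat) : Prop :=
  (forall v, (vlen G v <= N)%N /\ (vcap G v <= N)%N) /\
  (forall e, e \in vedges G -> (elen G e <= N)%N /\ (ecap G e <= N)%N).

Section Paths.
Variables (V : finType) (G : vcgraph V).

Definition vadj : rel V := fun x y => [set x; y] \in vedges G.

Definition pedges (s : seq V) : seq {set V} :=
  if s is x :: s' then pairmap (fun a b => [set a; b]) x s' else [::].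

Definition simple_path (s : seq V) : bool :=
  if s is x :: s' then path vadj x s' && uniq s else false.

Definition plen (s : seq V) : nat :=
  (\sum_(x <- s) vlen G x + \sum_(e <- pedges s) elen G e)%N.

Definition psteps (s : seq V) : nat := (size s).-1.
End Paths.

Section Flows.
Variables (R : realType) (V : finType) (G : vcgraph V).

(* A flow: a finite list of (simple path, nonnegative value) pairs; the value
   of a path is the sum of its entries. *)
Definition flow := seq (seq V * R).

Definition flow_ok (F : flow) : Prop :=
  forall p, p \in F -> simple_path G p.1 /\ 0 <= p.2.

Definition routes (F : flow) (D : V -> V -> R) : Prop :=
  forall v w, \sum_(p <- F | (ohead p.1 == Some v) && (ohead (rev p.1) == Some w)) p.2
              = D v w.

Definition congestion_le (F : flow) (gam : R) : Prop :=
  (forall x, \sum_(p <- F | x \in p.1) p.2 <= gam * (vcap G x)%:R) /\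
  (forall e, e \in vedges G ->
     \sum_(p <- F | e \in pedges p.1) p.2 <= gam * (ecap G e)%:R).

Definition length_le (F : flow) (h : R) : Prop :=
  forall p, p \in F -> 0 < p.2 -> (plen G p.1)%:R <= h.

Definition steps_le (F : flow) (t : nat) : Prop :=
  forall p, p \in F -> 0 < p.2 -> (psteps p.1 <= t)%N.

Definition demand (D : V -> V -> R) : Prop := forall v w, 0 <= D v w.

Definition routable (D : V -> V -> R) (gam h : R) : Prop :=
  exists F, [/\ flow_ok F, routes F D, congestion_le F gam & length_le F h].

Definition routable_t (D : V -> V -> R) (gam h : R) (t : nat) : Prop :=
  exists F, [/\ flow_ok F, routes F D, congestion_le F gam, length_le F h
              & steps_le F t].
End Flows.

(* G ∪ E' : the vertex set is V + 'I_k (k new vertices);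
   edges are the copies of G's edges together with E'. *)
Section Augment.
Variables (V : finType) (G : vcgraph V) (k : nat).

Definition lift_edge (e : {set V}) : {set (V + 'I_k)%type} := [set inl v | v in e].

Definition augment (E' : {set {set (V + 'I_k)%type}})
    (nlen ncap : 'I_k -> nat) (elen' ecap' : {set (V + 'I_k)%type} -> nat)
    : vcgraph (V + 'I_k)%type :=
  {| vedges := [set lift_edge e | e in vedges G] :|: E';
     vlen := fun x => match x with inl v => vlen G v | inr i => nlen i end;
     vcap := fun x => match x with inl v => vcap G v | inr i => ncap i end;
     elen := fun e => if e \in E' then elen' e else elen G [set v | inl v \in e];
     ecap := fun e => if e \in E' then ecap' e else ecap G [set v | inl v \in e] |}.

Definition new_edges (E' : {set {set (V + 'I_k)%type}}) : Prop :=
  [disjoint E' & [set lift_edge e | e in vedges G]].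
End Augment.

Definition lift_demand (R : realType) (V : finType) (k : nat) (D : V -> V -> R)
    : (V + 'I_k)%type -> (V + 'I_k)%type -> R :=
  fun x y => match x, y with inl v, inl w => D v w | _, _ => 0 end.

Definition flow_shortcut (R : realType) (V : finType) (k : nat)
    (G : vcgraph V) (H : vcgraph (V + 'I_k)%type) (t : nat) (lam kap : R) : Prop :=
  (forall (D : V -> V -> R) (h : R), demand D ->
     routable G D 1 h -> routable_t H (@lift_demand _ _ k D) 1 (lam * h) t) /\
  (forall (D : V -> V -> R) (h : R), demand D ->
     routable H (@lift_demand _ _ k D) 1 h -> routable G D kap h).

(* Main.v *)
(* Write L = ln n and c = eps L.  For each length scale 2^i the shortcut has a
   tower of J = O(1/eps) levels.  At a level, vertices are organised in groups;
   a group carries a path of G through its members and a capacity, and these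
   paths load G by a factor O(L).  A weight gamma on vertices and edges of G is
   a near-minimiser of a convex-like potential: kappa |gamma| plus the log
   partition functions ln Z_v of the kernel exp(-b (length/r + gamma)), summed
   over sources v.  The sources are the heads of the group paths and, linearly
   in gamma, the vertices of these paths themselves.  Perturbing gamma by tau w
   shows that for every weight w the kernel-averaged routes out of the sources
   are cheap in w; by linear programming duality this is exactly what is needed
   to embed stars over clusters of small gamma-radius into G.  A sparse cover
   in the metric length/r + gamma puts every pair joined by a short light path
   (gamma < 1) into a common cluster, so such pairs are joined by a hub.

   Short heavy paths (gamma >= 1) are served by the next level: a greedy
   multiplicative-weights family of heavy paths becomes the new groups, and a
   transportation rounding assigns vertices to them.  Since |gamma| is small,
   the total group capacity drops by e^-c per level, and after O(1/eps) levels
   no heavy path is left.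

   Forward mapping: along a flow path, points are attached to level j+1 where
   the running greedy price crosses theta + Z for a random theta, which loads a
   vertex in expectation by its price.  Every heavy stretch contains such a
   point, so one climbs from level to level at the two ends of a stretch; the
   lengths are amortised by alpha_j (length) + beta_j r_j with beta_j bounded,
   and the number of steps grows by a constant factor per level.  Backward
   mapping: a path of the shortcut is turned into a walk of G, each visit to a
   group being charged O(1) times its embedding cost. *)

Require Import Defs.
From HB Require Import structures.
From mathcomp Require Import all_boot all_order all_algebra.
From mathcomp Require Import reals exp.
From mathcomp Require Import ring lra zify.
Set Implicit Arguments. Unset Strict Implicit. Unset Printing Implicit Defensive.
Import Order.TTheory GRing.Theory Num.Theory.
Local Open Scope ring_scope.

Local Notation expR := sequences.expR.

(** * Weights of paths *)

Section Weights.
Variables (R : realType) (V : finType) (G : vcgraph V).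

(** The obstacle is that a group member must reach a source of the kernel while moving little in
    gamma, although its group path may itself be heavy in gamma. This is why vertices of group paths
    are sources in proportion to the gamma-weight next to them: walking off from a member, either
    the path stays light, or a stretch of gamma-weight 1/2 carries enough source mass to contain a
    cheap port. The potential is then no longer convex, but the sources are linear in gamma, so a
    perturbation changes them in proportion to its size only, which the final bound absorbs.
    Constants: comparing kernels at distance d costs a factor exp(2 b d). Clusters have d = O(1/eps)
    when balls may grow by n^eps, so b = eps^2 ln n keeps this factor n^O(eps). Kernel mass lies
    within O(ln U / b) = O(1/eps^2) of its centre, U being the total capacity; this is the length of
    a star relative to its scale, and O(1/eps) levels turn it into 1/eps^3. The ratio 4 between
    scales makes the additive errors of the climb a geometric series. The random theta is realised
    by averaging over [N'] integer offsets. *)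

Definition pw (wv : V -> R) (we : {set V} -> R) (s : seq V) : R :=
  \sum_(x <- s) wv x + \sum_(e <- pedges s) we e.

Definition nneg (T : Type) (f : T -> R) : Prop := forall x, 0 <= f x.

Definition wsize (wv : V -> R) (we : {set V} -> R) : R :=
  \sum_v wv v * (vcap G v)%:R + \sum_(e in vedges G) we e * (ecap G e)%:R.

Definition joins (v w : V) (s : seq V) : bool :=
  [&& simple_path G s, ohead s == Some v & ohead (rev s) == Some w].

Lemma ohead_rev (x : V) p : ohead (rev (x :: p)) = Some (last x p).
Proof. by rewrite lastI rev_rcons. Qed.

Lemma joins_pathP v w s :
  reflect (exists p, [/\ s = v :: p, path (vadj G) v p, uniq (v :: p) & last v p = w])
          (joins v w s).
Proof.
apply: (iffP idP).
  case: s => [|x p]; first by rewrite /joins.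
  rewrite /joins ohead_rev /= => /and3P[/andP[pp up] /eqP[ex] /eqP[el]].
  by subst x; exists p.
case=> p [-> pp up el]; rewrite /joins ohead_rev el /= !eqxx.
by rewrite /= in up; rewrite pp up.
Qed.

Lemma joins_simple v w s : joins v w s -> simple_path G s.
Proof. by case/and3P. Qed.

Lemma sum_sub_seq (T : eqType) (s1 s2 : seq T) (F : T -> R) :
  uniq s1 -> {subset s1 <= s2} -> (forall x, 0 <= F x) ->
  \sum_(x <- s1) F x <= \sum_(x <- s2) F x.
Proof.
move=> u1 sub F0.
have h : \sum_(x <- s1) F x <= \sum_(x <- undup s2) F x.
  rewrite (perm_big (filter (mem s1) (undup s2))) /=.
    by rewrite big_filter [leRHS](bigID (mem s1)) /= lerDl sumr_ge0.
  apply: uniq_perm => //; first by rewrite filter_uniq // undup_uniq.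
  move=> x; rewrite mem_filter mem_undup /=.
  by case e: (x \in s1) => //=; rewrite (sub _ e).
apply: (le_trans h); elim: s2 {sub h} => [|a s IH] /=; first by rewrite big_nil.
case: ifP => _; rewrite ?big_cons; last by rewrite lerD2l.
by apply: (le_trans IH); rewrite lerDr.
Qed.

Lemma pairmap_mem (f : V -> V -> {set V}) x p e :
  e \in pairmap f x p -> exists a b q r, x :: p = q ++ a :: b :: r /\ e = f a b.
Proof.
elim: p x => [|y p IH] x //=; rewrite inE => /orP[/eqP->|/IH [a [b [q [r [E ->]]]]]].
  by exists x, y, [::], p.
by exists a, b, (x :: q), r; rewrite E.
Qed.

Lemma pedges_mem (s : seq V) (e : {set V}) (x : V) : e \in pedges s -> x \in e -> x \in s.
Proof.
case: s => [|y p] //= /pairmap_mem [a [b [q [r [-> ->]]]]].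
by rewrite !inE mem_cat !inE => /orP[/eqP->|/eqP->]; rewrite eqxx ?orbT.
Qed.

Lemma pedges_uniq (s : seq V) : uniq s -> uniq (pedges s).
Proof.
case: s => [|x p] //; elim: p x => [|y p IH] x //= /andP[nx up].
rewrite IH // andbT; apply/negP => /(@pedges_mem (y :: p) _ x) h.
by move: nx; rewrite h // !inE eqxx.
Qed.

Lemma pedges_vedges s e : simple_path G s -> e \in pedges s -> e \in vedges G.
Proof.
case: s => [|x p] //= /andP[pp _]; elim: p x pp => [|y p IH] x //= /andP[a pp].
by rewrite inE => /orP[/eqP->//|]; apply: IH.
Qed.

Lemma vadj_sym : symmetric (vadj G).
Proof. by move=> x y; rewrite /vadj setUC. Qed.

Lemma pw_ge0 wv we s : nneg wv -> nneg we -> 0 <= pw wv we s.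
Proof. by move=> h1 h2; rewrite addr_ge0 // sumr_ge0. Qed.

Lemma pw_sub wv we s t : nneg wv -> nneg we -> uniq s ->
  {subset s <= t} -> {subset pedges s <= pedges t} -> pw wv we s <= pw wv we t.
Proof.
by move=> h1 h2 us st et; rewrite lerD // sum_sub_seq // pedges_uniq.
Qed.

(** Capacities are at least 1 and a simple path meets each vertex and edge once. This uniform bound
    sets the size of the perturbation in [near_minimizer]. *)
Lemma pw_simple wv we s : nneg wv -> nneg we -> vc_wf G -> simple_path G s ->
  pw wv we s <= wsize wv we.
Proof.
move=> h1 h2 [_ [hv he]] sp.
have us : uniq s by case: s sp => //= x p /andP[].
rewrite lerD //.
  apply: (@le_trans _ _ (\sum_v wv v)).
    by rewrite -[leRHS]big_enum /=; apply: sum_sub_seq => // x _; rewrite mem_enum.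
  by apply: ler_sum => v _; rewrite ler_peMr // ler1n; case: (hv v).
apply: (@le_trans _ _ (\sum_(e in vedges G) we e)).
  rewrite -[leRHS]big_enum /=; apply: sum_sub_seq => //; first exact: pedges_uniq.
  by move=> e; rewrite mem_enum; apply: pedges_vedges.
by apply: ler_sum => e ee; rewrite ler_peMr // ler1n; case: (he e ee).
Qed.

Lemma shorten_walk x p : path (vadj G) x p ->
  exists q, [/\ joins x (last x p) (x :: q), (size q <= size p)%N, {subset x :: q <= x :: p}
             & {subset pedges (x :: q) <= pedges (x :: p)}].
Proof.
move=> pp.
(* Restricting the relation to the edges of the walk makes [shortenP] control the edges of the
   shortened path, not only its vertices. *)
pose e' := [rel a b | vadj G a b && ([set a; b] \in pedges (x :: p))].
have pe' : path e' x p.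
  have : {subset pedges (x :: p) <= pedges (x :: p)} by [].
  rewrite {1}/pedges /e'; move: (pedges (x :: p)) => E.
  elim: p x pp {e'} => [|y p IH] x //= /andP[a pp] sub.
  rewrite a sub ?inE ?eqxx //=; apply: IH => // e h.
  by apply: sub; rewrite inE h orbT.
case: (shortenP pe') => q pq uq sub.
exists q; split.
- apply/joins_pathP; exists q; split=> //.
  by apply: sub_path pq => a b /andP[].
- by apply: uniq_leq_size; [case/andP: uq | exact: sub].
- move=> z; rewrite !inE => /orP[->//|/sub ->]; by rewrite orbT.
- rewrite /= -/(pedges (x :: p)); move: (pedges (x :: p)) @e' pq {pe'} => E /= pq e.
  elim: q x pq {uq sub pp} => [|y q IH] x //= /andP[/andP[_ h] pq].
  rewrite inE => /orP[/eqP->//|]; exact: IH.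
Qed.

Lemma pedges_cat (x : V) p q : pedges (x :: p ++ q) = pedges (x :: p) ++ pedges (last x p :: q).
Proof. by rewrite /= ; elim: p x => [|y p IH] x //=; rewrite IH. Qed.

Lemma pw_cat wv we x p q : nneg wv ->
  pw wv we (x :: p ++ q) <= pw wv we (x :: p) + pw wv we (last x p :: q).
Proof.
move=> h; rewrite /pw pedges_cat -cat_cons !big_cat /= [X in _ <= _ + (X + _)]big_cons.
have := h (last x p); lra.
Qed.

Lemma joins_trans a b c s t : joins a b s -> joins b c t ->
  exists u, joins a c u /\
    (forall wv we, nneg wv -> nneg we -> pw wv we u <= pw wv we s + pw wv we t).
Proof.
case/joins_pathP => p [-> pp up lp] /joins_pathP [q [-> pq uq lq]].
have pc : path (vadj G) a (p ++ q) by rewrite cat_path pp lp.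
case: (shorten_walk pc) => u [ju _ sv se]; exists (a :: u); split.
  by rewrite last_cat lp lq in ju.
move=> wv we h1 h2; have := @pw_cat wv we a p q h1; rewrite lp => h.
apply: le_trans h; apply: pw_sub => //.
by case/joins_pathP: ju => ? [[->]].
Qed.

Lemma pedges_rev (s : seq V) : perm_eq (pedges (rev s)) (pedges s).
Proof.
case: s => [|x p] //; elim: p x => [|y p IH] x //.
rewrite rev_cons; have := IH y; case E: (rev (y :: p)) => [|z r].
  by move: (congr1 size E); rewrite size_rev.
have lz : last z r = y by move: (ohead_rev z r); rewrite -E revK /= => -[].
rewrite rcons_cons -cats1 pedges_cat lz /= => h.
by rewrite cats1 perm_rcons (setUC [set y]) perm_cons.
Qed.

Lemma joins_sym a b s : joins a b s -> joins b a (rev s).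
Proof.
case/joins_pathP => p [-> pp up lp]; rewrite /joins revK.
have -> : ohead (a :: p) == Some a by rewrite /= eqxx.
rewrite ohead_rev lp eqxx !andbT.
rewrite /simple_path -rev_uniq in up *.
rewrite lastI rev_rcons lp in up *; rewrite up andbT.
rewrite -[b]lp rev_path; apply: sub_path pp => x y; by rewrite vadj_sym.
Qed.

Lemma pw_rev wv we s : pw wv we (rev s) = pw wv we s.
Proof.
rewrite /pw; congr (_ + _); apply: perm_big; first by rewrite perm_rev.
exact: pedges_rev.
Qed.

Lemma joins_refl v : joins v v [:: v].
Proof. by rewrite /joins /= !eqxx. Qed.

Lemma joins_sub s i k x0 : simple_path G s -> (i <= k < size s)%N ->
  joins (nth x0 s i) (nth x0 s k) (take (k - i).+1 (drop i s)).
Proof.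
move=> sp /andP[ik ks].
have us : uniq s by case: s sp {ks} => //= x p /andP[].
have is_ : (i < size s)%N by exact: leq_ltn_trans ks.
have E : take (k - i).+1 (drop i s) = nth x0 s i :: take (k - i) (drop i.+1 s).
  by rewrite (drop_nth x0).
apply/joins_pathP; exists (take (k - i) (drop i.+1 s)); split=> //.
- apply: take_path; case: s sp is_ {us E ks} => //= x p /andP[pp _] is_.
  have := pp; rewrite -(cat_take_drop i p) cat_path => /andP[_].
  suff -> : last x (take i p) = nth x0 (x :: p) i by rewrite cat_take_drop.
  case: i {ik} is_ => [|i] /= is_; first by rewrite take0.
  by rewrite (take_nth x0) // last_rcons.
- by rewrite -E take_uniq // drop_uniq.
- have : nth x0 (nth x0 s i :: take (k - i) (drop i.+1 s)) (k - i) = nth x0 s k.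
    by rewrite -E nth_take // nth_drop subnKC.
  have sz : size (take (k - i) (drop i.+1 s)) = (k - i)%N.
    by rewrite size_takel // size_drop; move: ks ik; clear; lia.
  by move=> <-; rewrite -[LHS]/(last x0 (_ :: _)) -nth_last /= sz.
Qed.

End Weights.

(** * Linear programming duality for routings *)

Lemma between_bounds (R : realFieldType) (I : finType) (P N : pred I) (lb ub : I -> R) :
  (forall i j, P i -> N j -> lb j <= ub i) ->
  exists t, (forall i, P i -> t <= ub i) /\ (forall j, N j -> lb j <= t).
Proof.
move=> h; case: (pickP N) => [j0 Nj0|N0].
  case: (arg_maxP lb Nj0) => j Nj jmax.
  by exists (lb j); split=> [i Pi|k Nk]; [exact: h|exact: jmax].
(* Without lower bounds, any number below all upper bounds will do. *)
exists (- \sum_i `|ub i|); split=> [i Pi|j]; last by rewrite N0.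
rewrite lerNl (bigD1 i) //=; have := ler_norm (- ub i); rewrite normrN => h1.
by apply: (le_trans h1); rewrite lerDl sumr_ge0.
Qed.

(* Fourier-Motzkin elimination of the last variable: the constraints not
   involving it are kept, and each pair with opposite signs is combined. *)
Lemma farkas_nat (R : realFieldType) n : forall (I : finType) (a : I -> nat -> R) (b : I -> R),
  (exists x : nat -> R, forall i, \sum_(k < n) a i k * x k <= b i) \/
  (exists l : I -> R, [/\ forall i, 0 <= l i,
      forall k, (k < n)%N -> \sum_i l i * a i k = 0 & \sum_i l i * b i < 0]).
Proof.
elim: n => [|n IH] I a b.
  case: (pickP (fun i => b i < 0)) => [i bi|h].
    right; exists (fun j => (j == i)%:R); split=> //.
    rewrite (bigD1 i) //= eqxx mul1r big1 ?addr0 // => j /negbTE ->; by rewrite mul0r.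
  left; exists (fun=> 0) => i; rewrite big_ord0.
  by have := h i; rewrite ltNge => /negbFE.
pose al i := a i n.
pose mix (v : I -> R) (z : I + I * I) : R :=
  match z with
  | inl i => if al i == 0 then v i else 0
  | inr (i, j) => if (0 < al i) && (al j < 0) then - al j * v i + al i * v j else 0
  end.
case: (IH _ (fun z k => mix (fun i => a i k) z) (mix b)) => [[x hx]|[l [l0 la lb]]].
  left; pose S i := \sum_(k < n) a i k * x k.
  have mixS z : \sum_(k < n) mix (fun i => a i k) z * x k = mix S z.
    case: z => [i|[i j]] /=; case: ifP => _ //; try by apply: big1 => k _; rewrite mul0r.
    by rewrite /S !mulr_sumr -big_split /=; apply: eq_bigr => k _; ring.
  have bb i j : 0 < al i -> al j < 0 -> (b j - S j) / al j <= (b i - S i) / al i.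
    move=> pi nj; have := hx (inr (i, j)); rewrite mixS /= pi nj /= => h.
    rewrite ler_pdivlMr // mulrAC ler_ndivrMr //; lra.
  have [t [tu tl]] := @between_bounds R I (fun i => 0 < al i) (fun j => al j < 0) _ _ bb.
  exists (fun k => if k == n then t else x k) => i.
  rewrite big_ord_recr /= eqxx.
  have -> : \sum_(k < n) a i k * (if (k : nat) == n then t else x k) = S i.
    by apply: eq_bigr => k _; rewrite ltn_eqF.
  case: (ltrgtP (al i) 0) => [neg|pos|zer].
  - have := tl i neg; rewrite ler_ndivrMr // -/(al i); lra.
  - have := tu i pos; rewrite ler_pdivlMr // -/(al i); lra.
  - rewrite -/(al i) zer mul0r addr0; have := hx (inl i); by rewrite mixS /= zer eqxx.
right.
(* Multipliers of the combined system pulled back to the original one: the pair (i, j) contributes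
   [- al j] to i and [al i] to j. [key] says that this is adjoint to [mix]. *)
pose l' i := (if al i == 0 then l (inl i) else 0)
  + \sum_j (if (0 < al i) && (al j < 0) then l (inr (i, j)) * - al j else 0)
  + \sum_j (if (0 < al j) && (al i < 0) then l (inr (j, i)) * al j else 0).
have key v : \sum_i l' i * v i = \sum_z l z * mix v z.
  rewrite [RHS]big_sumType /= /l'.
  under eq_bigr do rewrite !mulrDl.
  rewrite !big_split /= -addrA; congr (_ + _).
    by apply: eq_bigr => i _; case: ifP; rewrite ?mul0r ?mulr0.
  under eq_bigr do rewrite mulr_suml.
  under [X in _ + X]eq_bigr do rewrite mulr_suml.
  rewrite [X in _ + X]exchange_big /= -big_split /=.
  under eq_bigr do rewrite -big_split /=.
  rewrite pair_big /=; apply: eq_bigr => -[i j] _ /=.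
  case: ifP => _; rewrite ?mul0r ?mulr0 ?addr0 //; ring.
exists l'; split.
- move=> i; rewrite /l' !addr_ge0 //; first by case: ifP.
    by apply: sumr_ge0 => j _; case: ifP => // /andP[_ h]; rewrite mulr_ge0 // oppr_ge0 ltW.
  by apply: sumr_ge0 => j _; case: ifP => // /andP[h _]; rewrite mulr_ge0 // ltW.
- move=> k; rewrite ltnS leq_eqVlt => /orP[/eqP->|kn]; last by rewrite key; apply: la.
  rewrite key big1 // => -[i|[i j]] _ /=; case: ifP => [|_]; rewrite ?mulr0 //.
    by rewrite /al => /eqP ->; rewrite mulr0.
  by move=> _; rewrite /al; ring.
- by rewrite key.
Qed.

(** Nonnegativity of the unknowns is encoded as extra constraints [- f p <= 0]; their multipliers
    are the slacks that turn the equalities of [farkas_nat] into inequalities. *)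
Lemma farkas (R : realFieldType) (I P : finType) (a : I -> P -> R) (b : I -> R) :
  (exists f : P -> R, (forall p, 0 <= f p) /\ (forall i, \sum_p a i p * f p <= b i)) \/
  (exists l : I -> R, [/\ forall i, 0 <= l i,
      forall p, 0 <= \sum_i l i * a i p & \sum_i l i * b i < 0]).
Proof.
pose n := #|P|.
pose a' (z : I + P) (k : nat) : R :=
  match z with
  | inl i => oapp (fun o : 'I_n => a i (enum_val o)) 0 (insub k)
  | inr p => - ((k == enum_rank p :> nat)%:R)
  end.
have a'E z (o : 'I_n) : a' z o = match z with inl i => a i (enum_val o)
    | inr p => - ((o == enum_rank p)%:R) end.
  by case: z => //= i; rewrite valK.
pose b' (z : I + P) := match z with inl i => b i | inr _ => 0 end.
case: (farkas_nat n a' b') => [[x hx]|[l [l0 la lb]]].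
  left; exists (fun p => x (enum_rank p)); split.
    move=> p; have := hx (inr p); rewrite /= (bigD1 (enum_rank p)) //= eqxx big1 => [|o /negbTE].
      by rewrite addr0 mulN1r oppr_le0.
    by rewrite -val_eqE /= => ->; rewrite oppr0 mul0r.
  move=> i; have := hx (inl i); apply: le_trans.
  rewrite (reindex (@enum_val P P)) /=; last first.
    by exists enum_rank => o _; rewrite ?enum_rankK ?enum_valK.
  apply: eq_leq || (rewrite le_eqVlt; apply/orP; left; apply/eqP).
  by apply: eq_bigr => o _; rewrite valK /= enum_valK.
right; exists (fun i => l (inl i)); split=> //.
  move=> p; have := la (enum_rank p) (ltn_ord _); rewrite big_sumType /=.
  rewrite [X in _ + X](bigD1 p) //= eqxx [X in _ + (_ + X)]big1 => [|q qp].
    rewrite addr0 mulrN1 => /eqP; rewrite subr_eq0 => /eqP h.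
    have -> : \sum_i l (inl i) * a i p = l (inr p); last exact: l0.
    rewrite -h; apply: eq_bigr => i _; by rewrite valK /= enum_rankK.
  by rewrite val_eqE (inj_eq enum_rank_inj) eq_sym (negbTE qp) oppr0 mulr0.
move: lb; rewrite big_sumType /= [X in _ + X]big1 ?addr0 // => p _; exact: mulr0.
Qed.

Section Dual.
Variables (R : realType) (V : finType) (G : vcgraph V).

(** A simple path has at most [#|V|] vertices, so this finite type can index the variables of the
    linear program and the maxima over paths. *)
Definition bpath := (#|V|).-bseq V.

Lemma simple_bpath s : simple_path G s -> exists b : bpath, val b = s.
Proof.
move=> sp; have us : uniq s by case: s sp => //= x p /andP[].
have h : (size s <= #|V|)%N by rewrite -(card_uniqP us) max_card.
by exists (Bseq h).
Qed.

(** Linear programming duality with one variable per short simple path. An infeasibility certificate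
    consists of weights on vertices and edges together with pair potentials; the routing assumed
    cheap for these very weights contradicts it. *)
Lemma routable_dual (D : V -> V -> R) (kap h : R) : demand D ->
  (forall wv we, nneg wv -> nneg we -> exists q : V -> V -> seq V,
     (forall v w, 0 < D v w -> joins G v w (q v w) /\ (plen G (q v w))%:R <= h) /\
     \sum_v \sum_w D v w * pw wv we (q v w) <= kap * wsize G wv we) ->
  routable G D kap h.
Proof.
move=> D0 H.
pose ok (p : bpath) := simple_path G (val p) && ((plen G (val p))%:R <= h).
pose P : finType := {p : bpath | ok p}.
pose a (i : (V * V + V * V) + (V + {set V})) (p : P) : R :=
  match i with
  | inl (inl (v, w)) => (joins G v w (val (val p)))%:R
  | inl (inr (v, w)) => - (joins G v w (val (val p)))%:R
  | inr (inl v) => (v \in val (val p))%:R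
  | inr (inr e) => ((e \in vedges G) && (e \in pedges (val (val p))))%:R
  end.
pose b (i : (V * V + V * V) + (V + {set V})) : R :=
  match i with
  | inl (inl (v, w)) => D v w
  | inl (inr (v, w)) => - D v w
  | inr (inl v) => kap * (vcap G v)%:R
  | inr (inr e) => if e \in vedges G then kap * (ecap G e)%:R else 0
  end.
case: (farkas a b) => [[f [f0 fb]]|[l [l0 la lb]]].
  exists [seq (val (val p), f p) | p <- enum P]; split.
  - by move=> q /mapP[p _ ->] /=; split; [case: p => p /= /andP[]|exact: f0].
  - move=> v w; rewrite big_map big_enum_cond /=.
    have hsp (p : P) : simple_path G (val (val p)) by case: p => p /= /andP[].
    have E : \sum_(p : P | (ohead (val (val p)) == Some v) && (ohead (rev (val (val p))) == Some w)) f p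
       = \sum_p (joins G v w (val (val p)))%:R * f p.
      rewrite big_mkcond; apply: eq_bigr => p _; rewrite /joins hsp /=.
      by case: ifP; rewrite ?mul1r ?mul0r.
    rewrite E; apply: le_anti; rewrite (fb (inl (inl (v, w)))) /=.
    have := fb (inl (inr (v, w))); rewrite /=; under eq_bigr do rewrite mulNr.
    by rewrite sumrN lerN2.
  - split=> [x|e ee]; rewrite big_map big_enum_cond /= big_mkcond /=.
      apply: le_trans (fb (inr (inl x))) => /=; apply: ler_sum => p _.
      by case: ifP; rewrite ?mul1r ?mul0r.
    have := fb (inr (inr e)); rewrite /= ee; apply: le_trans; apply: ler_sum => p _.
    by case: ifP; rewrite ?mul1r ?mul0r.
  - by move=> q /mapP[p _ ->] _ /=; case: p => p /= /andP[].
exfalso.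
pose wv v := l (inr (inl v)).
pose we e := if e \in vedges G then l (inr (inr e)) else 0.
(* The equation for a pair was split into two inequalities; the difference of their multipliers is
   the free dual variable, at most the weight of any admissible path of the pair. *)
pose mu v w := l (inl (inr (v, w))) - l (inl (inl (v, w))).
have we0 : nneg we by move=> e; rewrite /we; case: ifP.
have [q [hq Hq]] := H wv we (fun v => l0 _) we0.
have mule v w : 0 < D v w -> mu v w <= pw wv we (q v w).
  move=> dv; have [jq lq] := hq v w dv.
  have sq := joins_simple jq.
  have [bq ebq] := simple_bpath sq.
  have okq : ok bq by rewrite /ok ebq sq.
  have := la (exist _ bq okq); rewrite big_sumType /= big_sumType /= [X in _ + X]big_sumType /= ebq.
  have uq : uniq (q v w) by case: (q v w) sq => //= x p /andP[].
  have jj v' w' : joins G v' w' (q v w) = ((v', w') == (v, w)).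
    rewrite xpair_eqE; case: (elimT (joins_pathP _ _ _ _) jq) => p [eq pp up lp]; rewrite eq.
    rewrite /joins ohead_rev lp /= pp /=; move: up => /= -> /=.
    by rewrite !(inj_eq (@Some_inj _)) eq_sym [w == _]eq_sym.
  rewrite [X in X + _ + _](bigD1 (v, w)) //= jj eqxx [X in _ + X + _ + _]big1; last first.
    by case=> v' w' ne; rewrite jj (negbTE ne) mulr0.
  rewrite [X in _ + X + _](bigD1 (v, w)) //= jj eqxx [X in _ + (_ + X) + _]big1; last first.
    by case=> v' w' ne; rewrite jj (negbTE ne) oppr0 mulr0.
  have -> : \sum_(i : V) l (inr (inl i)) * (i \in q v w)%:R = \sum_(x <- q v w) wv x.
    rewrite [in RHS]big_uniq //= [in RHS]big_mkcond /=; apply: eq_bigr => x _; by case: ifP; rewrite ?mulr1 ?mulr0.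
  have -> : \sum_i l (inr (inr i)) * ((i \in vedges G) && (i \in pedges (q v w)))%:R
     = \sum_(e <- pedges (q v w)) we e.
    rewrite [in RHS]big_uniq ?pedges_uniq //= [in RHS]big_mkcond /=; apply: eq_bigr => e _.
    by rewrite /we; case: (e \in vedges G); case: (e \in pedges _) => /=; rewrite ?mulr1 ?mulr0.
  rewrite /mu /pw (_ : 1 *- true = -1 :> R) // !addr0; lra.
have : \sum_v \sum_w D v w * mu v w <= kap * wsize G wv we.
  apply: le_trans Hq; apply: ler_sum => v _; apply: ler_sum => w _.
  have := D0 v w; rewrite le_eqVlt => /orP[/eqP<-|dv]; first by rewrite !mul0r.
  by rewrite ler_pM2l // mule.
move: lb; rewrite big_sumType /= big_sumType /= [X in _ + X]big_sumType /=.
have -> : \sum_(i : {set V}) l (inr (inr i)) * (if i \in vedges G then kap * (ecap G i)%:R else 0)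
   = kap * \sum_(e in vedges G) we e * (ecap G e)%:R.
  rewrite mulr_sumr [RHS]big_mkcond /=; apply: eq_bigr => e _; rewrite /we.
  by case: ifP => _; rewrite ?mulr0 //; ring.
have -> : \sum_i l (inr (inl i)) * (kap * (vcap G i)%:R) = kap * \sum_v wv v * (vcap G v)%:R.
  by rewrite mulr_sumr; apply: eq_bigr => v _; rewrite /wv; ring.
rewrite (pair_big predT predT (fun v w => D v w * mu v w)) /=.
have -> : \sum_(p : V * V) D p.1 p.2 * mu p.1 p.2 =
  - \sum_(i : V * V) l (inl (inl i)) * b (inl (inl i)) - \sum_(i : V * V) l (inl (inr i)) * b (inl (inr i)).
  rewrite -opprD -big_split /= -sumrN; apply: eq_bigr => -[v w] _ /=; rewrite /mu; ring.
rewrite /wsize /b; lra.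
Qed.

End Dual.

(** * Rounding in transportation polytopes *)

Lemma dependent_family (F : fieldType) (E C : finType) (a : E -> C -> F) : (#|C| < #|E|)%N ->
  exists d : E -> F, (exists e, d e != 0) /\ forall c, \sum_e d e * a e c = 0.
Proof.
move=> lt; pose A : 'M[F]_(#|E|, #|C|) := \matrix_(i, k) a (enum_val i) (enum_val k).
have : kermx A != 0.
  rewrite kermx_eq0 /row_free neq_ltn; apply/orP; left.
  by apply: leq_ltn_trans lt; exact: rank_leq_col.
case/rowV0Pn => v /sub_kermxP vA v0.
exists (fun e => v 0 (enum_rank e)); split.
  have /existsP [i vi] : [exists i, v 0 i != 0].
    apply: contraNT v0; rewrite negb_exists => /forallP h.
    by apply/eqP/rowP => i; rewrite mxE; apply/eqP; have := h i; rewrite negbK.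
  by exists (enum_val i); rewrite enum_valK.
move=> c; have := congr1 (fun w : 'rV_#|C| => w 0 (enum_rank c)) vA; rewrite !mxE.
rewrite (reindex (@enum_rank E)) /=; last first.
  by exists enum_val => e _; rewrite ?enum_rankK ?enum_valK.
by move=> h; rewrite -[RHS]h; apply: eq_bigr => e _; rewrite mxE !enum_rankK.
Qed.

Section Transport.
Variables (R : realFieldType) (J M : finType).
Implicit Types y d : J -> M -> R.

Definition tsupp y := [set p : J * M | 0 < y p.1 p.2].

(** Zero row sums force a negative entry in [d], so some positive entry of [y] vanishes while moving
    along [d]. The ratio test stops at the first one, which keeps the others nonnegative. *)
Lemma move_to_boundary y d : (forall j m, 0 <= y j m) ->
  (forall j m, d j m != 0 -> 0 < y j m) -> (exists j m, d j m != 0) ->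
  (forall j, \sum_m d j m = 0) ->
  exists t, (forall j m, 0 <= y j m + t * d j m) /\
    tsupp (fun j m => y j m + t * d j m) \proper tsupp y.
Proof.
move=> y0 ds [j1 [m1 d1]] dj.
have [m2 d2] : exists m, d j1 m < 0.
  apply/existsP; apply: contraNT d1; rewrite negb_exists => /forallP h.
  have h' m : true -> 0 <= d j1 m by move=> _; rewrite leNgt.
  by have /eqP := dj j1; rewrite psumr_eq0 // => /allP /(_ m1 (mem_index_enum _)).
have P0 : d (j1, m2).1 (j1, m2).2 < 0 by [].
case: (arg_minP (fun p : J * M => y p.1 p.2 / - d p.1 p.2) (P := fun p => d p.1 p.2 < 0) P0).
case=> j m /= dneg jmin; exists (y j m / - d j m).
have dn : 0 < - d j m by rewrite oppr_gt0.
have t0 : 0 <= y j m / - d j m by rewrite divr_ge0 // ltW.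
split.
  move=> j' m'; case: (ltP (d j' m') 0) => h; last by rewrite addr_ge0 // mulr_ge0.
  have := jmin (j', m') h; rewrite /= ler_pdivlMr ?oppr_gt0 // => hh; lra.
apply/properP; split.
  apply/subsetP => -[j' m']; rewrite !inE /= => h.
  case: (eqVneq (d j' m') 0) => [e|/ds //]; by move: h; rewrite e mulr0 addr0.
exists (j, m); rewrite !inE /=; first by apply: ds; rewrite lt_eqF.
have -> : y j m + y j m / - d j m * d j m = 0 by field; rewrite lt_eqF.
by rewrite ltxx.
Qed.

Lemma card_fibers (T1 T2 : finType) (S : {set T1 * T2}) (A : {set T1}) :
  (forall p, p \in S -> p.1 \in A) ->
  #|S| = (\sum_(a in A) #|[set b | (a, b) \in S]|)%N.
Proof.
move=> SA; rewrite -sum1_card.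
rewrite (eq_bigl (fun p : T1 * T2 => (p.1 \in A) && (p \in S))); last first.
  by move=> p; case h: (p \in S); rewrite ?andbF // (SA _ h).
rewrite (eq_bigl (fun p : T1 * T2 => (p.1 \in A) && ((p.1, p.2) \in S))); last by case.
rewrite -(pair_big_dep (fun a => a \in A) (fun a b => (a, b) \in S) (fun _ _ => 1%N)) /=.
by apply: eq_bigr => a _; rewrite -sum1_card; apply: eq_bigl => b; rewrite inE.
Qed.

(* Lenstra-Shmoys-Tardos: in a vertex of the transportation polytope some job
   or some machine has degree one in the support graph; count edges. *)
Lemma transport_rounding y : (forall j m, 0 <= y j m) ->
  (forall j, \sum_m y j m <= 1) ->
  exists a : J -> option M,
    (forall j, 0 < \sum_m y j m -> exists m, a j = Some m /\ 0 < y j m) /\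
    (forall m, \sum_(j | a j == Some m) \sum_m y j m <= \sum_j y j m + 1).
Proof.
have [n] := ubnP #|tsupp y|; elim: n => // n IH in y *; rewrite ltnS => yn y0 y1.
pose z j0 := (fun j m => if j == j0 then 0 else y j m).
have z0 j0 j m : 0 <= z j0 j m by rewrite /z; case: ifP.
have sz j0 j : \sum_m z j0 j m = if j == j0 then 0 else \sum_m y j m.
  by rewrite /z; case: ifP => // _; rewrite big1.
have z1 j0 j : \sum_m z j0 j m <= 1 by rewrite sz; case: ifP.
have zn j0 m0 : 0 < y j0 m0 -> (#|tsupp (z j0)| < n)%N.
  move=> h; apply: leq_trans yn; apply: proper_card; apply/properP; split.
    by apply/subsetP => -[j m]; rewrite !inE /z /=; case: ifP => //; rewrite ltxx.
  by exists (j0, m0); rewrite !inE /z /= ?eqxx ?ltxx.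
have cz j0 m : \sum_j z j0 j m = \sum_j y j m - y j0 m.
  rewrite (bigD1 j0) //= [in RHS](bigD1 j0) //= /z eqxx add0r addrAC subrr add0r.
  by apply: eq_bigr => j /negbTE ->.
have ext j0 m0 (a : J -> option M) :
    (forall m, \sum_(j | (if j == j0 then Some m0 else a j) == Some m) \sum_m y j m
     = (if m == m0 then \sum_m y j0 m else 0) + \sum_(j | a j == Some m) \sum_m z j0 j m).
  move=> m; rewrite [LHS]big_mkcond (bigD1 j0) //= eqxx (inj_eq Some_inj) eq_sym; congr (_ + _).
  rewrite [RHS]big_mkcond [in RHS](bigD1 j0) //= sz eqxx if_same add0r.
  by apply: eq_bigr => j /negbTE e; rewrite e sz e.
have extp j0 m0 (a : J -> option M) : 0 < y j0 m0 ->
   (forall j, 0 < \sum_m z j0 j m -> exists m, a j = Some m /\ 0 < z j0 j m) ->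
   forall j, 0 < \sum_m y j m ->
     exists m, (if j == j0 then Some m0 else a j) = Some m /\ 0 < y j m.
  move=> ym ha j hj; case: eqP => [->|/eqP ne]; first by exists m0.
  have [|m [am zm]] := ha j; first by rewrite sz (negbTE ne).
  by exists m; split=> //; move: zm; rewrite /z (negbTE ne).
pose uniqmach j m := 0 < y j m /\ forall m', m' != m -> y j m' = 0.
pose uniqjob j m := 0 < y j m /\ forall j', j' != j -> y j' m = 0.
(* A job with a single machine already has its whole mass there, so assigning it adds no load. *)
case: (boolp.pselect (exists j m, uniqmach j m)) => [[j0 [m0 [ym um]]]|no1].
  have [a [ha la]] := IH (z j0) (zn _ _ ym) (z0 j0) (z1 j0).
  exists (fun j => if j == j0 then Some m0 else a j); split; first exact: extp.
  move=> m; rewrite ext; have := la m; rewrite cz.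
  case: eqP => [->|/eqP ne]; last by rewrite (um _ ne); lra.
  rewrite [X in _ -> X + _ <= _](bigD1 m0) //= [X in _ -> _ + X + _ <= _]big1; last by move=> i /um.
  by lra.
(* A machine shared by no other job takes its job at load at most 1. Afterwards no mass is left on
   this machine, so nothing else is assigned to it and the extra 1 is spent once. *)
case: (boolp.pselect (exists j m, uniqjob j m)) => [[j0 [m0 [ym um]]]|no2].
  have [a [ha la]] := IH (z j0) (zn _ _ ym) (z0 j0) (z1 j0).
  exists (fun j => if j == j0 then Some m0 else a j); split; first exact: extp.
  move=> m; rewrite ext; have := la m; rewrite cz.
  case: eqP => [->|/eqP ne]; last by have := y0 j0 m; lra.
  move=> _; rewrite [X in _ + X]big1 ?addr0 => [|j /eqP aj].
    by apply: (le_trans (y1 j0)); rewrite lerDr sumr_ge0.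
  apply/eqP; rewrite eq_le sumr_ge0 // andbT leNgt; apply/negP => /ha [m' []].
  rewrite aj => -[<-]; rewrite /z; case: eqP => [_|/eqP ne]; first by rewrite ltxx.
  by rewrite um // ltxx.
case: (set_0Vmem (tsupp y)) => [s0|[[j1 m1] jm1]].
  have yz j m : y j m = 0.
    apply/eqP; rewrite eq_le y0 andbT leNgt; apply/negP => h.
    by have := in_set0 (j, m); rewrite -s0 inE /= h.
  exists (fun=> None); split=> [j|m]; first by rewrite big1 ?ltxx.
  by rewrite big1 // addr_ge0 // sumr_ge0.
pose AJ := [set j | [exists m, 0 < y j m]].
pose AM := [set m | [exists j, 0 < y j m]].
have degJ j : j \in AJ -> (1 < #|[set m | (j, m) \in tsupp y]|)%N.
  rewrite inE => /existsP [m ym]; rewrite ltnNge; apply/negP => c1.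
  apply: no1; exists j, m; split=> // m' ne; apply/eqP; rewrite eq_le y0 andbT leNgt.
  apply/negP => ym'; move: c1; apply/negP; rewrite -ltnNge.
  have : [set m; m'] \subset [set m | (j, m) \in tsupp y].
    by apply/subsetP => x; rewrite !inE => /orP[/eqP->|/eqP->].
  by move/subset_leq_card; rewrite cards2 eq_sym ne.
have degM m : m \in AM -> (1 < #|[set j | (j, m) \in tsupp y]|)%N.
  rewrite inE => /existsP [j ym]; rewrite ltnNge; apply/negP => c1.
  apply: no2; exists j, m; split=> // m' ne; apply/eqP; rewrite eq_le y0 andbT leNgt.
  apply/negP => ym'; move: c1; apply/negP; rewrite -ltnNge.
  have : [set j; m'] \subset [set j | (j, m) \in tsupp y].
    by apply/subsetP => x; rewrite !inE => /orP[/eqP->|/eqP->].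
  by move/subset_leq_card; rewrite cards2 eq_sym ne.
have c1 : (#|AJ| * 2 <= #|tsupp y|)%N.
  rewrite (@card_fibers _ _ (tsupp y) AJ) => [|p]; last first.
    by rewrite !inE => h; apply/existsP; exists p.2.
  by rewrite -sum_nat_const; apply: leq_sum.
have c2 : (#|AM| * 2 <= #|tsupp y|)%N.
  have -> : #|tsupp y| = #|[set p : M * J | (p.2, p.1) \in tsupp y]|.
    rewrite -(card_imset _ (can_inj (fun p : J * M => let: (a, b) as p0 := p return
      (fun q => (q.2, q.1)) ((fun q => (q.2, q.1)) p0) = p0 in erefl))).
    congr #|pred_of_set _|; apply/setP => -[m j]; rewrite !inE /=; apply/imsetP/idP.
      by case=> -[a b]; rewrite inE /= => h [-> ->].
    by move=> h; exists (j, m); rewrite ?inE.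
  rewrite (@card_fibers _ _ _ AM) => [|p]; last first.
    by rewrite !inE /= => h; apply/existsP; exists p.2.
  rewrite -sum_nat_const; apply: leq_sum => m /degM h.
  by apply: leq_trans h _; apply: subset_leq_card; apply/subsetP => j; rewrite !inE.
have m1A : m1 \in AM by rewrite inE; apply/existsP; exists j1; move: jm1; rewrite inE.
pose E : finType := {p : J * M | p \in tsupp y}.
(* All active degrees are now at least two, so there are at least [#|AJ| + #|AM|] edges. The column
   equation of [m1] follows from the other ones; omitting it makes the equations strictly fewer than
   the edges. *)
pose C : finType := ({j | j \in AJ} + {m | m \in AM :\ m1})%type.
pose A (e : E) (c : C) : R := match c with
  | inl j => ((val e).1 == val j)%:R | inr m => ((val e).2 == val m)%:R end.
have cC : (#|C| < #|E|)%N.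
  have -> : #|C| = (#|AJ| + #|AM :\ m1|)%N by rewrite card_sum !card_sig.
  have -> : #|E| = #|tsupp y| by rewrite card_sig.
  have := cardsD1 m1 AM; rewrite m1A; move: c1 c2.
  by move: #|AJ| #|AM| #|AM :\ m1| #|tsupp y|; clear; lia.
have [d [[e0 de0] dA]] := dependent_family A cC.
pose d' j m : R := oapp d 0 (insub (j, m)).
have d'E e : d' (val e).1 (val e).2 = d e.
  rewrite /d' (_ : (_, _) = val e) ?valK //; by case: e => -[].
have d'0 j m : d' j m != 0 -> 0 < y j m.
  by rewrite /d'; case: insubP => [e|]; rewrite ?eqxx // inE.
have sumd (F : J * M -> R) : \sum_j \sum_m d' j m * F (j, m) = \sum_e d e * F (val e).
  rewrite pair_big /= (bigID (fun p => p \in tsupp y)) /= [X in _ + X]big1 ?addr0.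
    rewrite big_sub /=; apply: eq_bigr => e _; rewrite d'E; congr (_ * F _).
    by case: (val e).
  move=> p np; rewrite [d' _ _](_ : _ = 0) ?mul0r //; apply/eqP; apply: contraNT np.
  by move/d'0; rewrite inE.
have dj j : \sum_m d' j m = 0.
  case jA: (j \in AJ); last first.
    apply: big1 => m _; apply/eqP; apply: contraFT jA => /d'0 h.
    by rewrite inE; apply/existsP; exists m.
  have := dA (inl (exist _ j jA)); rewrite /A /= -(sumd (fun p => (p.1 == j)%:R)) /=.
  rewrite (bigD1 j) //= eqxx [X in _ + X]big1 ?addr0 => [|j' /negbTE ->].
    by under eq_bigr do rewrite mulr1.
  by apply: big1 => m _; rewrite mulr0.
have dm' m : m != m1 -> \sum_j d' j m = 0.
  move=> ne; case mA: (m \in AM :\ m1); last first.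
    apply: big1 => j _; apply/eqP; apply: contraFT mA => /d'0 h.
    by rewrite !inE ne; apply/existsP; exists j.
  have := dA (inr (exist _ m mA)); rewrite /A /= -(sumd (fun p => (p.2 == m)%:R)) /=.
  rewrite exchange_big (bigD1 m) //= eqxx [X in _ + X]big1 ?addr0 => [|j' /negbTE ->].
    by under eq_bigr do rewrite mulr1.
  by apply: big1 => j _; rewrite mulr0.
have dm m : \sum_j d' j m = 0.
  case: (eqVneq m m1) => [->|/dm' //].
  have : \sum_j \sum_m d' j m = 0 by apply: big1.
  by rewrite exchange_big (bigD1 m1) //= [X in _ + X]big1 ?addr0.
have dn : exists j m, d' j m != 0 by exists (val e0).1, (val e0).2; rewrite d'E.
have [t [yt0 ytp]] := move_to_boundary y0 d'0 dn dj.
have rs j : \sum_m (y j m + t * d' j m) = \sum_m y j m.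
  by rewrite big_split /= -mulr_sumr dj mulr0 addr0.
have cs m : \sum_j (y j m + t * d' j m) = \sum_j y j m.
  by rewrite big_split /= -mulr_sumr dm mulr0 addr0.
have [|a [ha la]] := IH (fun j m => y j m + t * d' j m) (leq_trans (proper_card ytp) yn) yt0.
  by move=> j; rewrite rs.
exists a; split.
  move=> j; rewrite -rs => /ha [m [am ym]]; exists m; split=> //.
  have /subsetP := proper_sub ytp; move/(_ (j, m)); rewrite !inE /=; exact.
by move=> m; rewrite -cs; apply: le_trans (la m); apply: ler_sum => j _; rewrite rs.
Qed.

End Transport.

(** * Greedy path packing *)

Section Greedy.
Variables (R : realType) (V : finType) (G : vcgraph V).
Hypothesis wf : vc_wf G.
Let n := #|V|.
Let e0 : R := (2 * n%:R)^-1.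

Definition vload (l : seq (seq V)) x := count (fun W : seq V => x \in W) l.
Definition eload (l : seq (seq V)) e := count (fun W : seq V => e \in pedges W) l.

(** Multiplicative-weights price of a resource of capacity [u] after [k] uses: it starts at 0, grows
    by about 1/u of itself per use, and is below 1 for only O(u log n) uses. *)
Definition cprice (u k : nat) : R := (2 * #|V|%:R)^-1 * ((1 + u%:R^-1) ^+ k - 1).
Definition cv l x := cprice (vcap G x) (vload l x).
Definition ce l e := cprice (ecap G e) (eload l e).

Lemma cprice_ge0 u k : 0 <= cprice u k.
Proof.
rewrite mulr_ge0 ?invr_ge0 ?mulr_ge0 ?ler0n // subr_ge0 exprn_ege1 //.
by rewrite lerDl invr_ge0 ler0n.
Qed.

(** The form of the price is chosen for this identity: one use raises capacity times price by the
    current price plus [e0], so a path of cost below 1 raises the total by a constant. *)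
Lemma cpriceS u k : (0 < u)%N -> u%:R * (cprice u k.+1 - cprice u k) = cprice u k + e0.
Proof.
move=> u0; have : (u%:R : R) != 0 by rewrite pnatr_eq0 -lt0n.
by rewrite /cprice -/n -/e0 exprS => h; field.
Qed.

Lemma cprice_lt1 u k lam : (0 < n)%N -> (2 * n + 1 <= 2 ^ lam)%N -> (0 < u)%N ->
  cprice u k < 1 -> (k < lam * u)%N.
Proof.
move=> n0 hl u0; have up : 0 < (u%:R : R) by rewrite ltr0n.
have np : 0 < 2 * (n%:R : R) by rewrite mulr_gt0 ?ltr0n.
rewrite /cprice -/n mulrC ltr_pdivrMr // mul1r ltNge => h; rewrite ltnNge; apply: contra h => kl.
have b1 : 1 <= 1 + (u%:R : R)^-1 by rewrite lerDl invr_ge0 ltW.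
have b2 : 2 <= (1 + (u%:R : R)^-1) ^+ u.
  have H m : 1 + m%:R * (u%:R : R)^-1 <= (1 + u%:R^-1) ^+ m.
    elim: m => [|m IH]; first by rewrite mul0r addr0 expr0.
    rewrite exprS; apply: le_trans (ler_wpM2l _ IH); last by rewrite (le_trans _ b1).
    rewrite -natr1 mulrDl mul1r mulrDl mul1r mulrDr mulr1.
    have : 0 <= u%:R^-1 * (m%:R * (u%:R : R)^-1) by rewrite !mulr_ge0 ?invr_ge0 ?ler0n.
    lra.
  by apply: le_trans (H u); rewrite divff ?gt_eqF.
rewrite lerBrDr; apply: (@le_trans _ _ (2 ^+ lam)).
  by rewrite -natrX -[2]/(2%:R) -natrM -[1]/(1%:R) -natrD ler_nat.
apply: (@le_trans _ _ ((1 + (u%:R : R)^-1) ^+ (lam * u))); last exact: ler_weXn2l.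
by rewrite mulnC exprM lerXn2r // ?nnegrE ?(le_trans _ b2).
Qed.

Variable P : pred (seq V).
Hypothesis Ps : forall W, P W -> simple_path G W.

(** The most recent path is at the head, so prices at the time of a choice are those of the tail. *)
Fixpoint gvalid (l : seq (seq V)) : Prop :=
  if l is W :: l' then [/\ gvalid l', P W & pw (cv l') (ce l') W < 1] else True.

Lemma cv_ge0 l : nneg (cv l). Proof. by move=> x; apply: cprice_ge0. Qed.
Lemma ce_ge0 l : nneg (ce l). Proof. by move=> x; apply: cprice_ge0. Qed.

Lemma pw_ge_vertex wv we (s : seq V) x : nneg wv -> nneg we -> x \in s ->
  wv x <= pw wv we s :> R.
Proof.
move=> h1 h2 xs; rewrite /pw (big_rem x) //= -addrA lerDl addr_ge0 // sumr_ge0 //.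
Qed.

Lemma pw_ge_edge wv we (s : seq V) e : nneg wv -> nneg we -> e \in pedges s ->
  we e <= pw wv we s :> R.
Proof.
by move=> h1 h2 es; rewrite /pw addrC (big_rem e) //= -addrA lerDl addr_ge0 // sumr_ge0.
Qed.

Lemma simple_path_size s : simple_path G s -> (0 < size s <= n)%N.
Proof.
case: s => // x p /andP[pp up]; rewrite -(card_uniqP up) max_card andbT.
by apply/card_gt0P; exists x; rewrite inE eqxx.
Qed.

Lemma gvalid_load lam l : (2 * n + 1 <= 2 ^ lam)%N -> gvalid l ->
  (forall x, (vload l x <= lam * vcap G x)%N) /\
  (forall e, e \in vedges G -> (eload l e <= lam * ecap G e)%N).
Proof.
move=> hl; case: wf => [_ [wv we]]; elim: l => [|W l IH] /=; first by split.
case=> /IH [l1 l2] PW cW; have /andP[s0 sn] := simple_path_size (Ps PW).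
have n0 : (0 < n)%N by exact: leq_trans sn.
split=> [x|e ee].
  case xW: (x \in W); last by rewrite add0n l1.
  rewrite add1n; apply: (cprice_lt1 n0 hl); first by case: (wv x).
  exact: le_lt_trans (pw_ge_vertex (@cv_ge0 l) (@ce_ge0 l) xW) cW.
case xW: (e \in pedges W); last by rewrite add0n l2.
rewrite add1n; apply: (cprice_lt1 n0 hl); first by case: (we e ee).
exact: le_lt_trans (pw_ge_edge (@cv_ge0 l) (@ce_ge0 l) xW) cW.
Qed.

Lemma load_sum (gv : V -> R) (ge : {set V} -> R) l : (forall W, W \in l -> simple_path G W) ->
  \sum_(W <- l) pw gv ge W =
  \sum_x gv x * (vload l x)%:R + \sum_(e in vedges G) ge e * (eload l e)%:R.
Proof.
elim: l => [|W l IH] h.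
  by rewrite big_nil !big1 ?addr0 // => *; rewrite mulr0.
rewrite big_cons IH => [|W' h']; last by rewrite h // inE h' orbT.
have sW : simple_path G W by rewrite h // inE eqxx.
have uW : uniq W by case: W sW {h} => //= x p /andP[].
rewrite /pw (big_uniq _ uW) (big_uniq _ (pedges_uniq uW)) /=.
under [X in _ = X + _]eq_bigr do rewrite natrD mulrDr.
under [X in _ = _ + X]eq_bigr do rewrite natrD mulrDr.
rewrite !big_split /= [in RHS]addrACA; congr (_ + _ + _).
  by rewrite big_mkcond; apply: eq_bigr => x _; case: ifP; rewrite ?mulr1 ?mulr0.
rewrite big_mkcond [RHS]big_mkcond; apply: eq_bigr => e _.
case: ifP => [h1|]; last by rewrite mulr0 if_same.
by rewrite (pedges_vedges sW h1) mulr1.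
Qed.

(** Double counting: each chosen path weighs at least 1, and a resource is used at most [lam] times
    its capacity. A small gamma thus leaves few heavy paths, which is what shrinks the next
    level. *)
Lemma gvalid_size lam l gv ge : (2 * n + 1 <= 2 ^ lam)%N -> gvalid l -> nneg gv -> nneg ge ->
  (forall W, P W -> 1 <= pw gv ge W) ->
  (size l)%:R <= lam%:R * wsize G gv ge :> R.
Proof.
move=> hl vl g0 g1 hP; have [l1 l2] := gvalid_load hl vl.
have aP W : W \in l -> P W.
  by elim: l vl {l1 l2} => //= W' l IH [vl PW _]; rewrite inE => /orP[/eqP->|/IH]; [|exact].
apply: (@le_trans _ _ (\sum_(W <- l) pw gv ge W)).
  rewrite -sum1_size natr_sum big_seq [leRHS]big_seq; apply: ler_sum => W /aP; exact: hP.
rewrite load_sum => [|W /aP/Ps //]; rewrite /wsize mulrDr !mulr_sumr; apply: lerD.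
  by apply: ler_sum => x _; rewrite mulrCA ler_wpM2l // -natrM ler_nat.
by apply: ler_sum => e ee; rewrite mulrCA ler_wpM2l // -natrM ler_nat l2.
Qed.

(** The part of capacity times price at [x] caused by path [t], read off from [cpriceS];
    [drop t.+1 l] lists the paths chosen before it. *)
Definition shv (l : seq (seq V)) (t : nat) x : R :=
  if x \in nth [::] l t then cv (drop t.+1 l) x + (2 * #|V|%:R)^-1 else 0.
Definition she (l : seq (seq V)) (t : nat) e : R :=
  if e \in pedges (nth [::] l t) then ce (drop t.+1 l) e + (2 * #|V|%:R)^-1 else 0.

Lemma e0_ge0 : 0 <= e0. Proof. by rewrite invr_ge0 mulr_ge0 ?ler0n. Qed.

Lemma shv_ge0 l t : nneg (shv l t).
Proof. by move=> x; rewrite /shv; case: ifP => // _; rewrite addr_ge0 ?cv_ge0 ?e0_ge0. Qed.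
Lemma she_ge0 l t : nneg (she l t).
Proof. by move=> x; rewrite /she; case: ifP => // _; rewrite addr_ge0 ?ce_ge0 ?e0_ge0. Qed.

Lemma sum_shv l x : \sum_(t < size l) shv l t x = (vcap G x)%:R * cv l x.
Proof.
elim: l => [|W l IH]; first by rewrite big_ord0 /cv /cprice /= subrr !mulr0.
rewrite big_ord_recl /= IH /shv /= drop0.
have u0 : (0 < vcap G x)%N by case: wf => _ [h _]; case: (h x).
rewrite /cv /=; case: ifP => _; rewrite ?add0r ?add0n //.
by rewrite add1n -/n -/e0 -cpriceS //; ring.
Qed.

Lemma sum_she l e : e \in vedges G -> \sum_(t < size l) she l t e = (ecap G e)%:R * ce l e.
Proof.
move=> ee; elim: l => [|W l IH]; first by rewrite big_ord0 /ce /cprice /= subrr !mulr0.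
rewrite big_ord_recl /= IH /she /= drop0.
have u0 : (0 < ecap G e)%N by case: wf => _ [_ h]; case: (h e ee).
rewrite /ce /=; case: ifP => _; rewrite ?add0r ?add0n //.
by rewrite add1n -/n -/e0 -cpriceS //; ring.
Qed.

Lemma gvalid_mem l W : gvalid l -> W \in l -> P W.
Proof. by elim: l => //= W' l IH [/IH vl PW _]; rewrite inE => /orP[/eqP->|]. Qed.

Lemma gvalid_drop l t : gvalid l -> gvalid (drop t l).
Proof. by elim: l t => [|W l IH] [|t] //= [/IH]. Qed.

(** The price of the path was below 1, and the [e0] terms add at most 1/2 over its vertices and 1/2
    over its edges. *)
Lemma share_le2 l t : gvalid l -> (t < size l)%N ->
  \sum_x shv l t x + \sum_(e in vedges G) she l t e <= 2.
Proof.
move=> vl tl; have := gvalid_drop t vl; rewrite (drop_nth [::] tl) /=.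
set W := nth _ _ _; case=> _ PW cW; have sW := Ps PW.
have uW : uniq W by case: (W) sW => //= x p /andP[].
have /andP[s0 sn] := simple_path_size sW.
have n0 : 0 < 2 * (n%:R : R) by rewrite mulr_gt0 ?ltr0n // (leq_trans s0).
have E1 : \sum_x shv l t x = \sum_(x <- W) (cv (drop t.+1 l) x + e0).
  rewrite (big_uniq _ uW) [RHS]big_mkcond; apply: eq_bigr => x _.
  by rewrite /shv -/W -/n -/e0.
have E2 : \sum_(e in vedges G) she l t e = \sum_(e <- pedges W) (ce (drop t.+1 l) e + e0).
  rewrite (big_uniq _ (pedges_uniq uW)) big_mkcond [RHS]big_mkcond; apply: eq_bigr => e _.
  rewrite /she -/W -/n -/e0; case: ifP => h; last by case: ifP => // h'; rewrite (pedges_vedges sW h') in h.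
  by [].
have sz : (size (pedges W) <= n)%N.
  apply: leq_trans sn; rewrite /pedges; case: (W) => // x p; by rewrite size_pairmap /= ltnW.
have cst (T : eqType) (t' : seq T) : \sum_(x <- t') e0 = (size t')%:R * e0.
  by rewrite big_const_seq count_predT iter_addr_0 mulr_natl.
rewrite E1 E2 !big_split /= !cst.
have h1 : (size W)%:R * e0 <= 2^-1.
  by rewrite ler_pdivrMr //; move: sn; rewrite -(ler_nat R) -/n; lra.
have h2 : (size (pedges W))%:R * e0 <= 2^-1.
  by rewrite ler_pdivrMr //; move: sz; rewrite -(ler_nat R); lra.
move: cW; rewrite /pw; lra.
Qed.

(** Every path has a vertex, so [gvalid_size] with unit vertex weights bounds all valid lists and
    the greedy extension must stop. *)
Lemma greedy_maximal lam : (2 * n + 1 <= 2 ^ lam)%N ->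
  exists l, gvalid l /\ forall W, P W -> 1 <= pw (cv l) (ce l) W.
Proof.
move=> hl; pose m := (lam * \sum_x vcap G x)%N.
have bnd l : gvalid l -> (size l <= m)%N.
  move=> vl; rewrite -(ler_nat R).
  have H W : P W -> 1 <= pw (fun=> 1 : R) (fun=> 0) W.
    move=> /Ps /simple_path_size; rewrite /pw [X in _ + X]big1 ?addr0 //.
    by rewrite big_const_seq count_predT iter_addr_0 -[1]/(1%:R) ler_nat; case/andP.
  apply: (le_trans (gvalid_size hl vl (fun=> ler01) (fun=> lexx 0) H)).
  rewrite /wsize [X in _ + X]big1 => [|e _]; last by rewrite mul0r.
  rewrite addr0 /m natrM natr_sum ler_wpM2l //; apply: ler_sum => x _; by rewrite mul1r.
suff H k l : gvalid l -> (m - size l <= k)%N ->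
    exists l, gvalid l /\ forall W, P W -> 1 <= pw (cv l) (ce l) W.
  by apply: (H m [::]) => //; rewrite subn0.
elim: k l => [|k IH] l vl hk.
  exists l; split=> // W PW; rewrite leNgt; apply/negP => c1.
  have := bnd (W :: l) (And3 vl PW c1); rewrite /= ltnNge; move: hk; rewrite leqn0 subn_eq0.
  by move=> ->.
case: (boolp.pselect (exists W, P W /\ pw (cv l) (ce l) W < 1)) => [[W [PW c1]]|no].
  by apply: (IH (W :: l)) => //=; rewrite subnS -subn1 leq_subLR add1n.
exists l; split=> // W PW; rewrite leNgt; apply/negP => c1; apply: no; by exists W.
Qed.

End Greedy.

(* A group is named by one of the vertices. *)
Record groups (V : finType) := Groups {
  grp : V -> option V;
  gpath : V -> seq V;
  gcap : V -> nat }.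

(** * Groups, and the rounding of greedy paths into groups *)

Section Groups.
Variables (R : realType) (V : finType) (G : vcgraph V).
Hypothesis wf : vc_wf G.

Definition used (D : groups V) (g : V) := [exists x, grp D x == Some g].

(** One-vertex paths count as short whatever the length of the vertex: the vertex groups of level 0
    must qualify at every scale, and no edge is ever walked on them. *)
Definition short_path (r : R) (W : seq V) : bool :=
  (size W == 1%N) || ((plen G W)%:R <= r).

Definition groups_ok (Lam r : R) (D : groups V) : Prop :=
  [/\ forall g, used D g ->
        [/\ simple_path G (gpath D g), short_path r (gpath D g) & (0 < gcap D g)%N],
      forall x g, grp D x = Some g -> x \in gpath D g,
      forall y, \sum_(g | used D g && (y \in gpath D g)) (gcap D g)%:R <= Lam * (vcap G y)%:R
    & forall e, e \in vedges G ->
        \sum_(g | used D g && (e \in pedges (gpath D g))) (gcap D g)%:R <= Lam * (ecap G e)%:R].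

Definition gtotal (D : groups V) : R := \sum_(g | used D g) (gcap D g)%:R.

Definition vertex_groups : groups V := Groups Some (fun v => [:: v]) (vcap G).

Lemma vertex_groups_ok r : groups_ok 1 r vertex_groups.
Proof.
split=> [g _|x g [->]|y|e ee] /=.
- by split=> //; case: wf => _ [h _]; case: (h g).
- by rewrite inE.
- rewrite mul1r (big_pred1 y) // => g /=; rewrite inE eq_sym.
  rewrite (_ : used _ _) //; by apply/existsP; exists g.
- rewrite big1 ?mulr_ge0 // => g /andP[] //.
Qed.

(** Capacity times price around [x]. Up to a factor 2 it bounds the flow that the forward mapping
    attaches to the next level at [x], so group capacities are measured against it. *)
Definition sdem (l : seq (seq V)) x : R :=
  (vcap G x)%:R * cv R G l x + \sum_(e in vedges G | x \in e) (ecap G e)%:R * ce R G l e.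

Definition share (l : seq (seq V)) t x : R :=
  shv R G l t x + \sum_(e in vedges G | x \in e) she R G l t e.

Lemma share_ge0 l t x : 0 <= share l t x.
Proof. by rewrite addr_ge0 ?shv_ge0 // sumr_ge0 // => e _; rewrite she_ge0. Qed.

Lemma sum_share l x : \sum_(t < size l) share l t x = sdem l x.
Proof.
rewrite big_split /= sum_shv // exchange_big /=; congr (_ + _).
by apply: eq_bigr => e /andP[ee _]; rewrite sum_she.
Qed.

Lemma share_supp l t x : 0 < share l t x -> x \in nth [::] l t.
Proof.
apply: contraTT => xW; rewrite /share /shv (negbTE xW) add0r -leNgt.
rewrite big1 // => e /andP[_ xe]; rewrite /she; case: ifP => // h.
by rewrite (pedges_mem h xe) in xW.
Qed.

Variables (P : pred (seq V)) (l : seq (seq V)) (lam : nat) (r : R).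
Hypotheses (Ps : forall W, P W -> simple_path G W) (vl : gvalid R G P l).
Hypotheses (hl : (2 * #|V| + 1 <= 2 ^ lam)%N) (Pshort : forall W, P W -> short_path r W).

Lemma share_total t : (t < size l)%N -> \sum_x share l t x <= 4.
Proof.
move=> tl; have := share_le2 Ps vl tl; rewrite big_split /=.
have -> : \sum_x \sum_(e in vedges G | x \in e) she R G l t e =
    2 * \sum_(e in vedges G) she R G l t e.
  rewrite mulr_sumr (exchange_big_dep (fun e => e \in vedges G)) /=; last by move=> x e _ /andP[].
  apply: eq_bigr => e ee; under eq_bigl do rewrite ee /=.
  rewrite sumr_const; case: wf => [h _]; by rewrite (h e ee) mulr_natl.
have : 0 <= \sum_x shv R G l t x by rewrite sumr_ge0 // => x _; rewrite shv_ge0.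
lra.
Qed.

(** Vertices of demand at least 1 form groups of their own; the others are sent to greedy paths by
    transportation rounding, with the shares as fractional assignment. In 26, path groups account
    for 10 per path and single vertices for 4 times 4, since their demand is at most 4 per path
    through them. *)
Lemma round_groups : exists D : groups V,
  [/\ groups_ok (26 * lam%:R) r D,
      forall x, 0 < sdem l x -> grp D x <> None,
      forall g, used D g -> \sum_(x | grp D x == Some g) 2 * sdem l x <= (gcap D g)%:R
    & gtotal D <= 26 * (size l)%:R].
Proof.
pose s := sdem l.
have s0 x : 0 <= s x by rewrite /s -sum_share sumr_ge0 // => t _; apply: share_ge0.
have sh4 t x : (t < size l)%N -> share l t x <= 4.
  move=> tl; apply: le_trans (share_total tl).
  by rewrite (bigD1 x) //= lerDl sumr_ge0 // => ? _; apply: share_ge0.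
pose y x (t : 'I_(size l)) := if s x < 1 then share l t x else 0.
have y0 x t : 0 <= y x t by rewrite /y; case: ifP => // _; apply: share_ge0.
have ys x : \sum_t y x t = if s x < 1 then s x else 0.
  by rewrite /y; case: ifP => _; rewrite ?sum_share ?big1.
have [|a [ha la]] := transport_rounding y0.
  by move=> x; rewrite ys; case: ifP => // /ltW.
pose sm x := (0 < s x) && (s x < 1).
have smP x : sm x -> exists t, a x = Some t /\ x \in nth [::] l t.
  case/andP=> p q; have [|t [at_ yt]] := ha x; first by rewrite ys q.
  by exists t; split=> //; move: yt; rewrite /y q; apply: share_supp.
(* 4 is the total share of a path and 1 the loss of the rounding; twice this gives the capacity 10
   below. *)
have sma (t : 'I_(size l)) : \sum_(x | sm x && (a x == Some t)) s x <= 5.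
  apply: (@le_trans _ _ (\sum_(x | a x == Some t) \sum_t y x t)).
    rewrite big_mkcond [leRHS]big_mkcond; apply: ler_sum => x _; rewrite ys /sm.
    by case: (a x == _); rewrite ?andbF // andbT; case: (s x < 1); rewrite ?andbF // andbT; case: ifP.
  apply: (le_trans (la t)); rewrite (_ : 5 = 4 + 1); last by lra.
  rewrite lerD2r; apply: le_trans (share_total (ltn_ord t)); apply: ler_sum => x _.
  by rewrite /y; case: ifP => // _; apply: share_ge0.
(* A path group is named by a canonical small vertex assigned to the same path. Its name determines
   the path through [a], and distinct names give distinct paths ([usm_inj]). *)
pose D : groups V := Groups
  (fun x => if s x <= 0 then None else if s x < 1 then [pick z | sm z && (a z == a x)] else Some x)
  (fun g => if s g < 1 then oapp (fun t : 'I_(size l) => nth [::] l t) [:: g] (a g) else [:: g])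
  (fun g => if s g < 1 then 10%N else (2 * (Num.truncn (s g)).+1)%N).
have grpP x g : grp D x = Some g ->
    (sm x /\ [pick z | sm z && (a z == a x)] = Some g /\ (sm g && (a g == a x))) \/ (1 <= s x /\ g = x).
  rewrite /=; case: (leP (s x) 0) => [//|h1]; case: (ltP (s x) 1) => [h2|h2 [<-]]; last by right.
  case: pickP => // z hz [<-]; left; by rewrite /sm h1 h2.
have used_cases g : used D g -> 
    (sm g /\ [pick z | sm z && (a z == a g)] = Some g) \/ 1 <= s g.
  case/existsP=> x /eqP /grpP [[sx [px /andP[sg /eqP ag]]]|[h ->]]; last by right.
  by left; split=> //; rewrite ag.
have usm_inj g g' : used D g -> used D g' -> s g < 1 -> s g' < 1 -> a g = a g' -> g = g'.
  case/used_cases => [[_ p1]|]; last by rewrite leNgt => /negbTE ->.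
  case/used_cases => [[_ p2]|]; last by move=> h _; rewrite ltNge h.
  by move=> _ _ e; rewrite e p2 in p1; case: p1.
have capB g : 1 <= s g -> 2 * s g <= (2 * (Num.truncn (s g)).+1)%N%:R <= 4 * s g.
  move=> h; have /andP[t1 t2] := truncn_itv (s0 g).
  by rewrite natrM -natr1 in t2 *; apply/andP; split; lra.
have sumsm (F : 'I_(size l) -> R) : (forall t, 0 <= F t) ->
    \sum_(g | used D g && (s g < 1)) oapp F 0 (a g) <= \sum_t F t.
  move=> F0; have -> : \sum_(g | used D g && (s g < 1)) oapp F 0 (a g) =
     \sum_(g | used D g && (s g < 1)) \sum_(t | a g == Some t) F t.
    apply: eq_bigr => g _; case: (a g) => [t|] /=; last by rewrite big1.
    by rewrite (big_pred1 t) // => t'; rewrite (inj_eq Some_inj) eq_sym.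
  rewrite (exchange_big_dep predT) //=; apply: ler_sum => t _.
  case: (pickP (fun g => used D g && (s g < 1) && (a g == Some t))) => [g0 h0|no]; last first.
    by rewrite big_pred0.
  rewrite (big_pred1 g0) // => g; apply/idP/eqP => [|->//].
  case/andP: h0 => /andP[u0 l0] /eqP a0 /andP[/andP[u1 l1] /eqP a1].
  by apply: usm_inj => //; rewrite a0.
have big_s y' : s y' <= 4 * (vload l y')%:R.
  rewrite /s -sum_share /vload -sum1_count natr_sum mulr_sumr (big_nth [::]) big_mkord.
  rewrite [leRHS]big_mkcond; apply: ler_sum => t _; case: ifP => [_|/negbT h].
    by rewrite mulr1 sh4.
  by rewrite leNgt; apply: contra h; apply: share_supp.
have [vld eld] := gvalid_load wf Ps hl vl.
have vcnt y' : \sum_(t < size l) (y' \in nth [::] l t)%:R = (vload l y')%:R :> R.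
  rewrite /vload /eload -sum1_count natr_sum (big_nth [::]) big_mkord [RHS]big_mkcond.
  by apply: eq_bigr => t _; case: ifP.
have ecnt e : \sum_(t < size l) (e \in pedges (nth [::] l t))%:R = (eload l e)%:R :> R.
  rewrite /vload /eload -sum1_count natr_sum (big_nth [::]) big_mkord [RHS]big_mkcond.
  by apply: eq_bigr => t _; case: ifP.
have Pl t : (t < size l)%N -> P (nth [::] l t).
  by move=> tl; apply: gvalid_mem vl _; apply: mem_nth.
exists D; split.
- split.
  + move=> g /used_cases [[sg _]|h] /=; last first.
      rewrite ltNge h /=; split=> //.
    have [t [at_ gt]] := smP g sg; case/andP: sg => _ ->; rewrite at_ /=.
    by split=> //; [apply: Ps|apply: Pshort]; apply: Pl.
  + move=> x g /grpP [[sx [_ /andP[sg /eqP ag]]]|[h ->]] /=; last by rewrite ltNge h inE.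
    have [t [at_ xt]] := smP x sx; case/andP: sg => _ ->; by rewrite ag at_.
  + move=> y'; rewrite (bigID (fun g => s g < 1)) /=.
    apply: (@le_trans _ _ (10 * (vload l y')%:R + 4 * (4 * (vload l y')%:R))); last first.
      have : (vload l y')%:R <= lam%:R * (vcap G y')%:R :> R by rewrite -natrM ler_nat.
      lra.
    apply: lerD.
      apply: (@le_trans _ _ (\sum_(g | used D g && (s g < 1)) oapp (fun t : 'I_(size l) => 10 * (y' \in nth [::] l t)%:R) 0 (a g))).
        rewrite big_mkcond [leRHS]big_mkcond; apply: ler_sum => g _.
        case ug: (used D g) => //=; case sg: (s g < 1); rewrite ?andbF // andbT.
        have [[smg _]|] := used_cases g ug; last by rewrite leNgt sg.
        have [t [at_ gt]] := smP g smg; rewrite at_ /=; by case: ifP; rewrite ?mulr1 ?mulr0.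
      apply: (le_trans (sumsm _ _)); first by move=> t; rewrite mulr_ge0.
      by rewrite -mulr_sumr vcnt.
    apply: (@le_trans _ _ (\sum_(g | g == y') 4 * s g)); last by rewrite big_pred1_eq ler_wpM2l.
    rewrite big_mkcond [leRHS]big_mkcond; apply: ler_sum => g _.
    case sg: (s g < 1); rewrite ?andbF /=; first by case: ifP => // _; rewrite mulr_ge0.
    rewrite andbT inE [y' == g]eq_sym; case: ifP => [/andP[_ ->]|_].
      by have /capB/andP[] : 1 <= s g by rewrite leNgt sg.
    by case: ifP => // _; rewrite mulr_ge0.
  + move=> e ee; rewrite (bigID (fun g => s g < 1)) /=.
    apply: (@le_trans _ _ (10 * (eload l e)%:R + 0)); last first.
      have : (eload l e)%:R <= lam%:R * (ecap G e)%:R :> R by rewrite -natrM ler_nat eld.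
      have : 0 <= (eload l e)%:R :> R by [].
      lra.
    apply: lerD.
      apply: (@le_trans _ _ (\sum_(g | used D g && (s g < 1)) oapp (fun t : 'I_(size l) => 10 * (e \in pedges (nth [::] l t))%:R) 0 (a g))).
        rewrite big_mkcond [leRHS]big_mkcond; apply: ler_sum => g _.
        case ug: (used D g) => //=; case sg: (s g < 1); rewrite ?andbF // andbT.
        have [[smg _]|] := used_cases g ug; last by rewrite leNgt sg.
        have [t [at_ gt]] := smP g smg; rewrite at_ /=; by case: ifP; rewrite ?mulr1 ?mulr0.
      apply: (le_trans (sumsm _ _)); first by move=> t; rewrite mulr_ge0.
      by rewrite -mulr_sumr ecnt.
    rewrite big1 // => g /andP[/andP[_]]; by move=> h /negbTE sg; move: h; rewrite sg.
- move=> x; rewrite -/(s x) => sx /=; rewrite leNgt sx /=; case: ltP => // h.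
  by case: pickP => // /(_ x); rewrite /sm sx h eqxx.
- move=> g ug; have [[smg pg]|h] := used_cases g ug => /=.
    have [t [at_ gt]] := smP g smg; case/andP: (smg) => _ sg1; rewrite sg1 -mulr_sumr.
    suff : \sum_(x | grp D x == Some g) s x <= 5 by rewrite /s; lra.
    apply: le_trans (sma t); rewrite big_mkcond [leRHS]big_mkcond; apply: ler_sum => x _.
    case: ifP => [/eqP /grpP [[sx [_ /andP[_ /eqP ag]]]|[h e]]|_].
    + by rewrite sx -ag at_ eqxx.
    + by move: sg1; rewrite e ltNge h.
    + by case: ifP.
  rewrite ltNge h /=; have /andP[+ _] := capB g h; apply: le_trans.
  rewrite (big_pred1 g) // => x; apply/idP/eqP => [/eqP /grpP [[sx [_ /andP[/andP[_ sg] _]]]|[_ ->]] //|->].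
    by move: sg; rewrite ltNge h.
  by rewrite /= leNgt (lt_le_trans ltr01 h) /= ltNge h.
- rewrite /gtotal (bigID (fun g => s g < 1)) /=.
  apply: (@le_trans _ _ (10 * (size l)%:R + 4 * (4 * (size l)%:R))); last by lra.
  apply: lerD.
    apply: (@le_trans _ _ (\sum_(g | used D g && (s g < 1)) oapp (fun t : 'I_(size l) => 10) 0 (a g))).
      apply: ler_sum => g /andP[ug sg]; rewrite sg.
      have [[smg _]|] := used_cases g ug; last by rewrite leNgt sg.
      by have [t [-> gt]] := smP g smg.
    apply: (le_trans (sumsm _ _)) => //.
    by rewrite sumr_const card_ord mulr_natr.
  apply: (@le_trans _ _ (\sum_g 4 * s g)).
    rewrite big_mkcond; apply: ler_sum => g _; case: ifP => [/andP[_ sg]|_]; last by rewrite mulr_ge0.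
    rewrite (negbTE sg); by have /capB/andP[] : 1 <= s g by rewrite leNgt.
  rewrite -mulr_sumr ler_wpM2l //; under eq_bigr do rewrite /s -sum_share.
  rewrite exchange_big /= -[in leRHS](card_ord (size l)) -sum1_card natr_sum mulr_sumr.
  apply: ler_sum => t _; rewrite mulr1; exact: share_total.
Qed.

End Groups.

(** * The kernel potential *)

(** Compactness is avoided: if no point were minimal up to [eta], descending by [eta] again and
    again would make [F] negative. *)
Lemma near_minimum (R : realType) (T : Type) (ok : T -> Prop) (F : T -> R) (x0 : T) (eta : R) :
  ok x0 -> (forall x, ok x -> 0 <= F x) -> 0 < eta ->
  exists x, ok x /\ forall y, ok y -> F x <= F y + eta.
Proof.
move=> ok0 F0 e0; apply: boolp.contrapT => no.
have step x : ok x -> exists y, ok y /\ F y <= F x - eta.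
  move=> okx; apply: boolp.contrapT => nx; apply: no; exists x; split=> // y oky.
  rewrite leNgt; apply/negP => h; apply: nx; exists y; split=> //; lra.
have it m : exists y, ok y /\ F y <= F x0 - m%:R * eta.
  elim: m => [|m [y [oky hy]]]; first by exists x0; rewrite mul0r subr0.
  have [z [okz hz]] := step y oky; exists z; split=> //.
  apply: (le_trans hz); rewrite -natr1 mulrDl; lra.
have [y [oky hy]] := it (Num.truncn (F x0 / eta)).+1.
have := F0 y oky; have q0 : 0 <= F x0 / eta by rewrite divr_ge0 ?F0 // ltW.
have /andP[_] := truncn_itv q0; rewrite ltr_pdivrMr // => h1 h2; lra.
Qed.

Section PathWeight.
Variables (R : realType) (V : finType) (G : vcgraph V).

Lemma plen_pw (s : seq V) :
  (plen G s)%:R = pw (fun v => (vlen G v)%:R : R) (fun e => (elen G e)%:R) s.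
Proof. by rewrite /plen /pw natrD !natr_sum. Qed.

Lemma pwD (wv wv' : V -> R) we we' (s : seq V) :
  pw (fun x => wv x + wv' x) (fun e => we e + we' e) s = pw wv we s + pw wv' we' s.
Proof. by rewrite /pw !big_split /= addrACA. Qed.

Lemma pwZ (a : R) wv we (s : seq V) :
  pw (fun x => a * wv x) (fun e => a * we e) s = a * pw wv we s.
Proof. by rewrite /pw -!mulr_sumr mulrDr. Qed.

Lemma wsizeD (wv wv' : V -> R) we we' :
  wsize G (fun x => wv x + wv' x) (fun e => we e + we' e) = wsize G wv we + wsize G wv' we'.
Proof.
rewrite /wsize; under eq_bigr do rewrite mulrDl.
under [X in _ + X]eq_bigr do rewrite mulrDl.
by rewrite !big_split /= addrACA.
Qed.

Lemma wsizeZ (a : R) wv we :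
  wsize G (fun x => a * wv x) (fun e => a * we e) = a * wsize G wv we.
Proof.
rewrite /wsize; under eq_bigr do rewrite -mulrA.
under [X in _ + X]eq_bigr do rewrite -mulrA.
by rewrite -!mulr_sumr mulrDr.
Qed.

Lemma wsize_ge0 (wv : V -> R) we : nneg wv -> nneg we -> 0 <= wsize G wv we.
Proof. by move=> h1 h2; rewrite addr_ge0 // sumr_ge0 // => *; rewrite mulr_ge0. Qed.

(* weight of the part of W within distance one of v along W *)
Definition Gam (wv : V -> R) (we : {set V} -> R) (W : seq V) (v : V) : R :=
  wv v + \sum_(e <- pedges W | v \in e) (we e + \sum_(x in e) wv x).

Lemma Gam_ge0 wv we W : nneg wv -> nneg we -> nneg (Gam wv we W).
Proof.
move=> h1 h2 v; rewrite addr_ge0 // sumr_ge0 // => e _; by rewrite addr_ge0 // sumr_ge0.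
Qed.

Lemma GamD wv wv' we we' W v :
  Gam (fun x => wv x + wv' x) (fun e => we e + we' e) W v = Gam wv we W v + Gam wv' we' W v.
Proof.
rewrite /Gam addrACA -big_split /=; congr (_ + _); apply: eq_bigr => e _.
by rewrite big_split /= addrACA.
Qed.

Lemma GamZ a wv we W v :
  Gam (fun x => a * wv x) (fun e => a * we e) W v = a * Gam wv we W v.
Proof.
rewrite /Gam mulrDr mulr_sumr; congr (_ + _); apply: eq_bigr => e _.
by rewrite mulrDr mulr_sumr.
Qed.

Lemma sum_pedges_ends (wv : V -> R) (s : seq V) : nneg wv ->
  \sum_(e <- pedges s) \sum_(x in e) wv x <= 2 * \sum_(x <- s) wv x.
Proof.
move=> h; case: s => [|x p]; first by rewrite !big_nil mulr0.
suff : \sum_(e <- pedges (x :: p)) \sum_(x in e) wv x <= 2 * \sum_(x <- x :: p) wv x - wv x.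
  by have := h x; lra.
elim: p x => [|y p IH] x; first by rewrite big_nil big_seq1; have := h x; lra.
rewrite [pedges _]/= big_cons [X in _ <= 2 * X - _]big_cons.
have := IH y; rewrite /=.
have : \sum_(z in [set x; y]) wv z <= wv x + wv y.
  case: (eqVneq x y) => [->|ne]; last by rewrite big_setU1 ?inE //= big_set1.
  by rewrite setUid big_set1 lerDl.
lra.
Qed.

(** Each edge is seen from its two ends and carries the weights of both ends; a vertex is thereby
    counted 1 + 4 times and an edge twice. *)
Lemma sum_Gam wv we W : nneg wv -> nneg we -> vc_wf G -> simple_path G W ->
  \sum_v (v \in W)%:R * Gam wv we W v <= 5 * pw wv we W.
Proof.
move=> h1 h2 wf sW; have uW : uniq W by case: W sW => //= x p /andP[].
have -> : \sum_v (v \in W)%:R * Gam wv we W v = \sum_(v <- W) Gam wv we W v.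
  by rewrite (big_uniq _ uW) [RHS]big_mkcond; apply: eq_bigr => v _; case: ifP; rewrite ?mul1r ?mul0r.
rewrite /Gam big_split /= /pw.
suff : \sum_(v <- W) \sum_(e <- pedges W | v \in e) (we e + \sum_(x in e) wv x) <=
   2 * (\sum_(e <- pedges W) we e + \sum_(e <- pedges W) \sum_(x in e) wv x).
  have := sum_pedges_ends W h1.
  have : 0 <= \sum_(e <- pedges W) we e by rewrite sumr_ge0.
  have : 0 <= \sum_(v <- W) wv v by rewrite sumr_ge0.
  lra.
rewrite -big_split mulr_sumr /= (exchange_big_dep predT) //= big_seq [leRHS]big_seq.
apply: ler_sum => e eW; rewrite -big_filter big_const_seq count_predT iter_addr_0.
rewrite mulr_natl; apply: ler_wpMn2l; first by rewrite addr_ge0 ?sumr_ge0.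
case: wf => he _; rewrite -(he e (pedges_vedges sW eW)).
have uf : uniq [seq v <- W | v \in e] by rewrite filter_uniq.
rewrite -(card_uniqP uf); apply: subset_leq_card; apply/subsetP => x.
by rewrite mem_filter => /andP[].
Qed.

End PathWeight.

Section Kernel.
Variables (R : realType) (V : finType) (G : vcgraph V).
Hypothesis wf : vc_wf G.
Variables (b r kap Lam rr : R) (D : groups V).
Hypotheses (b0 : 0 < b) (r0 : 0 < r) (kap0 : 0 < kap) (Dok : groups_ok G Lam rr D).

Definition capsum : R := \sum_y (vcap G y)%:R.

Definition omg (gv : V -> R) ge (p : seq V) : R := (plen G p)%:R / r + pw gv ge p.

(** This is exp(- b dist) for the metric [omg]. As a maximum over paths it gives 0 to unreachable
    pairs, with no infinite distance. *)
Definition kern gv ge v y : R :=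
  \big[Num.max/0]_(p : bpath V | joins G v y p) expR (- (b * omg gv ge p)).

Definition Zk gv ge v : R := 1 + \sum_y (vcap G y)%:R * kern gv ge v y.

(** Each group puts one unit of source at the head of its path, and at every vertex of the path an
    amount equal to the gamma-weight around it; the second part serves paths that are heavy in
    gamma. *)
Definition srcA gv ge v : R :=
  \sum_(g | used D g) (gcap D g)%:R *
     ((ohead (gpath D g) == Some v)%:R + (v \in gpath D g)%:R * Gam gv ge (gpath D g) v).

Definition potential gv ge : R :=
  kap * wsize G gv ge + b^-1 * \sum_v srcA gv ge v * ln (Zk gv ge v).

Lemma omg_ge0 gv ge p : nneg gv -> nneg ge -> 0 <= omg gv ge p.
Proof. by move=> h1 h2; rewrite addr_ge0 ?pw_ge0 // divr_ge0 // ltW. Qed.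

Lemma omg_pw gv ge p : omg gv ge p =
  pw (fun v => r^-1 * (vlen G v)%:R + gv v) (fun e => r^-1 * (elen G e)%:R + ge e) p.
Proof. by rewrite pwD pwZ -plen_pw mulrC. Qed.

Lemma kern_ge gv ge v y p : joins G v y p -> expR (- (b * omg gv ge p)) <= kern gv ge v y.
Proof.
move=> jp; have [q eq_] := simple_bpath (joins_simple jp).
by rewrite -eq_; apply: (le_bigmax_cond _ (fun q : bpath V => expR (- (b * omg gv ge (val q))))); rewrite /= eq_.
Qed.

Lemma kern_le gv ge v y (m : R) : 0 <= m ->
  (forall p, joins G v y p -> expR (- (b * omg gv ge p)) <= m) -> kern gv ge v y <= m.
Proof. by move=> m0 h; apply: bigmax_le => // p; apply: h. Qed.

Lemma kern_ge0 gv ge v y : 0 <= kern gv ge v y.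
Proof. exact: bigmax_ge_id. Qed.

Lemma kern_le1 gv ge v y : nneg gv -> nneg ge -> kern gv ge v y <= 1.
Proof.
move=> h1 h2; apply: kern_le => // p _; rewrite -[leRHS]expR0 ler_expR oppr_le0.
by rewrite mulr_ge0 ?omg_ge0 // ltW.
Qed.

Lemma best_path gv ge v y : (exists p, joins G v y p) ->
  exists p, joins G v y p /\ forall q, joins G v y q -> omg gv ge p <= omg gv ge q.
Proof.
case=> p jp; have [q eq_] := simple_bpath (joins_simple jp); rewrite -eq_ in jp.
case: (arg_minP (fun q : bpath V => omg gv ge q) (P := fun q : bpath V => joins G v y q) jp).
move=> i ji imin; exists i; split=> // s js.
have [t et] := simple_bpath (joins_simple js); rewrite -et in js *; exact: imin.
Qed.

Lemma kern_best gv ge v y p : joins G v y p ->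
  (forall q, joins G v y q -> omg gv ge p <= omg gv ge q) ->
  kern gv ge v y = expR (- (b * omg gv ge p)).
Proof.
move=> jp pm; apply/le_anti; rewrite kern_ge // andbT; apply: kern_le; first exact: expR_ge0.
by move=> q /pm h; rewrite ler_expR lerN2 ler_pM2l.
Qed.

Lemma kern_none gv ge v y : ~ (exists p, joins G v y p) -> kern gv ge v y = 0.
Proof.
move=> no; apply/le_anti; rewrite kern_ge0 andbT; apply: kern_le => // p jp.
by case: no; exists p.
Qed.

Lemma Zk_ge1 gv ge v : 1 <= Zk gv ge v.
Proof. by rewrite lerDl sumr_ge0 // => y _; rewrite mulr_ge0 ?kern_ge0. Qed.

Lemma Zk_le gv ge v : nneg gv -> nneg ge -> Zk gv ge v <= 1 + capsum.
Proof.
move=> h1 h2; rewrite lerD2l; apply: ler_sum => y _.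
by rewrite ler_piMr // kern_le1.
Qed.

Lemma lnZ_ge0 gv ge v : 0 <= ln (Zk gv ge v).
Proof. by rewrite ln_ge0 // Zk_ge1. Qed.

Lemma capsum_ge0 : 0 <= capsum.
Proof. by rewrite sumr_ge0. Qed.

Lemma lnZ_le gv ge v : nneg gv -> nneg ge -> ln (Zk gv ge v) <= ln (1 + capsum).
Proof.
move=> h1 h2; rewrite ler_ln ?Zk_le // posrE.
  by apply: lt_le_trans (Zk_ge1 _ _ _).
by have := capsum_ge0; lra.
Qed.

Lemma srcA_ge0 gv ge v : nneg gv -> nneg ge -> 0 <= srcA gv ge v.
Proof.
move=> h1 h2; rewrite sumr_ge0 // => g _.
by rewrite mulr_ge0 // addr_ge0 // mulr_ge0 // Gam_ge0.
Qed.

Lemma potential_ge0 gv ge : nneg gv -> nneg ge -> 0 <= potential gv ge.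
Proof.
move=> h1 h2; rewrite addr_ge0 //; first by rewrite mulr_ge0 ?wsize_ge0 // ltW.
rewrite mulr_ge0 ?invr_ge0 ?(ltW b0) // sumr_ge0 // => v _.
by rewrite mulr_ge0 ?srcA_ge0 ?lnZ_ge0.
Qed.

Lemma sum_heads : \sum_v \sum_(g | used D g) (gcap D g)%:R * (ohead (gpath D g) == Some v)%:R
  = gtotal R D.
Proof.
rewrite exchange_big /=; apply: eq_bigr => g ug; rewrite -mulr_sumr.
case: Dok => /(_ g ug) [+ _ _] _ _ _; case: (gpath D g) => // x p _ /=.
rewrite (bigD1 x) //= eqxx big1 ?addr0 ?mulr1 // => v ne.
by rewrite (inj_eq Some_inj) eq_sym (negbTE ne).
Qed.

Lemma sum_group_weight wv we : nneg wv -> nneg we ->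
  \sum_(g | used D g) (gcap D g)%:R * pw wv we (gpath D g) <= Lam * wsize G wv we.
Proof.
move=> h1 h2; case: Dok => ok _ l1 l2.
have E g : used D g -> pw wv we (gpath D g) =
    \sum_x wv x * (x \in gpath D g)%:R + \sum_(e in vedges G) we e * (e \in pedges (gpath D g))%:R.
  move=> ug; have [sp _ _] := ok g ug.
  have := @load_sum R V G wv we [:: gpath D g]; rewrite big_seq1 => ->; last by move=> W; rewrite inE => /eqP->.
  by rewrite /vload /eload /=; congr (_ + _); apply: eq_bigr => x _; rewrite addn0.
have -> : \sum_(g | used D g) (gcap D g)%:R * pw wv we (gpath D g) =
   \sum_x wv x * \sum_(g | used D g && (x \in gpath D g)) (gcap D g)%:R +
   \sum_(e in vedges G) we e * \sum_(g | used D g && (e \in pedges (gpath D g))) (gcap D g)%:R.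
  transitivity (\sum_(g | used D g) (\sum_x (gcap D g)%:R * (wv x * (x \in gpath D g)%:R) + \sum_(e in vedges G) (gcap D g)%:R * (we e * (e \in pedges (gpath D g))%:R))).
    by apply: eq_bigr => g ug; rewrite E // mulrDr !mulr_sumr.
  rewrite big_split /=; congr (_ + _).
    rewrite exchange_big /=; apply: eq_bigr => x _.
    rewrite mulr_sumr big_mkcondr /=; apply: eq_bigr => g _.
    by case: ifP; rewrite ?mulr1 ?mulr0 // mulrC.
  rewrite exchange_big /=; apply: eq_bigr => x _.
  rewrite mulr_sumr big_mkcondr /=; apply: eq_bigr => g _.
  by case: ifP; rewrite ?mulr1 ?mulr0 // mulrC.
rewrite /wsize mulrDr !mulr_sumr; apply: lerD; apply: ler_sum => x hx; rewrite mulrCA ler_wpM2l //.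
exact: l2.
Qed.

Lemma srcA_perturb gv ge wv we t v :
  srcA (fun x => gv x + t * wv x) (fun e => ge e + t * we e) v = srcA gv ge v +
  t * \sum_(g | used D g) (gcap D g)%:R * ((v \in gpath D g)%:R * Gam wv we (gpath D g) v).
Proof.
rewrite /srcA mulr_sumr -big_split /=; apply: eq_bigr => g _.
rewrite GamD GamZ; ring.
Qed.

Lemma sum_Gam_groups wv we : nneg wv -> nneg we ->
  \sum_v \sum_(g | used D g) (gcap D g)%:R * ((v \in gpath D g)%:R * Gam wv we (gpath D g) v)
  <= 5 * (Lam * wsize G wv we).
Proof.
move=> h1 h2; apply: le_trans (ler_wpM2l _ (sum_group_weight h1 h2)); last by [].
rewrite exchange_big mulr_sumr /=; apply: ler_sum => g ug; rewrite -mulr_sumr mulrCA.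
rewrite ler_wpM2l //; apply: (sum_Gam h1 h2 wf); by case: Dok => /(_ g ug) [].
Qed.

Lemma expR_le_half (x : R) : 0 <= x <= 1 -> expR (- x) <= 1 - x / 2.
Proof.
case/andP=> x0 x1; have px : 0 < 1 - x / 2 by lra.
have h := expR_ge1Dx x; have e0 := expR_gt0 x.
rewrite expRN -[leLHS]mul1r ler_pdivrMr //.
apply: (@le_trans _ _ ((1 - x / 2) * (1 + x))); last by rewrite ler_pM2l.
nra.
Qed.

(** Comparing with the zero weight bounds the size of gamma. Comparing with gamma + t w makes the
    kernel-averaged cost in w at most the derivative of the size term plus the change of the
    sources; the optimality defect 1/b contributes the summand 1. *)
Lemma near_minimizer : exists gv ge, [/\ nneg gv, nneg ge,
    kap * wsize G gv ge <= (ln (1 + capsum) * gtotal R D + 1) / b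
  & forall wv we, nneg wv -> nneg we -> exists P' : V -> V -> seq V,
     (forall v y, (exists p, joins G v y p) -> joins G v y (P' v y) /\
        forall p, joins G v y p -> omg gv ge (P' v y) <= omg gv ge p + b^-1) /\
     \sum_v srcA gv ge v *
        (\sum_y (vcap G y)%:R * kern gv ge v y / Zk gv ge v * pw wv we (P' v y))
     <= 2 * (kap + 5 * Lam * ln (1 + capsum) / b + 1) * wsize G wv we].
Proof.
pose ok (g : (V -> R) * ({set V} -> R)) := nneg g.1 /\ nneg g.2.
have ok0 : ok (fun=> 0, fun=> 0) by split=> ? /=.
have bi : 0 < b^-1 by rewrite invr_gt0.
have [[gv ge] [[/= g0 g1] gmin]] := @near_minimum R _ ok (fun g => potential g.1 g.2) _ _ ok0
   (fun g h => potential_ge0 h.1 h.2) bi.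
exists gv, ge; split=> //.
  have h0 : potential (fun=> 0) (fun=> 0) <= b^-1 * (ln (1 + capsum) * gtotal R D).
    rewrite /potential /wsize [X in kap * (X + _)]big1 => [|v _]; last by rewrite mul0r.
    rewrite [X in kap * (_ + X)]big1 => [|v _]; last by rewrite mul0r.
    rewrite addr0 mulr0 add0r ler_pM2l // -sum_heads mulr_sumr.
    apply: ler_sum => v _; rewrite mulrC.
    have -> : srcA (fun=> 0) (fun=> 0) v =
       \sum_(g | used D g) (gcap D g)%:R * (ohead (gpath D g) == Some v)%:R.
      apply: eq_bigr => g _; rewrite /Gam add0r big1 ?mulr0 ?addr0 // => e _.
      by rewrite add0r big1.
    apply: ler_wpM2r; first by rewrite sumr_ge0 // => g _; rewrite mulr_ge0.
    by rewrite lnZ_le // => x; rewrite lexx.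
  have h := gmin _ ok0; rewrite /= in h.
  apply: (@le_trans _ _ (potential gv ge)).
    rewrite lerDl mulr_ge0 ?(ltW bi) // sumr_ge0 // => v _.
    by rewrite mulr_ge0 ?srcA_ge0 ?lnZ_ge0.
  apply: (le_trans h); rewrite [leRHS]mulrC mulrDr mulr1 lerD2r; exact: h0.
move=> wv we w0 w1; set w := wsize G wv we.
have ww : 0 <= w by apply: wsize_ge0.
(* The largest step for which b t times the weight of any simple path is at most 1, as
   [expR_le_half] requires. It also keeps paths optimal after the perturbation within 1/b of optimal
   before it. *)
pose t := (b * w)^-1.
have t0 : 0 <= t by rewrite invr_ge0 mulr_ge0 // ltW.
pose gv' x := gv x + t * wv x; pose ge' e := ge e + t * we e.
have g0' : nneg gv' by move=> x; rewrite addr_ge0 // mulr_ge0.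
have g1' : nneg ge' by move=> x; rewrite addr_ge0 // mulr_ge0.
have /boolp.choice [P' hP'] (q : V * V) : exists s, (exists p, joins G q.1 q.2 p) ->
    joins G q.1 q.2 s /\ forall p, joins G q.1 q.2 p -> omg gv' ge' s <= omg gv' ge' p.
  case: (boolp.pselect (exists p, joins G q.1 q.2 p)) => [e|ne]; last by exists [::].
  by have [s hs] := best_path gv' ge' e; exists s.
have omg' p : omg gv' ge' p = omg gv ge p + t * pw wv we p.
  by rewrite /omg pwD pwZ addrA.
have bt p : simple_path G p -> 0 <= b * (t * pw wv we p) <= 1.
  move=> sp; have pp := pw_simple w0 w1 wf sp; rewrite -/w in pp.
  have p0 := @pw_ge0 R V wv we p w0 w1.
  apply/andP; split; first by rewrite !mulr_ge0 // ltW.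
  rewrite /t invfM !mulrA divff ?gt_eqF // mul1r.
  case: (eqVneq w 0) => [->|wn]; first by rewrite invr0 mul0r.
  have wp : 0 < w by rewrite lt_neqAle eq_sym wn.
  by rewrite mulrC ler_pdivrMr // mul1r.
exists (fun v y => P' (v, y)); split.
  move=> v y ex; have [j1 m1] := hP' (v, y) ex; split=> // p jp.
  have := m1 p jp; rewrite !omg' => h.
  have /andP[h1 h2] := bt _ (joins_simple jp); have /andP[h3 _] := bt _ (joins_simple j1).
  move: h3; rewrite pmulr_rge0 // => h3.
  have h4 : t * pw wv we p <= b^-1 by rewrite -[leRHS]mul1r ler_pdivlMr // mulrC.
  lra.
pose Pi v := \sum_y (vcap G y)%:R * kern gv ge v y / Zk gv ge v * pw wv we (P' (v, y)).
rewrite -/(Pi _).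
have pP v y : 0 <= pw wv we (P' (v, y)) by apply: pw_ge0.
have Pi0 v : 0 <= Pi v.
  rewrite sumr_ge0 // => y _; rewrite mulr_ge0 // divr_ge0 //.
    by rewrite mulr_ge0 ?kern_ge0.
  exact: le_trans (Zk_ge1 _ _ _).
have Zp v : 0 < Zk gv ge v by apply: lt_le_trans (Zk_ge1 _ _ _).
have kk v y : kern gv' ge' v y <= kern gv ge v y * (1 - b * t * pw wv we (P' (v, y)) / 2).
  case: (boolp.pselect (exists p, joins G v y p)) => [ex|ne]; last first.
    by rewrite !kern_none // mul0r.
  have [j1 m1] := hP' (v, y) ex; rewrite (kern_best j1 m1) omg' mulrDr opprD expRD.
  apply: ler_pM; [exact: expR_ge0|exact: expR_ge0|exact: kern_ge|].
  by rewrite -[b * t * _]mulrA; apply: expR_le_half; rewrite bt // (joins_simple j1).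
have ZZ v : ln (Zk gv' ge' v) <= ln (Zk gv ge v) - b * t * Pi v / 2.
  have h : Zk gv' ge' v <= Zk gv ge v * (1 - b * t * Pi v / 2).
    have -> : Zk gv ge v * (1 - b * t * Pi v / 2) =
      1 + \sum_y (vcap G y)%:R * (kern gv ge v y * (1 - b * t * pw wv we (P' (v, y)) / 2)).
      rewrite mulrBr mulr1 {1}/Zk -addrA; congr (_ + _).
      rewrite /Pi !(mulr_sumr, mulr_suml) -sumrB; apply: eq_bigr => y _.
      by have := Zp v; move: (Zk gv ge v) => Z Z0; field; rewrite gt_eqF.
    rewrite lerD2l; apply: ler_sum => y _; by rewrite ler_wpM2l.
  have h1 : 0 < 1 - b * t * Pi v / 2.
    rewrite -(pmulr_rgt0 _ (Zp v)); apply: lt_le_trans h; exact: lt_le_trans (Zk_ge1 _ _ _).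
  apply: (@le_trans _ _ (ln (Zk gv ge v * (1 - b * t * Pi v / 2)))).
    rewrite ler_ln // posrE; first exact: lt_le_trans (Zk_ge1 _ _ _).
    by rewrite mulr_gt0.
  rewrite lnM ?posrE // lerD2l; apply: le_ln1Dx; lra.
pose B v := \sum_(g | used D g) (gcap D g)%:R * ((v \in gpath D g)%:R * Gam wv we (gpath D g) v).
have B0 v : 0 <= B v by rewrite sumr_ge0 // => g _; rewrite !mulr_ge0 // Gam_ge0.
have BB : \sum_v B v <= 5 * (Lam * w) by apply: sum_Gam_groups.
have /(gmin (gv', ge')) : ok (gv', ge') by [].
rewrite /= /potential wsizeD wsizeZ -/w => main.
set L1 := ln (1 + capsum) in main *.
have L10 : 0 <= L1 by rewrite ln_ge0 // lerDl capsum_ge0.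
(* A discrete product rule: the drop of ln Z is weighted by the old sources, and the growth of the
   sources by the uniform bound [L1] on the new ln Z. *)
have s1 : \sum_v srcA gv' ge' v * ln (Zk gv' ge' v) <=
   \sum_v srcA gv ge v * ln (Zk gv ge v) - b * t / 2 * \sum_v srcA gv ge v * Pi v
   + t * L1 * (5 * (Lam * w)).
  apply: (@le_trans _ _ (\sum_v srcA gv ge v * ln (Zk gv ge v) - b * t / 2 * \sum_v srcA gv ge v * Pi v
   + t * L1 * \sum_v B v)); last by rewrite lerD2l ler_wpM2l // mulr_ge0.
  rewrite !mulr_sumr -sumrB -big_split /=; apply: ler_sum => v _.
  rewrite srcA_perturb -/(B v) mulrDl; apply: lerD.
    have := ler_wpM2l (srcA_ge0 v g0 g1) (ZZ v); lra.
  rewrite -!mulrA ler_wpM2l // mulrC ler_wpM2r // lnZ_le //.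
(* If w = 0 then t is 0 and the comparison is void, but all simple paths have weight 0. *)
case: (eqVneq w 0) => [wz|wn].
  have pz p : simple_path G p -> pw wv we p = 0.
    move=> sp; apply/le_anti; rewrite pw_ge0 // andbT -wz; exact: pw_simple.
  rewrite wz mulr0 big1 // => v _; rewrite /Pi big1 ?mulr0 // => y _.
  case: (boolp.pselect (exists p, joins G v y p)) => [ex|ne]; last first.
    by rewrite kern_none // mulr0 !mul0r.
  by have [j1 _] := hP' (v, y) ex; rewrite pz ?mulr0 // (joins_simple j1).
have wp : 0 < w by rewrite lt_neqAle eq_sym wn.
have s2 := ler_wpM2l (ltW bi) s1.
set S := \sum_v srcA gv ge v * Pi v in s2 *.
set X := \sum_v srcA gv ge v * ln (Zk gv ge v) in main s2.
have e1 : b^-1 * (b * t / 2 * S) = t * S / 2 by field; rewrite gt_eqF.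
have s3 : t * (S / 2) <= t * (kap * w + 5 * Lam * L1 / b * w + w).
  have e2 : b^-1 * (X - b * t / 2 * S + t * L1 * (5 * (Lam * w))) =
     b^-1 * X - t * S / 2 + t * (5 * Lam * L1 / b * w) by field; rewrite gt_eqF.
  have e3 : t * w = b^-1 by rewrite /t; field; rewrite !gt_eqF.
  rewrite e2 in s2.
  have -> : t * (kap * w + 5 * Lam * L1 / b * w + w) =
     t * (kap * w) + t * (5 * Lam * L1 / b * w) + b^-1 by rewrite -e3; ring.
  move: main s2.
  have -> : kap * (wsize G gv ge + t * w) = kap * wsize G gv ge + t * (kap * w) by ring.
  by rewrite mulrA; lra.
have tp : 0 < t by rewrite invr_gt0 mulr_gt0.
move: s3; rewrite ler_pM2l // => s3.
have -> : 2 * (kap + 5 * Lam * L1 / b + 1) * w = 2 * (kap * w + 5 * Lam * L1 / b * w + w) by ring.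
lra.
Qed.

End Kernel.

(** * Sparse covers *)

Section Cover.
Variables (R : realType) (V : finType) (near : R -> V -> V -> bool) (q : R) (K : nat).
Hypotheses (near_sym : forall a x y, near a x y -> near a y x)
  (near_tri : forall a b x y z, near a x y -> near b y z -> near (a + b) x z)
  (near_le : forall a b x y, a <= b -> near a x y -> near b x y)
  (near_refl : forall a x y, near a x y -> near a x x)
  (q1 : 1 <= q) (qK : #|V|%:R <= q ^+ K).

(** [near] need not be reflexive: a one-vertex path has the weight of its vertex. Hence the
    conditions [near 2 x x] below. *)
Definition nball v (i : nat) := [set x | near (2 * i.+1%:R) v x].

Lemma nball_mono v i j : (i <= j)%N -> nball v i \subset nball v j.
Proof.
move=> ij; apply/subsetP => x; rewrite !inE; apply: near_le.
by rewrite ler_wpM2l // ler_nat ltnS.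
Qed.

Lemma nball_step v i x y : near 2 x y -> x \in nball v i -> y \in nball v i.+1.
Proof.
move=> xy; rewrite !inE => vx; have := near_tri vx xy; apply: near_le.
by rewrite -(natr1 i.+1) mulrDr mulr1.
Qed.

(** If the ball grew by more than [q] at each of the K + 1 steps, it would exceed [#|V|]. A step
    spans two radii: one for the cluster around the core, one for the buffer. *)
Lemma slow_growth (U : {set V}) v : near 2 v v -> v \in U ->
  exists m, (m < K.+1)%N /\
    #|U :&: nball v (2 * m).+2|%:R <= q * #|U :&: nball v (2 * m)|%:R.
Proof.
move=> vv vU; apply: boolp.contrapT => no.
have h m : (m < K.+1)%N -> q ^+ m.+1 < #|U :&: nball v (2 * m.+1)|%:R.
  have st k : (k < K.+1)%N ->
     q * #|U :&: nball v (2 * k)|%:R < #|U :&: nball v (2 * k.+1)|%:R.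
    move=> kK; rewrite mulnS add2n ltNge; apply/negP => hh; apply: no; by exists k.
  elim: m => [|m IH] mK.
    apply: le_lt_trans (st 0%N mK); rewrite expr1 muln0 ler_peMr ?(le_trans _ q1) //.
    rewrite ler1n card_gt0; apply/set0Pn; exists v; by rewrite !inE vU mulr1 vv.
  apply: le_lt_trans (st m.+1 mK); rewrite exprS ler_wpM2l ?(le_trans _ q1) //.
  by apply/ltW/IH; apply: ltn_trans mK.
have := h K (ltnSn _); rewrite ltNge => /negP; apply.
apply: (@le_trans _ _ #|V|%:R); first by rewrite ler_nat max_card.
by apply: (le_trans qK); rewrite exprS ler_peMl // exprn_ge0 // (le_trans _ q1).
Qed.

(** Ball growing. The core of a ball is served, the next layer completes its cluster, and the buffer
    layer is given up for this phase. [Y] holds the vertices still free for clusters; the buffer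
    keeps all neighbours of the remaining [U] inside it. *)
Lemma cluster_phase (U Y : {set V}) :
  (forall x, x \in U -> near 2 x x) ->
  (forall x y, x \in U -> near 2 x y -> y \in Y) ->
  exists (cl : V -> option V) (S : {set V}),
    [/\ S \subset U, #|U|%:R <= q * #|S|%:R,
        forall x y, x \in S -> near 2 x y -> exists s, cl x = Some s /\ cl y = Some s,
        forall x s, cl x = Some s -> near (4 * K.+1%:R) s x /\ near 2 s s
      & forall x, cl x <> None -> x \in Y].
Proof.
have [N] := ubnP #|U|; elim: N => // N IH in U Y *; rewrite ltnS => UN Ur UY.
case: (set_0Vmem U) => [U0|[v vU]].
  exists (fun=> None), set0; split=> //; first by rewrite sub0set.
    by rewrite U0 cards0 mulr0.
  by move=> x y; rewrite inE.
have [m [mK grow]] := slow_growth (Ur v vU) vU; set i := (2 * m)%N in grow.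
pose U1 := U :\: nball v i.+2; pose Y1 := Y :\: nball v i.+1.
have U1N : (#|U1| < N)%N.
  apply: leq_trans UN; apply: proper_card; apply/properP; split; first exact: subsetDl.
  exists v => //; rewrite !inE vU andbT negbK; apply: near_le (Ur v vU).
  by rewrite ler_peMr // ler1n.
have [||cl [S [SU US clS cln clY]]] := IH U1 Y1 U1N.
- by move=> x; rewrite inE => /andP[_ /Ur].
- move=> x y; rewrite inE => /andP[xB xU] xy; rewrite inE (UY x y) // andbT.
  by apply: contra xB => yB; apply: nball_step yB; apply: near_sym.
pose c := Y :&: nball v i.+1.
exists (fun x => if x \in c then Some v else cl x), ((U :&: nball v i) :|: S); split.
- by rewrite subUset subsetIl (subset_trans SU) // subsetDl.
- have dis : [disjoint U :&: nball v i & S].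
    rewrite -setI_eq0; apply/eqP/setP => x; rewrite in_set0; apply/negbTE/negP.
    rewrite in_setI => /andP[/setIP[_ xB] /(subsetP SU)].
    by rewrite inE (subsetP (nball_mono v (leqW (leqnSn i))) _ xB).
  rewrite cardsU (_ : _ :&: S = set0) ?cards0 ?subn0; last by apply/eqP; rewrite setI_eq0.
  rewrite natrD mulrDr -(cardsID (nball v i.+2) U) natrD; apply: lerD => //.
- move=> x y; rewrite inE => /orP[/setIP[xU xB]|xS] xy.
    exists v; rewrite !in_setI (UY x) ?(Ur x) //= (UY x) //=.
    by rewrite (subsetP (nball_mono v (leqnSn i)) _ xB) (nball_step xy xB).
  have [s [ex ey]] := clS x y xS xy; exists s.
  have nx z : cl z = Some s -> (z \in c) = false.
    move=> ez; have : z \in Y1 by apply: clY; rewrite ez.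
    by rewrite /c !inE => /andP[/negbTE -> _]; rewrite andbF.
  by rewrite !nx.
- move=> x s; case: ifP => [|_ /cln //]; rewrite inE => /andP[_]; rewrite inE => h [<-].
  split; last exact: Ur; apply: near_le h.
  rewrite -[4]/(4%:R) -[2]/(2%:R) -!natrM ler_nat; move: mK; rewrite /i; clear; lia.
- move=> x; case: ifP => [|_ /clY]; first by rewrite inE => /andP[].
  by rewrite inE => /andP[].
Qed.

(** Each phase serves a fraction 1/q of the vertices still waiting, so fewer than one vertex is left
    after [C] phases. *)
Lemma cluster_cover (C : nat) : #|V|%:R * (1 - q^-1) ^+ C < 1 ->
  exists cls : nat -> V -> option V,
    (forall x y, near 2 x y -> exists k s, [/\ (k < C)%N, cls k x = Some s & cls k y = Some s]) /\
    (forall k x s, cls k x = Some s -> near (4 * K.+1%:R) s x /\ near 2 s s).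
Proof.
move=> hC.
have q0 : 0 < q by apply: lt_le_trans q1.
have qi : 0 <= 1 - q^-1 by rewrite subr_ge0 invf_le1.
suff H c : exists (cls : nat -> V -> option V) (U : {set V}),
    [/\ #|U|%:R <= #|V|%:R * (1 - q^-1) ^+ c,
        forall x y, near 2 x y -> x \notin U ->
          exists k s, [/\ (k < c)%N, cls k x = Some s & cls k y = Some s]
      & forall k x s, cls k x = Some s -> near (4 * K.+1%:R) s x /\ near 2 s s].
  have [cls [U [hU hc hn]]] := H C; exists cls; split=> // x y xy; apply: hc xy _.
  have : #|U|%:R < 1 :> R by apply: le_lt_trans hC.
  by rewrite -[1]/(1%:R) ltr_nat ltnS leqn0 cards_eq0 => /eqP ->; rewrite inE.
elim: c => [|c [cls [U [hU hc hn]]]].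
  exists (fun _ _ => None), setT; split=> //; first by rewrite cardsT expr0 mulr1.
  by move=> x y _; rewrite inE.
pose U' := [set x in U | near 2 x x].
have [||cl [S [SU US clS cln _]]] := @cluster_phase U' setT.
- by move=> x; rewrite inE => /andP[].
- by move=> x y; rewrite inE.
exists (fun k => if k == c then cl else cls k), (U' :\: S); split.
- have -> : #|U' :\: S|%:R = #|U'|%:R - #|S|%:R :> R.
    rewrite -(cardsID S U') natrD (setIidPr SU); ring.
  rewrite exprSr mulrA; apply: (@le_trans _ _ (#|U'|%:R * (1 - q^-1))).
    have : #|U'|%:R / q <= #|S|%:R :> R by rewrite ler_pdivrMr // mulrC.
    lra.
  rewrite ler_wpM2r //; apply: le_trans hU; rewrite ler_nat subset_leq_card //.
  by apply/subsetP => x; rewrite inE => /andP[].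
- move=> x y xy; rewrite inE negb_and negbK inE (near_refl xy) andbT => h.
  case/orP: h => [xS|xU].
    have [s [h1 h2]] := clS x y xS xy; exists c, s; by rewrite eqxx.
  have [k [s [kc h1 h2]]] := hc x y xy xU; exists k, s.
  by rewrite (ltn_eqF kc) ltnS ltnW.
- by move=> k x s; case: ifP => _; [exact: cln|exact: hn].
Qed.

End Cover.

(** * Embedding stars over clusters *)

Section Ports.
Variables (R : realType) (V : finType) (G : vcgraph V).

(* weight of a walk, its first vertex excluded: this makes it additive *)
Definition tw (wv : V -> R) (we : {set V} -> R) (x : V) (p : seq V) : R :=
  \sum_(z <- p) wv z + \sum_(e <- pedges (x :: p)) we e.

Lemma pw_tw wv we x p : pw wv we (x :: p) = wv x + tw wv we x p.
Proof. by rewrite /pw big_cons addrA. Qed.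

Lemma tw_ge0 wv we x p : nneg wv -> nneg we -> 0 <= tw wv we x p.
Proof. by move=> h1 h2; rewrite addr_ge0 // sumr_ge0. Qed.

Lemma tw_cat wv we x p q : tw wv we x (p ++ q) = tw wv we x p + tw wv we (last x p) q.
Proof. by rewrite /tw pedges_cat !big_cat /= addrACA. Qed.

Lemma tw_nil wv we x : tw wv we x [::] = 0.
Proof. by rewrite /tw !big_nil addr0. Qed.

Lemma tw_cons wv we x y p : tw wv we x (y :: p) = wv y + we [set x; y] + tw wv we y p.
Proof. by rewrite /tw /= !big_cons addrACA. Qed.

Lemma tw_le_pw wv we x p : nneg wv -> tw wv we x p <= pw wv we (x :: p).
Proof. by move=> h; rewrite pw_tw lerDr. Qed.

Definition subwalk (W : seq V) x p : Prop :=
  [/\ path (vadj G) x p, uniq (x :: p), {subset x :: p <= W} & {subset pedges (x :: p) <= pedges W}].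

Lemma subwalk_suffix A x B : simple_path G (A ++ x :: B) -> subwalk (A ++ x :: B) x B.
Proof.
move=> sp; split.
- case: A sp => [|a A] /= /andP[]; first by [].
  by rewrite cat_path /= => /and3P[].
- by case: A sp => [|a A] /andP[_] //; rewrite cat_uniq => /and3P[].
- by move=> z; rewrite mem_cat => ->; rewrite orbT.
- move=> e; case: A sp => [|a A] _ //; rewrite cat_cons pedges_cat mem_cat /= inE => ->.
  by rewrite !orbT.
Qed.

Lemma subwalk_rev W x p : subwalk (rev W) x p -> subwalk W x p.
Proof.
case=> h1 h2 h3 h4; split=> // z; first by move=> /h3; rewrite mem_rev.
by move=> /h4; rewrite (perm_mem (pedges_rev W)).
Qed.

Lemma subwalk_prefix W x p q : subwalk W x (p ++ q) -> subwalk W x p.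
Proof.
case=> h1 h2 h3 h4; split.
- by move: h1; rewrite cat_path => /andP[].
- by move: h2; rewrite -cat_cons cat_uniq => /andP[].
- by move=> z zp; apply: h3; rewrite -cat_cons mem_cat zp.
- by move=> e ep; apply: h4; rewrite pedges_cat mem_cat ep.
Qed.

Lemma simple_rev (W : seq V) : simple_path G W -> simple_path G (rev W).
Proof.
case: W => // x p sp; have : joins G x (last x p) (x :: p) by rewrite /joins sp ohead_rev !eqxx.
by move/joins_sym/joins_simple.
Qed.

Lemma walk_prefix_to (x : V) (p : seq V) z :
  z \in x :: p -> exists p1 p2, p = p1 ++ p2 /\ last x p1 = z.
Proof.
rewrite inE => /orP[/eqP->|]; first by exists [::], p.
by case/splitPr => p1 p2; exists (rcons p1 z), p2; rewrite last_rcons cat_rcons.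
Qed.

Lemma subwalk_split W x : simple_path G W -> x \in W -> exists W1 W2,
  [/\ W = W1 ++ x :: W2, subwalk W x W2 & subwalk W x (rev W1)].
Proof.
move=> sW xW; have [W1 [W2 EW]] : exists W1 W2, W = W1 ++ x :: W2.
  by case/splitPr: xW => W1 W2; exists W1, W2.
exists W1, W2; split=> //; first by rewrite EW; apply: subwalk_suffix; rewrite -EW.
apply: subwalk_rev; have := simple_rev sW; rewrite EW rev_cat rev_cons cat_rcons.
exact: subwalk_suffix.
Qed.

Lemma subwalk_to W x y : simple_path G W -> x \in W -> y \in W ->
  exists p, subwalk W x p /\ last x p = y.
Proof.
move=> sW xW yW; have [W1 [W2 [EW sR sL]]] := subwalk_split sW xW.
have H p : subwalk W x p -> y \in x :: p -> exists p, subwalk W x p /\ last x p = y.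
  move=> sp /walk_prefix_to [p1 [p2 [ep ez]]]; exists p1; split=> //; rewrite ep in sp.
  exact: subwalk_prefix sp.
move: yW; rewrite {1}EW mem_cat => /orP[y1|]; last exact: H.
by apply: (H _ sL); rewrite inE mem_rev y1 orbT.
Qed.

Variables (W : seq V) (gv : V -> R) (ge : {set V} -> R) (Ga Pi : V -> R).
Hypotheses (sW : simple_path G W) (g0 : nneg gv) (g1 : nneg ge) (Pi0 : nneg Pi)
  (Ga0 : nneg Ga)
  (Gae : forall a c, [set a; c] \in pedges W -> gv a + ge [set a; c] + gv c <= Ga a).

(** [Ga] at a vertex dominates the weight of the step to the next one. The walk is cut just before
    its weight reaches [th]; including the [Ga] of its last vertex, the sum then reaches [th]. *)
Lemma port_direction x p th : {subset pedges (x :: p) <= pedges W} -> 0 < th ->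
  tw gv ge x p < th \/
  exists p1 p2, [/\ p = p1 ++ p2, tw gv ge x p1 < th & th <= \sum_(z <- x :: p1) Ga z].
Proof.
elim: p x th => [|y p IH] x th sub t0; first by left; rewrite tw_nil.
have sub' : {subset pedges (y :: p) <= pedges W}.
  by move=> e h; apply: sub; rewrite /= inE h orbT.
have := Gae (sub [set x; y] (mem_head _ _)); set c := ge _ => h.
have gx := g0 x; have gy := g0 y; have gc : 0 <= c := g1 _.
case: (leP th (gv y + c)) => hc.
  right; exists [::], (y :: p); split=> //; first by rewrite tw_nil.
  by rewrite big_seq1; lra.
have [|h1|[p1 [p2 [-> h1 h2]]]] := IH y (th - (gv y + c)) sub'; first by lra.
  by left; rewrite tw_cons -/c; lra.
right; exists (y :: p1), p2; split=> //; first by rewrite tw_cons -/c; lra.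
by rewrite big_cons; lra.
Qed.

Lemma average_pick (s : seq V) : uniq s -> {subset s <= W} -> 2^-1 <= \sum_(z <- s) Ga z ->
  exists2 z, z \in s & Pi z <= 2 * \sum_(v <- W) Ga v * Pi v.
Proof.
move=> us sub h; apply: boolp.contrapT => no.
have h2 : \sum_(v <- s) Ga v * Pi v <= \sum_(v <- W) Ga v * Pi v.
  by apply: sum_sub_seq => // v; rewrite mulr_ge0.
set X := \sum_(v <- W) _ in no h2.
have X0 : 0 <= X by rewrite sumr_ge0 // => v _; rewrite mulr_ge0.
have low z : z \in s -> 2 * X < Pi z.
  by move=> zs; rewrite ltNge; apply/negP => hz; apply: no; exists z.
have h3 : (\sum_(z <- s) Ga z) * (2 * X) <= \sum_(v <- s) Ga v * Pi v.
  rewrite mulr_suml big_seq [leRHS]big_seq; apply: ler_sum => z zs.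
  by rewrite ler_wpM2l // ltW // low.
have [z zs Gz] : exists2 z, z \in s & 0 < Ga z.
  apply: boolp.contrapT => nz; move: h; rewrite big_seq big1 ?leNgt ?invr_gt0 ?ltr0n //.
  move=> z zs; apply/le_anti; rewrite Ga0 andbT leNgt; apply/negP => hz; apply: nz; by exists z.
have h4 : (\sum_(z <- s) Ga z) * (2 * X) < \sum_(v <- s) Ga v * Pi v.
  rewrite mulr_suml (big_rem z) //= [ltRHS](big_rem z) //=; apply: ltr_leD.
    by rewrite ltr_pM2l // low.
  rewrite big_seq [leRHS]big_seq; apply: ler_sum => y ys.
  by rewrite ler_wpM2l // ltW // low // (mem_rem ys).
have : 2^-1 * (2 * X) <= (\sum_(z <- s) Ga z) * (2 * X) by rewrite ler_wpM2r // mulr_ge0.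
lra.
Qed.

Lemma tw_prefix x p q : tw gv ge x p <= tw gv ge x (p ++ q).
Proof. by rewrite tw_cat lerDl tw_ge0. Qed.

(** If one direction from [x] is heavy, averaging over its light prefix finds a cheap vertex. If
    both are light, all of [W] is within reach: average over [W] when its [Ga] mass is at least 1/2,
    and take the head otherwise. The bound is the sum of the two possible prices. *)
Lemma port_exists x h : x \in W -> ohead W = Some h -> exists p,
  [/\ subwalk W x p, tw gv ge x p < 2^-1
    & Pi (last x p) <= Pi h + 2 * \sum_(v <- W) Ga v * Pi v].
Proof.
move=> xW hW; have uW : uniq W by case: (W) sW => //= ? ? /andP[].
have half : 0 < 2^-1 :> R by rewrite invr_gt0.
have S0 : 0 <= 2 * \sum_(v <- W) Ga v * Pi v.
  by rewrite mulr_ge0 // sumr_ge0 // => v _; rewrite mulr_ge0.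
have [W1 [W2 [EW sR sL]]] := subwalk_split sW xW.
have pickin p z : subwalk W x p -> tw gv ge x p < 2^-1 -> z \in x :: p ->
    exists p, [/\ subwalk W x p, tw gv ge x p < 2^-1 & last x p = z].
  move=> sp tp /walk_prefix_to [p1 [p2 [ep ez]]]; exists p1; rewrite ep in sp tp.
  by split=> //; [exact: subwalk_prefix sp | exact: le_lt_trans (tw_prefix _ _ _) tp].
have dir p : subwalk W x p -> tw gv ge x p < 2^-1 \/
    (exists p, [/\ subwalk W x p, tw gv ge x p < 2^-1
    & Pi (last x p) <= Pi h + 2 * \sum_(v <- W) Ga v * Pi v]).
  move=> sp; case: (sp) => _ _ _ sub.
  have [|[p1 [p2 [ep t1 G1]]]] := port_direction sub half; [by left|right].
  rewrite ep in sp; have sp1 := subwalk_prefix sp; case: (sp1) => _ u1 v1 _.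
  have [z zin Pz] := average_pick u1 v1 G1.
  have [p' [a1 a2 a3]] := pickin p1 z sp1 t1 zin.
  by exists p'; rewrite a3; split=> //; have := Pi0 h; lra.
have [tR|//] := dir W2 sR; have [tL|//] := dir (rev W1) sL.
have inLR z : z \in W -> exists p, [/\ subwalk W x p, tw gv ge x p < 2^-1 & last x p = z].
  rewrite {1}EW mem_cat => /orP[z1|z2]; last exact: (pickin W2 z sR tR z2).
  by apply: (pickin (rev W1) z sL tL); rewrite inE mem_rev z1 orbT.
case: (leP (2^-1) (\sum_(v <- W) Ga v)) => hG.
  have [z zin Pz] := average_pick uW (fun _ h => h) hG.
  have [p' [a1 a2 a3]] := inLR z zin.
  by exists p'; rewrite a3; split=> //; have := Pi0 h; lra.
have hin : h \in W by case: (W) hW => //= a s [->]; rewrite inE eqxx.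
have [p' [a1 a2 a3]] := inLR h hin.
by exists p'; rewrite a3; split=> //; lra.
Qed.

End Ports.

Lemma weighted_min (R : realFieldType) (I : finType) (P : pred I) (a c : I -> R) (B : R) :
  (forall i, 0 <= a i) -> 0 < \sum_(i | P i) a i ->
  \sum_(i | P i) a i * c i <= B * \sum_(i | P i) a i -> exists i, P i /\ c i <= B.
Proof.
move=> a0 sp h; apply: boolp.contrapT => no.
have low i : P i -> B < c i.
  by move=> Pi; rewrite ltNge; apply/negP => hz; apply: no; exists i.
have [i /andP[Pi ai]] : exists i, P i && (0 < a i).
  apply/existsP; move: sp; apply: contraTT; rewrite negb_exists => /forallP nz.
  rewrite big1 ?ltxx // => i Pi; have := nz i; rewrite Pi /= -leNgt => ai.
  by apply/le_anti; rewrite ai a0.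
move: h; rewrite leNgt => /negP; apply; rewrite mulr_sumr (bigD1 i) //= [ltRHS](bigD1 i) //=.
apply: ltr_leD; first by rewrite mulrC ltr_pM2l // low.
by apply: ler_sum => j /andP[Pj _]; rewrite mulrC ler_wpM2l // ltW // low.
Qed.

Section Walks.
Variables (R : realType) (V : finType) (G : vcgraph V).

Definition lenv (v : V) : R := (vlen G v)%:R.
Definition lene (e : {set V}) : R := (elen G e)%:R.

Lemma lenv_ge0 : nneg lenv. Proof. by move=> v; apply: ler0n. Qed.
Lemma lene_ge0 : nneg lene. Proof. by move=> v; apply: ler0n. Qed.

Definition gwalk (wv : V -> R) we x y (cost len : R) : Prop :=
  exists p, [/\ path (vadj G) x p, last x p = y, tw wv we x p <= cost & tw lenv lene x p <= len].

Lemma gwalk_trans wv we x y z c1 l1 c2 l2 :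
  gwalk wv we x y c1 l1 -> gwalk wv we y z c2 l2 -> gwalk wv we x z (c1 + c2) (l1 + l2).
Proof.
case=> p [p1 p2 p3 p4] [q [q1 q2 q3 q4]]; exists (p ++ q); split.
- by rewrite cat_path p1 p2.
- by rewrite last_cat p2.
- by rewrite tw_cat p2 lerD.
- by rewrite tw_cat p2 lerD.
Qed.

Lemma gwalk_le wv we x y c1 l1 c2 l2 : c1 <= c2 -> l1 <= l2 ->
  gwalk wv we x y c1 l1 -> gwalk wv we x y c2 l2.
Proof.
move=> h1 h2 [p [p1 p2 p3 p4]]; exists p; split=> //; first exact: le_trans h1.
exact: le_trans h2.
Qed.

Lemma gwalk_refl wv we x c l : 0 <= c -> 0 <= l -> gwalk wv we x x c l.
Proof. by move=> c0 l0; exists [::]; rewrite !tw_nil. Qed.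

Lemma gwalk_joins wv we x y s : nneg wv -> joins G x y s ->
  gwalk wv we x y (pw wv we s) (plen G s)%:R.
Proof.
move=> w0 /joins_pathP [p [-> pp up lp]]; exists p; split=> //; first exact: tw_le_pw.
by rewrite plen_pw; apply: tw_le_pw; apply: lenv_ge0.
Qed.

(** An embedding in dual form: instead of a flow, group prices for every weight. The existential
    stands under the weights, so prices of all levels can be added before [routable_dual] is applied
    once. *)
Definition backprop (D : groups V) (cls : nat -> V -> option V) (kap Len : R) : Prop :=
  forall wv we, nneg wv -> nneg we -> exists Psi : V -> R,
  [/\ nneg Psi, \sum_(g | used D g) (gcap D g)%:R * Psi g <= kap * wsize G wv we,
      forall x y g, grp D x = Some g -> grp D y = Some g -> gwalk wv we x y (Psi g) Len
    & forall k x y g g' s, grp D x = Some g -> grp D y = Some g' ->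
        cls k x = Some s -> cls k y = Some s -> gwalk wv we x y (Psi g + Psi g') Len].

Definition near (r : R) gv ge (a : R) x y : bool :=
  [exists p : bpath V, joins G x y p && (omg G r gv ge p <= a)].

End Walks.

Section Near.
Variables (R : realType) (V : finType) (G : vcgraph V) (b r : R) (gv : V -> R) (ge : {set V} -> R).
Hypotheses (b0 : 0 < b) (r0 : 0 < r) (g0 : nneg gv) (g1 : nneg ge).

Let ov (v : V) : R := r^-1 * (vlen G v)%:R + gv v.
Let oe (e : {set V}) : R := r^-1 * (elen G e)%:R + ge e.
Let ov0 : nneg ov. Proof. by move=> v; rewrite addr_ge0 // mulr_ge0 // invr_ge0 ltW. Qed.
Let oe0 : nneg oe. Proof. by move=> v; rewrite addr_ge0 // mulr_ge0 // invr_ge0 ltW. Qed.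

Lemma nearP a x y :
  reflect (exists p, joins G x y p /\ omg G r gv ge p <= a) (near G r gv ge a x y).
Proof.
apply: (iffP existsP) => [[p /andP[j o]]|[p [j o]]]; first by exists p.
by have [q eq_] := simple_bpath (joins_simple j); exists q; rewrite eq_ j.
Qed.

Lemma near_sym a x y : near G r gv ge a x y -> near G r gv ge a y x.
Proof.
case/nearP=> p [j o]; apply/nearP; exists (rev p); split; first exact: joins_sym.
by rewrite omg_pw pw_rev -omg_pw.
Qed.

Lemma near_tri a c x y z : near G r gv ge a x y -> near G r gv ge c y z ->
  near G r gv ge (a + c) x z.
Proof.
case/nearP=> p [j o] /nearP [q [j' o']]; apply/nearP.
have [u [ju hu]] := joins_trans R j j'; exists u; split=> //.
apply: (@le_trans _ _ (omg G r gv ge p + omg G r gv ge q)); last exact: lerD.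
rewrite !omg_pw; exact: hu.
Qed.

Lemma near_le a c x y : a <= c -> near G r gv ge a x y -> near G r gv ge c x y.
Proof. by move=> ac /nearP [p [j o]]; apply/nearP; exists p; split=> //; apply: le_trans ac. Qed.

Lemma near_refl a x y : near G r gv ge a x y -> near G r gv ge a x x.
Proof.
case/nearP=> p [j o]; apply/nearP; exists [:: x]; split; first exact: joins_refl.
apply: le_trans o; rewrite !omg_pw; apply: pw_sub => //.
by move=> z; rewrite inE => /eqP ->; case/joins_pathP: j => q [-> _ _ _]; rewrite inE eqxx.
Qed.

Lemma near_walk a c s x p : near G r gv ge a s x -> path (vadj G) x p ->
  tw (lenv R G) (lene R G) x p / r + tw gv ge x p <= c -> near G r gv ge (a + c) s (last x p).
Proof.
case/nearP=> q [/joins_pathP [q' [-> pq uq lq]] oq] pp h.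
have pc : path (vadj G) s (q' ++ p) by rewrite cat_path pq lq.
have [u [ju _ sv se]] := shorten_walk pc; rewrite last_cat lq in ju.
apply/nearP; exists (s :: u); split=> //; rewrite omg_pw.
apply: (@le_trans _ _ (pw ov oe (s :: q' ++ p))).
  by apply: pw_sub => //; case/joins_pathP: ju => ? [[->]].
rewrite pw_tw tw_cat lq addrA -pw_tw; apply: lerD; first by rewrite -omg_pw.
apply: le_trans h; rewrite /tw !big_split /= -!mulr_sumr /lenv /lene.
set X := \sum_(i <- p) _; set Y := \sum_(i <- p) gv i.
set Z := \sum_(i <- _) (elen _ _)%:R; set T := \sum_(i <- _) ge _; lra.
Qed.

Lemma kern_tri a c q y : joins G a c q ->
  kern G b r gv ge a y * expR (- (b * omg G r gv ge q)) <= kern G b r gv ge c y.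
Proof.
move=> jq; case: (boolp.pselect (exists p, joins G a y p)) => [ex|ne]; last first.
  by rewrite (kern_none _ _ _ _ ne) mul0r kern_ge0.
have [p [jp pm]] := best_path r gv ge ex; rewrite (kern_best b0 jp pm) -expRD.
have [u [ju hu]] := joins_trans R (joins_sym jq) jp.
apply: le_trans (kern_ge b r gv ge ju); rewrite ler_expR -opprD lerN2 -mulrDr ler_pM2l //.
by rewrite addrC !omg_pw; have := hu _ _ ov0 oe0; rewrite pw_rev.
Qed.

Lemma kern_near a c x y : near G r gv ge a x c ->
  kern G b r gv ge x y * expR (- (b * a)) <= kern G b r gv ge c y.
Proof.
case/nearP=> q [jq oq]; apply: le_trans (kern_tri y jq).
by rewrite ler_wpM2l ?kern_ge0 // ler_expR lerN2 ler_pM2l.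
Qed.

Lemma near_kern a x y : expR (- (b * a)) <= kern G b r gv ge x y -> near G r gv ge a x y.
Proof.
move=> h; case: (boolp.pselect (exists p, joins G x y p)) => [ex|ne]; last first.
  by move: h; rewrite (kern_none _ _ _ _ ne) leNgt expR_gt0.
have [p [jp pm]] := best_path r gv ge ex; apply/nearP; exists p; split=> //.
by move: h; rewrite (kern_best b0 jp pm) ler_expR lerN2 ler_pM2l.
Qed.

Lemma Zk_near a x c : 0 <= a -> near G r gv ge a x c ->
  Zk G b r gv ge x <= expR (b * a) * Zk G b r gv ge c.
Proof.
move=> a0 nx; rewrite /Zk mulrDr mulr1; apply: lerD.
  by rewrite -expR0 ler_expR mulr_ge0 // ltW.
rewrite mulr_sumr; apply: ler_sum => y _; rewrite mulrCA ler_wpM2l //.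
by have := kern_near y nx; rewrite expRN ler_pdivrMr ?expR_gt0 // mulrC.
Qed.

End Near.

Section LevelBackward.
Variables (R : realType) (V : finType) (G : vcgraph V).
Hypothesis wf : vc_wf G.
Variables (b r Lam rr kap2 D0 Dn : R) (D : groups V) (cls : nat -> V -> option V).
Variables (gv : V -> R) (ge : {set V} -> R).
Hypotheses (b0 : 0 < b) (r0 : 0 < r) (Dok : groups_ok G Lam rr D) (rrr : rr <= r)
  (g0 : nneg gv) (g1 : nneg ge) (Dn0 : 0 <= Dn)
  (clsn : forall k x s, cls k x = Some s -> near G r gv ge Dn s x /\ near G r gv ge 2 s s)
  (hD0 : ln (2 * capsum R G) + 2 * b <= b * D0)
  (gmin : forall wv we, nneg wv -> nneg we -> exists P' : V -> V -> seq V,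
     (forall v y, (exists p, joins G v y p) -> joins G v y (P' v y) /\
        forall p, joins G v y p -> omg G r gv ge (P' v y) <= omg G r gv ge p + b^-1) /\
     \sum_v srcA D gv ge v *
        (\sum_y (vcap G y)%:R * kern G b r gv ge v y / Zk G b r gv ge v * pw wv we (P' v y))
     <= kap2 * wsize G wv we).

Let D1 := Dn + 2.
Definition bp_ratio : R := 4 * expR (2 * b * (Dn + 3)).
Let Q := bp_ratio.

(** The path from [s] to itself gives kernel mass at least exp(- 2 b), whereas all points beyond
    [D0] together have at most half of that. The 1 in [Zk] costs the other factor of 2. *)
Lemma kern_mass s : near G r gv ge 2 s s ->
  expR (- (2 * b)) / 4 <= \sum_(y | expR (- (b * D0)) <= kern G b r gv ge s y)
     (vcap G y)%:R * kern G b r gv ge s y / Zk G b r gv ge s.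
Proof.
move=> ns; rewrite -mulr_suml; set S := \sum_(y | _) _.
pose X := \sum_y (vcap G y)%:R * kern G b r gv ge s y.
have ZE : Zk G b r gv ge s = 1 + X by [].
have u1 : 1 <= (vcap G s)%:R :> R by case: wf => _ [h _]; rewrite ler1n; case: (h s).
have U1 : 1 <= capsum R G.
  by apply: (le_trans u1); rewrite /capsum (bigD1 s) //= lerDl sumr_ge0.
have e0 : 0 < expR (- (2 * b)) by apply: expR_gt0.
have X1 : expR (- (2 * b)) <= X.
  have /nearP [p [jp op]] := ns.
  rewrite /X (bigD1 s) //=; apply: (@le_trans _ _ (kern G b r gv ge s s)).
    apply: le_trans (kern_ge b r gv ge jp); rewrite ler_expR lerN2 mulrC ler_pM2r //.
  apply: (@le_trans _ _ ((vcap G s)%:R * kern G b r gv ge s s)); first by rewrite ler_peMl ?kern_ge0.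
  by rewrite lerDl sumr_ge0 // => y _; rewrite mulr_ge0 ?kern_ge0.
have far : X - S <= expR (- (2 * b)) / 2.
  rewrite /X (bigID (fun y => expR (- (b * D0)) <= kern G b r gv ge s y)) /= addrAC subrr add0r.
  apply: (@le_trans _ _ (capsum R G * expR (- (b * D0)))).
    rewrite mulr_suml big_mkcond; apply: ler_sum => y _; case: ifP => [|_]; last by rewrite mulr_ge0 ?expR_ge0.
    by rewrite -ltNge => /ltW h; rewrite ler_wpM2l.
  rewrite ler_pdivlMr // mulrAC; apply: (@le_trans _ _ (2 * capsum R G * expR (- (ln (2 * capsum R G) + 2 * b)))).
    by rewrite [_ * 2]mulrC ler_wpM2l ?mulr_ge0 ?(le_trans _ U1) // ler_expR lerN2.
  rewrite opprD expRD (expRN (ln _)) lnK ?posrE; last by lra.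
  by rewrite mulrA divff ?mul1r // gt_eqF //; lra.
have S0 : X / 2 <= S by lra.
rewrite ZE ler_pdivlMr; last by lra.
have e1 : expR (- (2 * b)) <= 1 by rewrite -[leRHS]expR0 ler_expR oppr_le0 mulr_ge0 // ltW.
set E := expR _ in X1 e0 e1 *; nra.
Qed.

Lemma bp_D0_ge0 (v : V) : 0 <= D0.
Proof.
have u1 : 1 <= (vcap G v)%:R :> R by case: wf => _ [h _]; rewrite ler1n; case: (h v).
have U1 : 1 <= capsum R G.
  by apply: (le_trans u1); rewrite /capsum (bigD1 v) //= lerDl sumr_ge0.
rewrite -(pmulr_rge0 _ b0); apply: le_trans hD0; rewrite addr_ge0 //.
  by rewrite ln_ge0 //; lra.
by rewrite mulr_ge0 // ltW.
Qed.

(** Two members of a cluster walk along their group paths to cheap ports and meet at a common vertex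
    y near the centre. Since both ports are close to the centre, their kernel distributions dominate
    that of the centre up to a factor, and averaging produces y. *)
Lemma level_backprop :
  backprop G D cls (Lam + 2 * Q * kap2) (2 * r * (Dn + 2 + D0 + b^-1 + 1)).
Proof.
move=> wv we w0 w1; have [P' [hP' hS]] := gmin w0 w1.
have bi : 0 < b^-1 by rewrite invr_gt0.
have Q0 : 0 <= Q by rewrite /Q /bp_ratio mulr_ge0 ?expR_ge0.
pose pi v y : R := (vcap G y)%:R * kern G b r gv ge v y / Zk G b r gv ge v.
have Zp v : 0 < Zk G b r gv ge v by apply: lt_le_trans (Zk_ge1 _ _ _ _ _ _).
have pi0 v y : 0 <= pi v y by rewrite divr_ge0 ?(ltW (Zp v)) // mulr_ge0 ?kern_ge0.
pose Pi v := \sum_y pi v y * pw wv we (P' v y).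
have Pi0 : nneg Pi by move=> v; rewrite sumr_ge0 // => y _; rewrite mulr_ge0 ?pw_ge0.
pose Ga g v := Gam gv ge (gpath D g) v.
have Ga0 g : nneg (Ga g) by apply: Gam_ge0.
pose Th g := Pi (head g (gpath D g)) + 2 * \sum_(v <- gpath D g) Ga g v * Pi v.
have Th0 : nneg Th.
  by move=> g; rewrite addr_ge0 // mulr_ge0 // sumr_ge0 // => v _; rewrite mulr_ge0 ?Ga0.
pose Psi g := pw wv we (gpath D g) + Q * Th g.
have Psi0 : nneg Psi by move=> g; apply: addr_ge0; [exact: pw_ge0|exact: mulr_ge0].
have [ok gin _ _] := Dok.
have Uok x g : grp D x = Some g -> used D g by move=> h; apply/existsP; exists x; rewrite h.
have sub x g p : used D g -> subwalk G (gpath D g) x p ->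
   [/\ gwalk G wv we x (last x p) (pw wv we (gpath D g)) r,
       gwalk G wv we (last x p) x (pw wv we (gpath D g)) r
     & tw (lenv R G) (lene R G) x p <= r].
  move=> ug [pp up vs es]; have [sW shW _] := ok g ug.
  case: p pp up vs es => [|y p] pp up vs es.
    by rewrite tw_nil (ltW r0); split=> //; apply: gwalk_refl; rewrite ?(ltW r0) ?pw_ge0.
  have jp : joins G x (last x (y :: p)) (x :: y :: p) by apply/joins_pathP; exists (y :: p).
  have lenp : (plen G (x :: y :: p))%:R <= r.
    case/orP: shW => [/eqP s1|h]; first by have := uniq_leq_size up vs; rewrite s1.
    apply: (le_trans _ rrr); apply: le_trans h; rewrite !plen_pw.
    by apply: (pw_sub (@lenv_ge0 R V G) (@lene_ge0 R V G)).
  have pwp : pw wv we (x :: y :: p) <= pw wv we (gpath D g) by apply: pw_sub.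
  split.
  - by apply: gwalk_le (gwalk_joins we w0 jp).
  - apply: gwalk_le (gwalk_joins we w0 (joins_sym jp)); first by rewrite pw_rev.
    by rewrite plen_pw pw_rev -plen_pw.
  - by apply: le_trans lenp; rewrite plen_pw; apply: tw_le_pw; apply: lenv_ge0.
have port x g : grp D x = Some g -> exists v,
   [/\ gwalk G wv we x v (pw wv we (gpath D g)) r, gwalk G wv we v x (pw wv we (gpath D g)) r,
       Pi v <= Th g & forall s a, near G r gv ge a s x -> near G r gv ge (a + 2) s v].
  move=> xg; have [sW shW _] := ok g (Uok _ _ xg); have xW := gin _ _ xg.
  have hW : ohead (gpath D g) = Some (head g (gpath D g)) by case: (gpath D g) sW.
  have Gae a c : [set a; c] \in pedges (gpath D g) -> gv a + ge [set a; c] + gv c <= Ga g a.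
    move=> ac; rewrite /Ga /Gam -addrA lerD2l (big_rem [set a; c]) //= in_set2 eqxx /=.
    rewrite -addrA lerD2l; apply: (@le_trans _ _ (\sum_(x in [set a; c]) gv x)).
      by rewrite (bigD1 c) ?in_set2 ?eqxx ?orbT //= lerDl sumr_ge0.
    by rewrite lerDl sumr_ge0 // => e _; rewrite addr_ge0 // sumr_ge0.
  have [p [[pp up vs es] tp Pp]] := port_exists sW g0 g1 Pi0 (Ga0 g) Gae xW hW.
  have [s1 s2 lenp] := sub x g p (Uok _ _ xg) (And4 pp up vs es).
  exists (last x p); split=> //.
  move=> s a nx; apply: near_walk nx pp _ => //.
  have : tw (lenv R G) (lene R G) x p / r <= 1 by rewrite ler_pdivrMr // mul1r.
  lra.
exists Psi; split=> //.
- have E1 : \sum_(g | used D g) (gcap D g)%:R * Th g <= 2 * \sum_v srcA D gv ge v * Pi v.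
    rewrite mulr_sumr /srcA; under [leRHS]eq_bigr do rewrite mulr_suml mulr_sumr.
    rewrite exchange_big /=; apply: ler_sum => g ug.
    have -> : \sum_v 2 * ((gcap D g)%:R * ((ohead (gpath D g) == Some v)%:R +
        (v \in gpath D g)%:R * Gam gv ge (gpath D g) v) * Pi v) = (gcap D g)%:R *
        (2 * (\sum_v (ohead (gpath D g) == Some v)%:R * Pi v + \sum_v (v \in gpath D g)%:R * (Ga g v * Pi v))).
      by rewrite -big_split /= !mulr_sumr; apply: eq_bigr => v _; rewrite /Ga; ring.
    rewrite ler_wpM2l //; have [sW _ _] := ok g ug.
    have -> : \sum_v (ohead (gpath D g) == Some v)%:R * Pi v = Pi (head g (gpath D g)).
      case: (gpath D g) sW => //= a s _; rewrite (bigD1 a) //= eqxx mul1r big1 ?addr0 // => v va.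
      by rewrite (inj_eq Some_inj) eq_sym (negbTE va) mul0r.
    have uW : uniq (gpath D g) by case: (gpath D g) sW => //= ? ? /andP[].
    have -> : \sum_v (v \in gpath D g)%:R * (Ga g v * Pi v) = \sum_(v <- gpath D g) Ga g v * Pi v.
      rewrite (big_uniq _ uW) [RHS]big_mkcond; apply: eq_bigr => v _.
      by case: ifP; rewrite ?mul1r ?mul0r.
    rewrite /Th; have := Pi0 (head g (gpath D g)); lra.
  rewrite /Psi; under eq_bigr do rewrite mulrDr mulrCA.
  rewrite big_split /= -mulr_sumr.
  have := sum_group_weight Dok w0 w1.
  have : \sum_v srcA D gv ge v * Pi v <= kap2 * wsize G wv we by exact: hS.
  move: E1 Q0; set X := \sum_(g | _) _ * Th g; set Y := \sum_v _ * Pi v.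
  set w := wsize _ _ _; set Z := \sum_(g | _) _ => E1 Q0 hY hZ.
  have : Q * X <= Q * (2 * (kap2 * w)) by rewrite ler_wpM2l //; lra.
  lra.
- move=> x y g xg yg; have [sW _ _] := ok g (Uok _ _ xg).
  have [p [sp <-]] := subwalk_to sW (gin _ _ xg) (gin _ _ yg).
  have [h _ _] := sub x g p (Uok _ _ xg) sp.
  apply: gwalk_le h; first by rewrite /Psi lerDl mulr_ge0.
  have h0 : 0 <= D0 := bp_D0_ge0 x; rewrite mulrAC ler_peMl ?(ltW r0) //.
  by have := Dn0; lra.
- move=> k x x' g g' s xg xg' cx cx'.
  have [v [xv _ Pv nv]] := port x g xg; have [v' [_ xv' Pv' nv']] := port x' g' xg'.
  have [sx ss] := clsn cx; have [sx' _] := clsn cx'.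
  have sv := nv _ _ sx; have sv' := nv' _ _ sx'; rewrite -/D1 in sv sv'.
  have h0 : 0 <= D0 := bp_D0_ge0 x.
  (* A Harnack inequality: one factor exp(b D1) comes from the kernel and one from its
     normalisation. *)
  have piv u : near G r gv ge D1 s u -> forall y, pi s y <= expR (2 * (b * D1)) * pi u y.
    move=> su y; rewrite /pi ler_pdivrMr // mulrA mulrAC ler_pdivlMr //.
    have k1 := kern_near b0 r0 g0 g1 y su; have z1 := Zk_near b0 r0 g0 g1 _ (near_sym su).
    have z2 : Zk G b r gv ge u <= expR (b * D1) * Zk G b r gv ge s.
      by apply: z1 => //; rewrite /D1; have := Dn0; lra.
    have k2 : kern G b r gv ge s y <= kern G b r gv ge u y * expR (b * D1).
      by move: k1; rewrite expRN ler_pdivrMr ?expR_gt0.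
    have -> : expR (2 * (b * D1)) * ((vcap G y)%:R * kern G b r gv ge u y) * Zk G b r gv ge s =
       (vcap G y)%:R * (kern G b r gv ge u y * expR (b * D1)) * (expR (b * D1) * Zk G b r gv ge s).
      rewrite (_ : 2 * (b * D1) = b * D1 + b * D1) ?expRD; [by ring|by ring].
    apply: ler_pM => //; rewrite ?(ltW (Zp _)) ?mulr_ge0 ?kern_ge0 //.
    by rewrite ler_wpM2l.
  pose c y := pw wv we (P' v y) + pw wv we (P' v' y).
  have c0 y : 0 <= c y by rewrite addr_ge0 ?pw_ge0.
  have mass := kern_mass ss; rewrite -/(pi s _) in mass.
  pose N y := expR (- (b * D0)) <= kern G b r gv ge s y.
  have mp : 0 < \sum_(y | N y) pi s y.
    by apply: lt_le_trans mass; rewrite divr_gt0 ?expR_gt0.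
  have S0 : 0 <= Pi v + Pi v' by rewrite addr_ge0.
  (* Averaging is over y within [D0] of the centre only, so that the meeting point also controls the
     length. *)
  have [|y [Ny cy]] := @weighted_min R V N (pi s) c (Q * (Pi v + Pi v')) (pi0 s) mp.
    apply: (@le_trans _ _ (expR (2 * (b * D1)) * (Pi v + Pi v'))).
      rewrite mulrDr !mulr_sumr -big_split /= big_mkcond; apply: ler_sum => y _.
      have a1 := piv v sv y; have a2 := piv v' sv' y.
      have q1 : 0 <= pw wv we (P' v y) by apply: pw_ge0.
      have q2 : 0 <= pw wv we (P' v' y) by apply: pw_ge0.
      apply: (@le_trans _ _ (pi s y * c y)); first by case: ifP => // _; rewrite mulr_ge0.
      rewrite /c mulrDr; apply: lerD; rewrite [leRHS]mulrA; exact: ler_wpM2r.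
    rewrite [leRHS]mulrAC ler_wpM2r //; apply: (@le_trans _ _ (Q * (expR (- (2 * b)) / 4))); last first.
      by rewrite ler_wpM2l.
    rewrite /Q /bp_ratio (_ : 2 * b * (Dn + 3) = 2 * (b * D1) + 2 * b); last by rewrite /D1; ring.
    rewrite expRD expRN; have := expR_gt0 (2 * b); set E := expR (2 * b) => E0.
    by rewrite le_eqVlt; apply/orP; left; apply/eqP; field; rewrite gt_eqF.
  have sy : near G r gv ge D0 s y by apply: (near_kern b0); exact: Ny.
  have leg u : near G r gv ge D1 s u -> joins G u y (P' u y) /\
      (plen G (P' u y))%:R <= r * (D1 + D0 + b^-1).
    move=> su; have /nearP [q [jq oq]] := near_tri r0 g0 g1 (near_sym su) sy.
    have [jP /(_ q jq) oP] := hP' u y (ex_intro _ q jq); split=> //.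
    rewrite mulrC -ler_pdivrMr //; apply: (@le_trans _ _ (omg G r gv ge (P' u y))).
      by rewrite lerDl pw_ge0.
    lra.
  have [j1 l1] := leg v sv; have [j2 l2] := leg v' sv'.
  have g1' := gwalk_joins we w0 j1; have g2' := gwalk_joins we w0 (joins_sym j2).
  rewrite pw_rev plen_pw pw_rev -plen_pw in g2'.
  have := gwalk_trans (gwalk_trans (gwalk_trans xv g1') g2') xv'.
  apply: gwalk_le; last by rewrite /D1 in l1 l2; lra.
  rewrite /Psi; move: cy; rewrite /c => cy.
  have := ler_wpM2l Q0 Pv; have := ler_wpM2l Q0 Pv'; lra.
Qed.

End LevelBackward.

(** * Climbing through the levels *)

Ltac natlia :=
  repeat (match goal with H : ?T |- _ =>
    lazymatch type of T with Prop =>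
      lazymatch T with
      | is_true (leq _ _) => fail
      | is_true (andb (leq _ _) (leq _ _)) => fail
      | @eq nat _ _ => fail
      | is_true (negb _) => fail
      | _ => clear H
      end
    end end); lia.

Section Climb.
Variables (R : realType) (N : nat) (M : nat -> R) (conn : nat -> nat -> R -> nat -> Prop).
Variables (X : nat -> nat -> bool) (r : nat -> R) (sg : R).
Hypotheses
  (Mmono : forall a b, (a <= b <= N)%N -> M a <= M b)
  (conn_refl : forall a, conn a a 0 0)
  (conn_trans : forall a b c l1 t1 l2 t2,
     conn a b l1 t1 -> conn b c l2 t2 -> conn a c (l1 + l2) (t1 + t2))
  (conn_le : forall a b l1 t1 l2 t2, l1 <= l2 -> (t1 <= t2)%N -> conn a b l1 t1 -> conn a b l2 t2)
  (conn_edge : forall a, (a < N)%N -> conn a a.+1 (M a.+1 - M a) 1)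
  (X0 : forall a, X 0 a)
  (r0 : forall j, 0 < r j) (rS : forall j, r j.+1 = 4 * r j) (sg0 : 0 <= sg)
  (star : forall j x y, (x < y <= N)%N -> X j x -> X j y -> M y - M x <= r j.+1 ->
     conn x y (sg * r j.+1) 4 \/ exists2 t, X j.+1 t & (x <= t <= y)%N).

(** In absolute terms the additive error obeys be' = 3 be + sg r'. With r' = 4 r the relative error
    is multiplied by 3/4 and stays below 4 sg. *)
Fixpoint climb_b (j : nat) : R := if j is j'.+1 then 3 / 4 * climb_b j' + sg else 0.
Fixpoint climb_a (j : nat) : R := if j is j'.+1 then climb_a j' + climb_b j' else 1.
Fixpoint climb_t (j : nat) : nat := if j is j'.+1 then (15 * (climb_t j').+1)%N else 0%N.

Lemma climb_b_ge0 j : 0 <= climb_b j.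
Proof. by have := sg0; elim: j => //= j IH s0; have := IH s0; lra. Qed.

Lemma climb_b_le j : climb_b j <= 4 * sg.
Proof. have := sg0; elim: j => [|j IH] /= s0; [|have := IH s0]; lra. Qed.

Lemma climb_a_ge1 j : 1 <= climb_a j.
Proof. by elim: j => //= j IH; have := climb_b_ge0 j; lra. Qed.

Lemma climb_a_le j : climb_a j <= 1 + j%:R * (4 * sg).
Proof.
elim: j => [|j IH] /=; first by rewrite mul0r addr0.
by rewrite -natr1; have := climb_b_le j; lra.
Qed.

Lemma climb_t_le j : (climb_t j <= 30 ^ j)%N.
Proof. by elim: j => //= j IH; rewrite expnS; move: (expn_gt0 30 j) IH; clear; lia. Qed.

(** Either the stretch is bridged entirely, or both ends reach level [j] and the middle is left to
    higher levels. *)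
Definition climbs j al be1 be2 t a b : Prop :=
  conn a b (al * (M b - M a) + be1) t \/
  exists x y, [/\ (a <= x <= y)%N, (y <= b)%N, X j x && X j y,
    conn a x (al * (M x - M a) + be1) t & conn y b (al * (M b - M y) + be2) t].

Let be j := climb_b j * r j.

(** The stretch is cut into pieces of length about r j joined by edges. Bridged pieces are
    concatenated, and the outermost points of level [j] are kept. The error of each bridged piece is
    paid by length, whence [climb_a] grows by [climb_b]. *)
Lemma climb_chain j k a b :
  (forall a b, (a <= b <= N)%N -> M b - M a <= r j ->
     climbs j (climb_a j) (be j) (be j) (climb_t j) a b) ->
  (a <= b <= N)%N -> M b - M a <= k%:R * r j ->
  climbs j (climb_a j.+1) (be j) (2 * be j) (k.+1 * (climb_t j).+1) a b.
Proof.
move=> Q; have be0 : 0 <= be j by rewrite mulr_ge0 ?climb_b_ge0 ?ltW.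
have a1 := climb_a_ge1 j; have bj := climb_b_ge0 j; have rj := r0 j.
have P1 u v : M u <= M v -> 0 <= climb_b j * (M v - M u) by move=> uv; rewrite mulr_ge0 ?subr_ge0.
have P2 u v : M u <= M v -> 0 <= (climb_a j - 1) * (M v - M u).
  by move=> uv; rewrite mulr_ge0 ?subr_ge0.
have base k' a' b' : (a' <= b' <= N)%N -> M b' - M a' <= r j ->
    climbs j (climb_a j.+1) (be j) (2 * be j) (k'.+1 * (climb_t j).+1) a' b'.
  move=> ab h; have tt : (climb_t j <= k'.+1 * (climb_t j).+1)%N by apply: leq_trans (leqnSn _) (leq_pmull _ _).
  have mab := Mmono ab.
  case: (Q a' b' ab h) => [c|[x [y [ax yb xx c1 c2]]]].
    left; apply: conn_le c => //=; have := P1 _ _ mab; lra.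
  have m1 : M a' <= M x by apply: Mmono; natlia.
  have m2 : M y <= M b' by apply: Mmono; natlia.
  right; exists x, y; split=> //; [apply: conn_le c1 => //=|apply: conn_le c2 => //=].
    by have := P1 _ _ m1; lra.
  by have := P1 _ _ m2; lra.
elim: k a b => [|k IH] a b ab h.
  by apply: base => //; rewrite mul0r in h; lra.
case: (leP (M b - M a) (r j)) => hr; first exact: base.
have ex : exists m, (a + m <= b)%N && (M (a + m)%N - M a <= r j).
  by exists 0%N; rewrite addn0 subrr (ltW rj) andbT; natlia.
have bd m : (a + m <= b)%N && (M (a + m)%N - M a <= r j) -> (m <= b)%N by natlia.
(* c is the last index within r j of a, so the piece with its following edge is longer than r j and
   pays for [be j]. *)
case: (ex_maxnP ex bd) => m /andP[mb mr] mmax; set c := (a + m)%N in mb mr.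
have cb : (c < b)%N.
  rewrite ltn_neqAle mb andbT; apply/eqP => e; move: hr; rewrite -e; lra.
have cr : r j < M c.+1 - M a.
  rewrite ltNge; apply/negP => hh; have := mmax m.+1; rewrite addnS -/c cb hh => /(_ isT).
  by rewrite ltnn.
have ac : (a <= c <= N)%N by rewrite /c; natlia.
have cbN : (c.+1 <= b <= N)%N by natlia.
have e1 := conn_edge (leq_trans cb (andP ab).2).
have m1 : M a <= M c by apply: Mmono.
have m2 : M c <= M c.+1 by apply: Mmono; natlia.
have m3 : M c.+1 <= M b by apply: Mmono.
have p2 := P2 _ _ m2; have pay : be j <= climb_b j * (M c.+1 - M a) by rewrite /be ler_wpM2l // ltW.
have h' : M b - M c.+1 <= k%:R * r j by rewrite -natr1 mulrDl in h; lra.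
have tk : ((climb_t j + 1) + k.+1 * (climb_t j).+1 <= k.+2 * (climb_t j).+1)%N by rewrite addn1 -mulSn.
have t1 : (climb_t j <= k.+2 * (climb_t j).+1)%N by apply: leq_trans (leqnSn _) (leq_pmull _ _).
have t2 : (k.+1 * (climb_t j).+1 <= k.+2 * (climb_t j).+1)%N by rewrite leq_mul2r leqnSn orbT.
have q := Q a c ac mr; have i := IH c.+1 b cbN h'.
case: q => [q|[x [y [ax yc xx c1 c2]]]].
  have ac1 := conn_trans q e1.
  case: i => [i|[x [y [cx yb xx c1 c2]]]].
    left; apply: conn_le tk (conn_trans ac1 i); rewrite /=; lra.
  have mx : M c.+1 <= M x by apply: Mmono; natlia.
  right; exists x, y; split=> //; first by natlia.
    apply: conn_le tk (conn_trans ac1 c1); rewrite /=; lra.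
  exact: conn_le c2.
have mx : M a <= M x by apply: Mmono; natlia.
have my : M y <= M c by apply: Mmono; natlia.
have c1' : conn a x (climb_a j.+1 * (M x - M a) + be j) (k.+2 * (climb_t j).+1).
  apply: conn_le c1 => //=; have := P1 _ _ mx; lra.
case: i => [i|[x' [y' [cx yb xx' _ c2']]]].
  right; exists x, y; split=> //; first by natlia.
  have := conn_trans (conn_trans c2 e1) i; apply: conn_le; last by apply: leq_trans tk; rewrite leq_add2r.
  have := P1 _ _ my; have := P1 _ _ m2; rewrite /=; lra.
right; exists x, y'; split=> //; [by natlia| |exact: conn_le c2'].
by case/andP: xx => ->; case/andP: xx'.
Qed.

(** Four times the old scale is cut by [climb_chain]. If the level-j points x and y are not joined
    by a star, there is a point of level j + 1 between them, and the first and last such points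
    become the new ends. *)
Lemma climb_all j a b : (a <= b <= N)%N -> M b - M a <= r j ->
  climbs j (climb_a j) (be j) (be j) (climb_t j) a b.
Proof.
elim: j a b => [|j IH] a b ab h.
  right; exists a, b; rewrite !X0 !subrr !mulr0 /be /= mul0r addr0; split=> //; natlia.
have be0 : 0 <= be j by rewrite mulr_ge0 ?climb_b_ge0 ?ltW.
have rj := r0 j; have r1 := rS j; have s0 := sg0; have bj := climb_b_ge0 j.
have beS : be j.+1 = 3 * be j + sg * r j.+1.
  by rewrite /be /= r1; field.
have sr : 0 <= sg * r j.+1 by rewrite mulr_ge0 // ltW.
have chain := @climb_chain j 4 _ _ IH.
have ch a' b' : (a <= a' <= b')%N -> (b' <= b)%N ->
    climbs j (climb_a j.+1) (be j) (2 * be j) (5 * (climb_t j).+1) a' b'.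
  move=> h1 h2; apply: chain; first by natlia.
  have : M a <= M a' by apply: Mmono; natlia.
  have : M b' <= M b by apply: Mmono; natlia.
  by move: h; rewrite r1; lra.
set al := climb_a j.+1 in ch *; set T := (5 * (climb_t j).+1)%N in ch.
have al1 : 1 <= al by apply: climb_a_ge1.
have P2 u v : M u <= M v -> 0 <= (al - 1) * (M v - M u).
  by move=> uv; rewrite mulr_ge0 ?subr_ge0.
have P3 u v : M u <= M v -> 0 <= al * (M v - M u).
  by move=> uv; rewrite mulr_ge0 ?subr_ge0 // (le_trans _ al1).
have TT : climb_t j.+1 = (3 * T)%N by rewrite /T /=; natlia.
have T5 : (5 <= T)%N by rewrite /T; natlia.
have star' x y : (a <= x <= y)%N -> (y <= b)%N -> X j x -> X j y ->
   conn x y (sg * r j.+1) 4 \/ exists2 t, X j.+1 t & (x <= t <= y)%N.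
  move=> h1 h2 xx xy; case: (ltnP x y) => lt.
    apply: star => //; first by natlia.
    have : M a <= M x by apply: Mmono; natlia.
    have : M y <= M b by apply: Mmono; natlia.
    by lra.
  by have -> : x = y by [natlia]; left; apply: conn_le (conn_refl y).
rewrite TT; case: (ch a b _ _) => [||c|[x [y [ax yb /andP[xx xy] c1 c2]]]]; [by natlia|by []| |].
  by left; apply: conn_le c; rewrite ?beS; [lra|natlia].
have mx : M a <= M x by apply: Mmono; natlia.
have mxy : M x <= M y by apply: Mmono; natlia.
have my : M y <= M b by apply: Mmono; natlia.
case: (star' x y) => // [c3|[t Xt xty]].
  left; apply: conn_le (conn_trans (conn_trans c1 c3) c2); last by natlia.
  rewrite beS; have := P3 _ _ mxy; lra.
right.
pose P t := X j.+1 t && (x <= t <= y)%N.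
have exP : exists t, P t by exists t; rewrite /P Xt.
have bdP t' : P t' -> (t' <= y)%N by case/andP=> _ /andP[].
(* By extremality no point of level j + 1 lies before x' or after y', so every star needed in these
   gaps exists. A gap stops one edge short of its end; this edge is added separately. *)
case: (ex_minnP exP) => x' /andP[Xx' xx'] xmin.
case: (ex_maxnP exP bdP) => y' /andP[Xy' yy'] ymax.
have noP t' : X j.+1 t' -> (x <= t' <= y)%N -> (x' <= t' <= y')%N.
  by move=> h1 h2; rewrite xmin ?ymax // /P h1.
have xy' : (x' <= y')%N by have := noP x' Xx' xx'; natlia.
exists x', y'; split; [by natlia|by natlia|by rewrite Xx'| |].
  case: (eqVneq x' x) => [->|ne]; first by apply: conn_le c1; [rewrite beS; lra|natlia].
  have e1 : conn x'.-1 x' (M x' - M x'.-1) 1.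
    by have := @conn_edge x'.-1; rewrite prednK; [apply; natlia|natlia].
  have m1 : M x <= M x'.-1 by apply: Mmono; natlia.
  have m2 : M x'.-1 <= M x' by apply: Mmono; natlia.
  case: (ch x x'.-1 _ _) => [||c|[x1 [y1 [h1 h2 /andP[Xx1 Xy1] d1 d2]]]]; [by natlia|by natlia| |].
    apply: conn_le (conn_trans (conn_trans c1 c) e1); last by natlia.
    rewrite beS; have := P2 _ _ m2; lra.
  have my1 : M x <= M y1 by apply: Mmono; natlia.
  have my2 : M y1 <= M x'.-1 by apply: Mmono; natlia.
  case: (star' x y1) => // [|||[t' Xt' tt]]; [by natlia|by natlia| |].
    move=> c3; apply: conn_le (conn_trans (conn_trans (conn_trans c1 c3) d2) e1); last by natlia.
    rewrite beS; have := P2 _ _ m2; have := P3 _ _ my1; lra.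
  by have := noP t' Xt'; natlia.
case: (eqVneq y' y) => [->|ne]; first by apply: conn_le c2; [rewrite beS; lra|natlia].
have e1 : conn y' y'.+1 (M y'.+1 - M y') 1 by apply: conn_edge; natlia.
have m1 : M y' <= M y'.+1 by apply: Mmono; natlia.
have m2 : M y'.+1 <= M y by apply: Mmono; natlia.
case: (ch y'.+1 y _ _) => [||c|[x1 [y1 [h1 h2 /andP[Xx1 Xy1] d1 d2]]]]; [by natlia|by natlia| |].
  apply: conn_le (conn_trans (conn_trans e1 c) c2); last by natlia.
  rewrite beS; have := P2 _ _ m1; lra.
have my1 : M y'.+1 <= M x1 by apply: Mmono; natlia.
have my2 : M x1 <= M y by apply: Mmono; natlia.
case: (star' x1 y) => // [||[t' Xt' tt]]; [by natlia| |].
  move=> c3; apply: conn_le (conn_trans (conn_trans (conn_trans e1 d1) c3) c2); last by natlia.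
  rewrite beS; have := P2 _ _ m1; have := P3 _ _ my2; lra.
by have := noP t' Xt'; natlia.
Qed.

End Climb.

(** * The tower of levels *)

Section Levels.
Variables (R : realType) (V : finType) (G : vcgraph V).
Hypotheses (wf : vc_wf G) (V0 : (0 < #|V|)%N).
Variables (b q th D0 : R) (lam K C : nat).
Hypotheses (b0 : 0 < b) (hlam : (2 * #|V| + 1 <= 2 ^ lam)%N)
  (q1 : 1 <= q) (qK : #|V|%:R <= q ^+ K) (hC : #|V|%:R * (1 - q^-1) ^+ C < 1)
  (th0 : 0 < th) (th1 : th < 1) (hD0 : ln (2 * capsum R G) + 2 * b <= b * D0).

Definition gLam : R := 26 * lam%:R.
Definition lnU : R := ln (1 + capsum R G).
(** Chosen so that the near-minimiser satisfies gLam |gamma| <= th max(total, 1), which is the decay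
    of the group capacity. *)
Definition kapmin : R := gLam * (lnU + 1) / (b * th).
Definition kapder : R := 2 * (kapmin + 5 * gLam * lnU / b + 1).
Definition cldiam : R := 4 * K.+1%:R.
Definition kaplev : R := gLam + 2 * bp_ratio b cldiam * kapder.
Definition lenlev : R := 2 * (cldiam + 2 + D0 + b^-1 + 1).

Definition sd (cv : V -> R) (ce : {set V} -> R) x : R :=
  (vcap G x)%:R * cv x + \sum_(e in vedges G | x \in e) (ecap G e)%:R * ce e.

Record level := Level {
  lcls : nat -> V -> option V;
  lcv : V -> R;
  lce : {set V} -> R }.

Definition level_ok (r : R) (D : groups V) (l : level) (D' : groups V) : Prop :=
  [/\ backprop G D (lcls l) kaplev (lenlev * r),
      nneg (lcv l) /\ nneg (lce l),
      forall x y W, joins G x y W -> (plen G W)%:R <= r ->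
        (exists k s, [/\ (k < C)%N, lcls l k x = Some s & lcls l k y = Some s]) \/
        1 <= pw (lcv l) (lce l) W /\ 1 < gtotal R D,
      (forall x, 0 < sd (lcv l) (lce l) x -> grp D' x <> None) /\
      (forall g, used D' g ->
         \sum_(x | grp D' x == Some g) 2 * sd (lcv l) (lce l) x <= (gcap D' g)%:R)
    & groups_ok G gLam r D' /\ gtotal R D' <= th * Num.max (gtotal R D) 1].

Lemma lam_ge1 : (0 < lam)%N.
Proof. by case: lam hlam => //; rewrite expn0 addn1 ltnS leqn0 muln_eq0 /= eqn0Ngt V0. Qed.

Lemma gLam_ge1 : 1 <= gLam.
Proof.
have : 1 <= lam%:R :> R by rewrite ler1n lam_ge1.
by rewrite /gLam; lra.
Qed.

Lemma lnU_ge0 : 0 <= lnU.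
Proof. by rewrite ln_ge0 // lerDl capsum_ge0. Qed.

Lemma kapmin_gt0 : 0 < kapmin.
Proof.
apply: divr_gt0; last exact: mulr_gt0.
apply: mulr_gt0; first exact: lt_le_trans gLam_ge1.
by have := lnU_ge0; lra.
Qed.

Lemma kapder_ge0 : 0 <= kapder.
Proof.
rewrite mulr_ge0 // !addr_ge0 ?(ltW kapmin_gt0) // divr_ge0 ?(ltW b0) //.
by rewrite mulr_ge0 ?lnU_ge0 // mulr_ge0 // (le_trans _ gLam_ge1).
Qed.

Lemma level_step (r rr : R) (D : groups V) : 0 < r -> rr <= r -> groups_ok G gLam rr D ->
  exists l D', level_ok r D l D'.
Proof.
move=> r0 rrr Dok.
have [gv [ge [g0 g1 hsz hmin]]] := near_minimizer wf b0 r0 kapmin_gt0 Dok.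
rewrite -/lnU in hsz hmin.
have [cls [cov cln]] := @cluster_cover R V (near G r gv ge) q K
  (@near_sym R V G r gv ge) (near_tri r0 g0 g1) (@near_le R V G r gv ge)
  (near_refl r0 g0 g1) q1 qK C hC.
pose P (W : seq V) := [&& simple_path G W, 1 <= pw gv ge W & (plen G W)%:R <= r].
have Ps W : P W -> simple_path G W by case/and3P.
have [hl [vl hlP]] := @greedy_maximal R V G wf P Ps lam hlam.
have Psh W : P W -> short_path G r W by case/and3P=> _ _ h; rewrite /short_path h orbT.
have [D' [D'ok D'n D'm D't]] := round_groups wf Ps vl hlam Psh.
have gl1 := gLam_ge1; have lu0 := lnU_ge0.
have w0 : 0 <= wsize G gv ge by apply: wsize_ge0.
have T0 : 0 <= gtotal R D by rewrite sumr_ge0.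
set T := gtotal R D in hsz T0.
have sz : gLam * wsize G gv ge <= th * Num.max T 1.
  have h : gLam * (lnU + 1) * wsize G gv ge <= th * (lnU * T + 1).
    move: hsz; rewrite /kapmin ler_pdivlMr // => h.
    have -> : gLam * (lnU + 1) * wsize G gv ge =
      th * (gLam * (lnU + 1) / (b * th) * wsize G gv ge * b) by field; rewrite !gt_eqF.
    by rewrite ler_pM2l.
  have mx : lnU * T + 1 <= (lnU + 1) * Num.max T 1.
    have a1 : T <= Num.max T 1 by rewrite le_max lexx.
    have a2 : 1 <= Num.max T 1 by rewrite le_max lexx orbT.
    have := ler_wpM2l lu0 a1; lra.
  have lp : 0 < lnU + 1 by lra.
  rewrite -(ler_pM2l lp); apply: (@le_trans _ _ (th * (lnU * T + 1))); first by lra.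
  by rewrite [leRHS]mulrCA ler_pM2l.
exists (Level cls (cv R G hl) (ce R G hl)), D'; split=> //=.
- rewrite (_ : lenlev * r = 2 * r * (cldiam + 2 + D0 + b^-1 + 1)); last by rewrite /lenlev; ring.
  have cd0 : 0 <= cldiam by rewrite mulr_ge0.
  exact: (level_backprop wf b0 r0 Dok rrr g0 g1 cd0 cln hD0 hmin).
- by split; [apply: cv_ge0|apply: ce_ge0].
- move=> x y W jW lW; case: (leP 1 (pw gv ge W)) => h.
    (* A heavy path forces |gamma| >= 1, which contradicts the decay when the total is at most 1. So
       levels of total at most 1 have no heavy path, and the tower may end there. *)
    right; split; first by apply: hlP; rewrite /P (joins_simple jW) h lW.
    have ws : 1 <= wsize G gv ge.
      by apply: (le_trans h); apply: pw_simple => //; apply: joins_simple jW.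
    rewrite -/T ltNge; apply/negP => T1.
    have mT : Num.max T 1 = 1 by apply/max_idPr.
    have tt := th1; rewrite mT in sz; have : 1 * 1 <= gLam * wsize G gv ge by apply: ler_pM.
    lra.
  left; apply: cov; apply/nearP; exists W; split=> //; rewrite /omg.
  have : (plen G W)%:R / r <= 1 by rewrite ler_pdivrMr // mul1r.
  lra.
- split=> //; apply: (le_trans D't); apply: le_trans sz; rewrite /gLam -mulrA ler_wpM2l //.
  by apply: (gvalid_size wf Ps hlam vl) => // W /and3P[].
Qed.

Variable r : nat -> R.
Hypotheses (r0 : forall j, 0 < r j) (rS : forall j, r j <= r j.+1).

Lemma level_chain : exists (D : nat -> groups V) (l : nat -> level),
  [/\ D 0%N = vertex_groups G, forall j, groups_ok G gLam (r j) (D j)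
    & forall j, level_ok (r j.+1) (D j) (l j) (D j.+1)].
Proof.
have /boolp.choice [f hf] (p : nat * groups V) : exists o : level * groups V,
   groups_ok G gLam (r p.1) p.2 -> level_ok (r p.1.+1) p.2 o.1 o.2.
  case: (boolp.pselect (groups_ok G gLam (r p.1) p.2)) => [h|n]; last first.
    (* A default for invalid groups; the recursion only meets valid ones. *)
    by exists (Level (fun _ _ => None) (fun=> 0) (fun=> 0), p.2).
  by have [l [D' h']] := level_step (r0 p.1.+1) (rS p.1) h; exists (l, D').
pose D := fix D j := if j is j'.+1 then (f (j', D j')).2 else vertex_groups G.
have Dok j : groups_ok G gLam (r j) (D j).
  elim: j => [|j IH] /=; last by have [_ _ _ _ []] := hf (j, D j) IH.
  have [h1 h2 h3 h4] := vertex_groups_ok wf (r 0%N).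
  have g1 := gLam_ge1; split=> // [y|e ee].
    by apply: (le_trans (h3 y)); rewrite ler_wpM2r.
  by apply: (le_trans (h4 e ee)); rewrite ler_wpM2r.
by exists D, (fun j => (f (j, D j)).1); split=> // j; apply: (hf (j, D j)).
Qed.

Lemma chain_total (D : nat -> groups V) (l : nat -> level) (J : nat) :
  D 0%N = vertex_groups G -> (forall j, level_ok (r j.+1) (D j) (l j) (D j.+1)) ->
  th ^+ J * capsum R G <= 1 -> gtotal R (D J) <= 1.
Proof.
move=> D00 hD hJ; have t0 := th0; have t1 := th1.
suff H j : gtotal R (D j) <= Num.max (th ^+ j * capsum R G) 1.
  by apply: (le_trans (H J)); rewrite ge_max hJ lexx.
elim: j => [|j IH].
  rewrite expr0 mul1r le_max D00; apply/orP; left; rewrite /gtotal /= big_mkcond.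
  by apply: ler_sum => g _; case: ifP.
have [_ _ _ _ [_ h]] := hD j; apply: (le_trans h).
apply: (@le_trans _ _ (th * Num.max (th ^+ j * capsum R G) 1)).
  by rewrite ler_pM2l // ge_max IH le_max lexx orbT.
rewrite maxr_pMr ?(ltW th0) // mulr1 exprS -mulrA ge_max le_max lexx /=.
by rewrite le_max (ltW th1) orbT.
Qed.

End Levels.

(** * Sampling positions with a uniform offset *)

Section Sampling.
Variables (N : nat) (S : nat -> nat).
Hypotheses (N0 : (0 < N)%N) (Smono : forall t, (S t <= S t.+1)%N).

(* with offset th, the multiples of N are hit by S at the step t *)
Definition attach (th t : nat) : bool := ((S t + th) %/ N < (S t.+1 + th) %/ N)%N.

Lemma attach_window th a b : (a <= b)%N -> (S a + N <= S b)%N ->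
  exists2 t, attach th t & (a <= t < b)%N.
Proof.
move=> ab h; apply: boolp.contrapT => no.
have H k : (a + k <= b)%N -> ((S (a + k)%N + th) %/ N <= (S a + th) %/ N)%N.
  elim: k => [|k IH] kb; first by rewrite addn0.
  have kb' : (a + k < b)%N by rewrite -addnS.
  apply: leq_trans (IH (ltnW kb')); rewrite addnS leqNgt; apply/negP => att.
  by apply: no; exists (a + k)%N => //; rewrite leq_addr.
have := H (b - a)%N; rewrite subnKC // leqnn => /(_ isT); rewrite leqNgt => /negP; apply.
apply: leq_trans (leq_div2r N (_ : S a + th + N <= _)%N); last by rewrite addnAC leq_add2r.
by rewrite (divnDr (S a + th)%N (dvdnn N)) divnn N0 addn1.
Qed.

Lemma sum_jumps (f : nat -> nat) k : (forall t, (f t <= f t.+1)%N) ->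
  (\sum_(th < k) (f th < f th.+1) <= f k - f 0)%N.
Proof.
move=> fm; have f0 t : (f 0 <= f t)%N by elim: t => // t IH; apply: leq_trans (fm t).
elim: k => [|k IH]; first by rewrite big_ord0.
rewrite big_ord_recr /=; have := fm k; have := f0 k; move: IH.
by case: ltnP => /= h1 h2 h3 h4; lia.
Qed.

(** Divided by [N], this says that a uniform offset attaches at [t] with probability at most the
    increment over [N]. *)
Lemma attach_count t : (\sum_(th < N) attach th t <= S t.+1 - S t)%N.
Proof.
rewrite /attach; have := Smono t; move: (S t) (S t.+1) => s s' ss.
rewrite -{1}(subnKC ss); elim: (s' - s)%N => [|d IH].
  by rewrite addn0 big1 // => th _; rewrite ltnn.
(* A unit increment of S equals a unit shift of the offset, so its jumps telescope over th to
   exactly one. *)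
apply: (@leq_trans (\sum_(th < N) ((((s + th) %/ N < (s + d + th) %/ N)%N : nat) +
     ((s + d + th) %/ N < (s + d + th.+1) %/ N)%N)))%N.
  apply: leq_sum => th _; rewrite addnS addSnnS.
  have : ((s + d + th) %/ N <= (s + d + th.+1) %/ N)%N by apply: leq_div2r; rewrite leq_add2l.
  by do 3!case: ltnP => /=; lia.
have mono k : ((s + d + k) %/ N <= (s + d + k.+1) %/ N)%N by apply: leq_div2r; rewrite leq_add2l.
have := @sum_jumps (fun k => (s + d + k) %/ N)%N N mono.
rewrite addn0 (divnDr (s + d)%N (dvdnn N)) divnn N0 addKn => h.
by rewrite big_split /= -addn1; apply: leq_add.
Qed.

End Sampling.

(** * The shortcut and its backward mapping *)

Lemma set2_eq (T : finType) (a b c d : T) : [set a; b] = [set c; d] -> a != b ->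
  (a = c /\ b = d) \/ (a = d /\ b = c).
Proof.
move=> e ab; have ha : a \in [set c; d] by rewrite -e !inE eqxx.
have hb : b \in [set c; d] by rewrite -e !inE eqxx orbT.
by move: ha hb ab; rewrite !inE => /orP[/eqP->|/eqP->] /orP[/eqP->|/eqP->]; rewrite ?eqxx; auto.
Qed.

Section Shortcut.
Variables (V : finType) (G : vcgraph V) (A B C : nat).
Variables (D : 'I_A -> 'I_B -> groups V) (cls : 'I_A -> 'I_B -> nat -> V -> option V).
Variable glen : 'I_A -> 'I_B -> nat.
Hypotheses (wf : vc_wf G) (glen0 : forall i j, (0 < glen i j)%N)
  (gcap0 : forall i j g, used (D i j) g -> (0 < gcap (D i j) g)%N).

(** Indices are scale, level and group, or scale, level, clustering and cluster centre: each group
    gets a node and each cluster a hub. *)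
Definition hnode : finType := (('I_A * 'I_B * V) + ('I_A * 'I_B * 'I_C * V))%type.
Definition hsize := #|hnode|.
Local Notation HV := (V + 'I_hsize)%type.

Definition grpn i j g : HV := inr (enum_rank (inl (i, j, g) : hnode)).
Definition hubn i j k s : HV := inr (enum_rank (inr (i, j, k, s) : hnode)).

Lemma grpn_inj i j g i' j' g' : grpn i j g = grpn i' j' g' -> [/\ i = i', j = j' & g = g'].
Proof. by case=> /enum_rank_inj [-> -> ->]. Qed.

Lemma grpn_hubn i j g i' j' k s : grpn i j g <> hubn i' j' k s.
Proof. by case=> /enum_rank_inj. Qed.

Variant hnode_spec : HV -> Type :=
  | HVertex v : hnode_spec (inl v)
  | HGroup i j g : hnode_spec (grpn i j g)
  | HHub i j k s : hnode_spec (hubn i j k s).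

Lemma hnodeP z : hnode_spec z.
Proof.
case: z => [v|o]; first by constructor.
rewrite -(enum_valK o); case: (enum_val o) => [[[i j] g]|[[[i j] k] s]].
  exact: HGroup.
exact: HHub.
Qed.

Definition hval T (fv : V -> T) (fg : 'I_A -> 'I_B -> V -> T)
    (fh : 'I_A -> 'I_B -> 'I_C -> V -> T) (z : HV) : T :=
  match z with
  | inl v => fv v
  | inr o => match (enum_val o : hnode) with
             | inl (i, j, g) => fg i j g
             | inr (i, j, k, s) => fh i j k s
             end
  end.

Lemma hval_vtx T (fv : V -> T) fg fh v : hval fv fg fh (inl v) = fv v.
Proof. by []. Qed.

Lemma hval_grp T (fv : V -> T) fg fh i j g : hval fv fg fh (grpn i j g) = fg i j g.
Proof. by rewrite /hval /grpn enum_rankK. Qed.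

Lemma hval_hub T (fv : V -> T) fg fh i j k s : hval fv fg fh (hubn i j k s) = fh i j k s.
Proof. by rewrite /hval /hubn enum_rankK. Qed.

Definition hvalE := (hval_vtx, hval_grp, hval_hub).
Arguments hval : simpl never.
Arguments grpn : simpl never.
Arguments hubn : simpl never.

Definition hnew (z z' : HV) : bool :=
  hval (fun x => hval xpred0 (fun i j g => grp (D i j) x == Some g) (fun _ _ _ _ => false) z')
       (fun i j g => hval xpred0 (fun _ _ _ => false)
          (fun i' j' k s => [&& i == i', j == j' &
             [exists x, (grp (D i j) x == Some g) && (cls i j k x == Some s)]]) z')
       (fun _ _ _ _ => false) z.

Variant hnew_spec (z z' : HV) : Prop :=
  | NewGroup x i j g of z = inl x & z' = grpn i j g & grp (D i j) x = Some g
  | NewHub x i j g k s of z = grpn i j g & z' = hubn i j k s & grp (D i j) x = Some g &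
      cls i j k x = Some s.

Lemma hnewP z z' : reflect (hnew_spec z z') (hnew z z').
Proof.
apply: (iffP idP).
  rewrite /hnew; case: (hnodeP z) => [x|i j g|i j k s]; rewrite ?hvalE //=.
    case: (hnodeP z') => [y|i j g|i j k s]; rewrite ?hvalE //= => /eqP h.
    exact: NewGroup h.
  case: (hnodeP z') => [y|i' j' g'|i' j' k s]; rewrite ?hvalE //=.
  case/and3P=> /eqP <- /eqP <- /existsP [x /andP[/eqP h1 /eqP h2]].
  exact: (NewHub erefl erefl h1 h2).
case=> [x i j g -> -> h|x i j g k s -> -> h1 h2]; rewrite /hnew.
  by rewrite !hvalE h.
by rewrite !hvalE !eqxx /=; apply/existsP; exists x; rewrite h1 h2 !eqxx.
Qed.

Definition newE : {set {set HV}} :=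
  [set [set p.1; p.2] | p in [set p : HV * HV | hnew p.1 p.2]].

(** Lengths and capacities must be functions of the edge as a set. A new edge contains exactly one
    group node, so this sum reads off the value of its group. *)
Definition gsum (f : 'I_A -> 'I_B -> V -> nat) (e : {set HV}) : nat :=
  \sum_(z in e) hval (fun=> 0%N) f (fun _ _ _ _ => 0%N) z.

(** Hubs can carry all groups of their level, so only groups restrict the flow. The [maxn] and the
    successor keep capacities positive. *)
Definition hncap (o : 'I_hsize) : nat :=
  hval (fun=> 0%N) (fun i j g => maxn 1 (gcap (D i j) g))
    (fun i j _ _ => (\sum_g gcap (D i j) g).+1) (inr o).

Definition shortcut : vcgraph HV :=
  augment G newE (fun=> 1%N) hncap (gsum (fun i j _ => glen i j)) (gsum (fun i j g => gcap (D i j) g)).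

Lemma hnew_neq z z' : hnew z z' -> z != z'.
Proof.
case/hnewP => [x i j g -> -> _|x i j g k s -> -> _ _] //.
by apply/eqP => -[/enum_rank_inj].
Qed.

Lemma newEP e : reflect (exists z z', hnew z z' /\ e = [set z; z']) (e \in newE).
Proof.
apply: (iffP imsetP) => [[[z z']]|[z [z' [h ->]]]]; last by exists (z, z'); rewrite ?inE.
by rewrite inE /= => h ->; exists z, z'.
Qed.

Lemma newE_has_group e : e \in newE -> exists i j g, [/\ used (D i j) g, grpn i j g \in e
  & forall f, gsum f e = f i j g].
Proof.
case/newEP=> z [z' [h ->]]; have zz := hnew_neq h.
have E f : gsum f [set z; z'] = (hval (fun=> 0%N) f (fun _ _ _ _ => 0%N) z +
    hval (fun=> 0%N) f (fun _ _ _ _ => 0%N) z')%N.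
  by rewrite /gsum big_setU1 ?inE //= big_set1.
case/hnewP: h => [x i j g ez ez' h|x i j g k s ez ez' h _]; exists i, j, g; split.
- by apply/existsP; exists x; rewrite h.
- by rewrite ez' !inE eqxx orbT.
- by move=> f; rewrite E ez ez' !hvalE.
- by apply/existsP; exists x; rewrite h.
- by rewrite ez !inE eqxx.
- by move=> f; rewrite E ez ez' !hvalE addn0.
Qed.

Lemma lift_edge_inl (e : {set V}) z : z \in lift_edge hsize e -> exists2 v, v \in e & z = inl v.
Proof. by case/imsetP=> v ve ->; exists v. Qed.

Lemma lift_edge_pre (e : {set V}) : [set v | inl v \in lift_edge hsize e] = e.
Proof.
apply/setP => v; rewrite inE; apply/imsetP/idP => [[u ue [->]] //|ve]; by exists v.
Qed.

Lemma lift_edge_notin e : (lift_edge hsize e \in newE) = false.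
Proof.
apply/negP => /newE_has_group [i [j [g [_ /lift_edge_inl [v _]]]]] //.
Qed.

Lemma shortcut_wf : vc_wf shortcut.
Proof.
case: wf => [w1 [w2 w3]]; split; last split.
- move=> e; rewrite inE => /orP[/imsetP [e' ee ->]|/newEP [z [z' [h ->]]]].
    by rewrite card_imset ?w1 // => x y [].
  by rewrite cards2 (hnew_neq h).
- case=> [v|o]; first exact: w2.
  rewrite /= /hncap /hval; case: (enum_val _) => [[[i j] g]|[[[i j] k] s]] //.
  by rewrite leq_max.
- move=> e; rewrite inE => /orP[/imsetP [e' ee ->]|ee] /=.
    by rewrite lift_edge_notin lift_edge_pre; apply: w3.
  by rewrite ee; have [i [j [g [ug _ E]]]] := newE_has_group ee; rewrite !E; split=> //; apply: gcap0.
Qed.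

Lemma shortcut_new : new_edges G newE.
Proof.
rewrite /new_edges -setI_eq0; apply/eqP/setP => e; rewrite !inE; apply/negP => /andP[h].
by case/imsetP=> e' _ ee; rewrite ee lift_edge_notin in h.
Qed.

Lemma lift_edge2 (x y : V) : lift_edge hsize [set x; y] = [set inl x; inl y].
Proof. by rewrite /lift_edge imsetU1 imset_set1. Qed.

Lemma shortcut_adj z z' : vadj shortcut z z' ->
  ([set z; z'] \in newE /\ (hnew z z' \/ hnew z' z)) \/
  exists x y, [/\ z = inl x, z' = inl y, vadj G x y & [set z; z'] = lift_edge hsize [set x; y]].
Proof.
rewrite /vadj inE => /orP[/imsetP [e' ee e2]|h]; last first.
  left; split=> //; case/newEP: h => u [u' [h e]].
  by have [[<- <-]|[<- <-]] := set2_eq (esym e) (hnew_neq h); auto.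
right; have : z \in lift_edge hsize e' by rewrite -e2 !inE eqxx.
have : z' \in lift_edge hsize e' by rewrite -e2 !inE eqxx orbT.
move=> /lift_edge_inl [y ye ez'] /lift_edge_inl [x xe ez]; exists x, y.
have exy : e' = [set x; y].
  by rewrite -(lift_edge_pre e') -e2 ez ez' -lift_edge2 lift_edge_pre.
by rewrite -exy; split.
Qed.

Lemma vadj_new z z' : hnew z z' -> vadj shortcut z z'.
Proof. by move=> h; rewrite /vadj inE; apply/orP; right; apply/newEP; exists z, z'. Qed.

Lemma vadj_lift x y : vadj G x y -> vadj shortcut (inl x) (inl y).
Proof. by move=> h; rewrite /vadj inE -lift_edge2; apply/orP; left; apply: imset_f. Qed.

(** For fixed scale and level, each vertex causes at most one edge to its group and, per clustering,
    one edge from its group to a hub. *)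
Lemma card_newE : (#|newE| <= A * B * #|V| * (1 + C))%N.
Proof.
apply: leq_trans (leq_imset_card _ _) _.
pose f1 (t : 'I_A * 'I_B * V) : HV * HV :=
  (inl t.2, grpn t.1.1 t.1.2 (odflt t.2 (grp (D t.1.1 t.1.2) t.2))).
pose f2 (t : 'I_A * 'I_B * 'I_C * V) : HV * HV :=
  (grpn t.1.1.1 t.1.1.2 (odflt t.2 (grp (D t.1.1.1 t.1.1.2) t.2)),
   hubn t.1.1.1 t.1.1.2 t.1.2 (odflt t.2 (cls t.1.1.1 t.1.1.2 t.1.2 t.2))).
have sub : [set p : HV * HV | hnew p.1 p.2] \subset
    (f1 @: [set: 'I_A * 'I_B * V]) :|: (f2 @: [set: 'I_A * 'I_B * 'I_C * V]).
  apply/subsetP => -[z z']; rewrite !inE /= => /hnewP [x i j g -> -> h|x i j g k s -> -> h1 h2].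
    by apply/orP; left; apply/imsetP; exists (i, j, x); rewrite ?inE // /f1 /= h.
  by apply/orP; right; apply/imsetP; exists (i, j, k, x); rewrite ?inE // /f2 /= h1 h2.
apply: leq_trans (subset_leq_card sub) _; apply: leq_trans (leq_card_setU _ _) _.
rewrite mulnDr muln1; apply: leq_add; apply: leq_trans (leq_imset_card _ _) _.
  by rewrite cardsT !card_prod !card_ord.
by rewrite cardsT !card_prod !card_ord -!mulnA (mulnC #|V|).
Qed.

End Shortcut.

Section WeakDuality.
Variables (R : realType) (V : finType) (G : vcgraph V).

Lemma flow_weight (F : flow R V) (gam : R) wv we : nneg wv -> nneg we ->
  flow_ok G F -> congestion_le G F gam ->
  \sum_(p <- F) p.2 * pw wv we p.1 <= gam * wsize G wv we.
Proof.
move=> w0 w1 okF [cv ce].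
have E p : p \in F -> p.2 * pw wv we p.1 = \sum_x wv x * (if x \in p.1 then p.2 else 0) +
    \sum_(e in vedges G) we e * (if e \in pedges p.1 then p.2 else 0).
  move=> pF; have [sp _] := okF p pF.
  have := @load_sum R V G wv we [:: p.1]; rewrite big_seq1 => ->; last first.
    by move=> W; rewrite inE => /eqP ->.
  rewrite mulrDr !mulr_sumr /vload /eload /=; congr (_ + _); apply: eq_bigr => x _;
    by rewrite addn0; case: ifP; rewrite ?mulr0 ?mulr1 // mulrC.
rewrite big_seq (eq_bigr _ E) -big_seq big_split /= /wsize mulrDr !mulr_sumr; apply: lerD.
  rewrite exchange_big /=; apply: ler_sum => x _; rewrite -mulr_sumr mulrCA ler_wpM2l //.
  by rewrite -big_mkcond; apply: cv.
rewrite exchange_big /=; apply: ler_sum => e ee; rewrite -mulr_sumr mulrCA ler_wpM2l //.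
by rewrite -big_mkcond; apply: ce.
Qed.

Lemma weighted_min_seq (T : eqType) (s : seq T) (P : pred T) (a c : T -> R) :
  (forall i, i \in s -> 0 <= a i) -> 0 < \sum_(i <- s | P i) a i ->
  exists i, [/\ i \in s, P i, 0 < a i &
    (\sum_(j <- s | P j) a j) * c i <= \sum_(j <- s | P j) a j * c j].
Proof.
case: s => [|x0 s'] a0 sp; first by rewrite big_nil ltxx in sp.
set s := x0 :: s' in a0 sp *.
pose Q (k : 'I_(size s)) := P (nth x0 s k) && (0 < a (nth x0 s k)).
have E (f : T -> R) : (forall i, i \in s -> a i = 0 -> f i = 0) ->
    \sum_(i <- s | P i) f i = \sum_(k | Q k) f (nth x0 s k).
  move=> f0; rewrite (big_nth x0) big_mkord big_mkcondr /=; apply: eq_bigr => k _.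
  case: ltP => // h; apply: f0; first exact: mem_nth.
  by apply/le_anti; rewrite h a0 // mem_nth.
have E1 : \sum_(i <- s | P i) a i = \sum_(k | Q k) a (nth x0 s k) by apply: E.
have E2 : \sum_(i <- s | P i) a i * c i = \sum_(k | Q k) a (nth x0 s k) * c (nth x0 s k).
  by apply: (E (fun i => a i * c i)) => i _ ->; rewrite mul0r.
have ak (k : 'I_(size s)) : 0 <= a (nth x0 s k) by apply: a0; apply: mem_nth.
have sp' := sp; rewrite E1 in sp'.
have [|k [/andP[Pk kp] ck]] := @weighted_min R _ Q (fun k => a (nth x0 s k))
   (fun k => c (nth x0 s k)) (\sum_(j <- s | P j) a j * c j / \sum_(j <- s | P j) a j) ak sp'.
  by rewrite -E1 -E2 -mulr_suml divfK ?gt_eqF.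
exists (nth x0 s k); split=> //; first exact: mem_nth.
move: ck; rewrite -mulr_suml ler_pdivlMr // mulrC //.
Qed.

End WeakDuality.

Section Backward.
Variables (R : realType) (V : finType) (G : vcgraph V) (A B C : nat).
Variables (D : 'I_A -> 'I_B -> groups V) (cls : 'I_A -> 'I_B -> nat -> V -> option V).
Variables (glen : 'I_A -> 'I_B -> nat) (Len : 'I_A -> 'I_B -> R) (kap : R).
Hypotheses (wf : vc_wf G) (glen0 : forall i j, (0 < glen i j)%N)
  (gcap0 : forall i j g, used (D i j) g -> (0 < gcap (D i j) g)%N)
  (glenL : forall i j, Len i j <= (glen i j)%:R)
  (bp : forall i j, backprop G (D i j) (cls i j) kap (Len i j)).

Let H := @shortcut V G A B C D cls glen.

Section Convert.
Variables (wv : V -> R) (we : {set V} -> R) (Psi : 'I_A -> 'I_B -> V -> R).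
Hypotheses (w0 : nneg wv) (w1 : nneg we) (Psi0 : forall i j, nneg (Psi i j))
  (Psi1 : forall i j x y g, grp (D i j) x = Some g -> grp (D i j) y = Some g ->
     gwalk G wv we x y (Psi i j g) (Len i j))
  (Psi2 : forall i j k x y g g' s, grp (D i j) x = Some g -> grp (D i j) y = Some g' ->
     cls i j k x = Some s -> cls i j k y = Some s ->
     gwalk G wv we x y (Psi i j g + Psi i j g') (Len i j)).

(* A visit to a group is charged at most three times: on entering it from a
   hub, on leaving it, and on leaving the hub visited next. *)
Definition cwv : V + 'I_(hsize V A B C) -> R :=
  hval wv (fun i j g => if used (D i j) g then 3 * Psi i j g else 0) (fun _ _ _ _ => 0).
Definition cwe (e : {set V + 'I_(hsize V A B C)}) : R :=
  if e \in newE C D cls then 0 else we [set v | inl v \in e].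

(* [y] is the current position in [G] of a walk standing at [z], [c] the credit left *)
Definition hat (z : V + 'I_(hsize V A B C)) (y : V) (c : R) : Prop :=
  hval (fun x => y = x /\ c = 0)
       (fun i j g => grp (D i j) y = Some g /\ c = 2 * Psi i j g)
       (fun i j k s => exists g, [/\ grp (D i j) y = Some g, cls i j k y = Some s & c = Psi i j g]) z.

Lemma cwv_ge0 : nneg cwv.
Proof.
move=> z; rewrite /cwv; case: (hnodeP z) => [v|i j g|i j k s]; rewrite !hvalE //.
by case: ifP => // _; rewrite mulr_ge0 ?Psi0.
Qed.

Lemma cwe_ge0 : nneg cwe.
Proof. by move=> e; rewrite /cwe; case: ifP. Qed.

(** Amortised accounting. Entering a group from a vertex changes nothing in [G]; leaving it costs
    [Psi], moving to the member that witnesses the edge used. From a hub to the next group, [Psi] of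
    the old group is paid by the credit and [Psi] of the new one by its node weight. *)
Lemma convert_step z z' y c : vadj H z z' -> hat z y c -> exists y' c', hat z' y' c' /\
  exists c1 l1, [/\ gwalk G wv we y y' c1 l1, c1 + c' <= c + (cwv z' + cwe [set z; z'])
     & l1 <= lenv R H z' + lene R H [set z; z']].
Proof.
move=> adj hz; have [[nE hn]|[x [x' [ez ez' gx eE]]]] := shortcut_adj adj; last first.
  move: hz; rewrite {1}/hat ez hvalE => -[-> ->]; exists x', 0; split; first by rewrite /hat ez' hvalE.
  exists (wv x' + we [set x; x']), ((vlen G x')%:R + (elen G [set x; x'])%:R); split.
  - exists [:: x']; split=> //; first by rewrite /= gx.
      by rewrite tw_cons tw_nil addr0.
    by rewrite tw_cons tw_nil addr0.
  - by rewrite -ez eE /cwe lift_edge_notin (lift_edge_pre A B C) /cwv ez' hvalE addr0 add0r.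
  - by rewrite -ez eE /lenv /lene ez' /= lift_edge_notin (lift_edge_pre A B C).
have [i0 [j0 [g0 [ug0 gin elE]]]] := newE_has_group nE.
have lE : lene R H [set z; z'] = (glen i0 j0)%:R by rewrite /lene /= nE elE.
have cE : cwe [set z; z'] = 0 by rewrite /cwe nE.
have lv0 : 0 <= lenv R H z' by apply: lenv_ge0.
have cv0 := cwv_ge0 z'.
have glE := glenL i0 j0.
have P0 i j g : 0 <= Psi i j g by apply: Psi0.
have usedP i j x g : grp (D i j) x = Some g -> used (D i j) g.
  by move=> h; apply/existsP; exists x; rewrite h.
case: hn => /hnewP [x i j g e1 e2 hx|x i j g k s e1 e2 hx hs].
- move: hz; rewrite {1}/hat e1 hvalE => -[-> ->]; exists x, (2 * Psi i j g).
  split; first by rewrite /hat e2 hvalE.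
  exists 0, 0; split; first exact: gwalk_refl.
    by rewrite -e1 cE /cwv e2 hvalE (usedP _ _ _ _ hx); have := P0 i j g; lra.
  by rewrite -e1 lE addr_ge0.
- have [ei ej eg] : [/\ i0 = i, j0 = j & g0 = g].
    by move: gin; rewrite e1 e2 !inE => /orP[/eqP/grpn_inj|/eqP/grpn_hubn].
  subst i0 j0 g0; move: hz; rewrite {1}/hat e1 hvalE => -[hy ->]; exists x, (Psi i j g); split.
    by rewrite /hat e2 hvalE; exists g.
  exists (Psi i j g), (Len i j); split; first exact: Psi1.
    by rewrite -e1 cE; have := P0 i j g; lra.
  by rewrite -e1 lE; lra.
- have [ei ej eg] : [/\ i0 = i, j0 = j & g0 = g].
    by move: gin; rewrite e1 e2 !inE => /orP[/eqP/grpn_inj|/eqP].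
  subst i0 j0 g0; move: hz; rewrite {1}/hat e2 hvalE => -[hy ->]; exists x, 0; split.
    by rewrite /hat e1 hvalE.
  exists (Psi i j g), (Len i j); split; first exact: Psi1.
    by rewrite -e2 cE; have := P0 i j g; lra.
  by rewrite -e2 lE; lra.
- have [ei ej eg] : [/\ i0 = i, j0 = j & g0 = g].
    by move: gin; rewrite e1 e2 !inE => /orP[/eqP/grpn_hubn|/eqP/grpn_inj].
  subst i0 j0 g0; move: hz; rewrite {1}/hat e2 hvalE => -[g' [hy hy' ->]].
  exists x, (2 * Psi i j g); split; first by rewrite /hat e1 hvalE.
  exists (Psi i j g' + Psi i j g), (Len i j); split; first exact: Psi2 hy hx hy' hs.
    by rewrite -e2 cE /cwv e1 hvalE (usedP _ _ _ _ hx); lra.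
  by rewrite -e2 lE; lra.
Qed.

Lemma convert_walk z P y c w : path (vadj H) z P -> last z P = inl w -> hat z y c ->
  gwalk G wv we y w (c + tw cwv cwe z P) (tw (lenv R H) (lene R H) z P).
Proof.
elim: P z y c => [|z' P IH] z y c /=.
  move=> _ ->; rewrite /hat hvalE => -[-> ->]; rewrite !tw_nil addr0; exact: gwalk_refl.
case/andP=> adj pp lw hz; have [y' [c' [hz' [c1 [l1 [g1 h1 h2]]]]]] := convert_step adj hz.
apply: gwalk_le (gwalk_trans g1 (IH z' y' c' pp lw hz')).
  by rewrite tw_cons; lra.
by rewrite tw_cons; lra.
Qed.

Lemma convert_path v w P : joins H (inl v) (inl w) P -> exists q,
  [/\ joins G v w q, pw wv we q <= pw cwv cwe P & (plen G q <= plen H P)%N].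
Proof.
case/joins_pathP => p [-> pp up lp].
have h0 : hat (inl v) v 0 by rewrite /hat hvalE.
have [q [pq lq cq lenq]] := convert_walk pp lp h0.
have [u [ju _ sv se]] := shorten_walk pq; rewrite lq in ju; exists (v :: u).
have uu : uniq (v :: u) by case/joins_pathP: ju => ? [[->]].
split=> //.
  apply: (@le_trans _ _ (pw wv we (v :: q))); first exact: pw_sub.
  by rewrite add0r in cq; rewrite !pw_tw; apply: lerD => //; rewrite /cwv hvalE.
rewrite -(ler_nat R); apply: (@le_trans _ _ (plen G (v :: q))%:R).
  by rewrite !plen_pw; apply: (pw_sub (@lenv_ge0 R V G) (@lene_ge0 R V G)).
by rewrite !plen_pw !pw_tw; apply: lerD.
Qed.

Lemma cwsize : wsize H cwv cwe = wsize G wv we +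
  \sum_i \sum_j 3 * \sum_(g | used (D i j) g) (gcap (D i j) g)%:R * Psi i j g.
Proof.
rewrite /wsize big_sumType /= [RHS]addrAC; congr (_ + _ + _).
- rewrite (reindex (@enum_rank (hnode V A B C))) /=; last first.
    by exists enum_val => o _; rewrite ?enum_rankK ?enum_valK.
  rewrite big_sumType /= [X in _ + X]big1 ?addr0; last first.
    by case=> [[[i j] k] s] _; rewrite /cwv /hval enum_rankK mul0r.
  rewrite [RHS]pair_big /=; under [RHS]eq_bigr do rewrite mulr_sumr big_mkcond /=.
  rewrite [RHS]pair_big /=; apply: eq_bigr => -[[i j] g] _ /=.
  rewrite /cwv /hncap /hval !enum_rankK.
  case: ifP => ug; last by rewrite mul0r.
  by rewrite (maxn_idPr (gcap0 ug)); ring.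
have inj : injective (lift_edge (V := V) (hsize V A B C)).
  by move=> e e' ee; rewrite -(lift_edge_pre A B C e) ee (lift_edge_pre A B C).
rewrite [LHS](bigID (fun e => e \in newE C D cls)) /= [X in X + _]big1 ?add0r; last first.
  by move=> e /andP[_ h]; rewrite /cwe h mul0r.
rewrite (eq_bigl (fun e => e \in [set lift_edge (hsize V A B C) e | e in vedges G])); last first.
  move=> e; rewrite inE; case eN: (e \in newE C D cls); rewrite /= ?andbF ?andbT ?orbF //.
  by apply/esym/negP => /imsetP [e' _ ee]; rewrite ee lift_edge_notin in eN.
rewrite big_imset /=; last by move=> e e' _ _; apply: inj.
by apply: eq_bigr => e ee; rewrite /cwe lift_edge_notin (lift_edge_pre A B C).
Qed.

End Convert.

(** Dual again: for given weights on [G], priced as [cwv] and [cwe] on the shortcut, each demand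
    pair uses the image of a cheapest path of the given flow. Each of the A B towers and levels adds
    3 kap to the congestion. *)
Lemma shortcut_backward (Dm : V -> V -> R) (h : R) : demand Dm ->
  routable H (@lift_demand _ _ (hsize V A B C) Dm) 1 h ->
  routable G Dm (1 + 3 * A%:R * B%:R * kap) h.
Proof.
move=> Dm0 [F [okF rF cF lF]]; apply: routable_dual => // wv we w0 w1.
have /boolp.choice [Psi hPsi] (p : 'I_A * 'I_B) := bp p.1 p.2 w0 w1.
pose Ps i j := Psi (i, j).
have Ps0 i j : nneg (Ps i j) by have [] := hPsi (i, j).
have Ps1 i j : \sum_(g | used (D i j) g) (gcap (D i j) g)%:R * Ps i j g <= kap * wsize G wv we.
  by have [] := hPsi (i, j).
have conv v w P : joins H (inl v) (inl w) P -> exists q,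
  [/\ joins G v w q, pw wv we q <= pw (cwv wv Ps) (cwe we) P & (plen G q <= plen H P)%N].
  apply: convert_path => // [i j x y g|i j k x y g g' s].
    by have [_ _ + _] := hPsi (i, j); apply.
  by have [_ _ _] := hPsi (i, j); apply.
pose W P := pw (cwv wv Ps) (cwe we) P.
pose pr v w (p : seq (V + 'I_(hsize V A B C)) * R) :=
  (ohead p.1 == Some (inl v)) && (ohead (rev p.1) == Some (inl w)).
have /boolp.choice [q hq] (vw : V * V) : exists q, 0 < Dm vw.1 vw.2 ->
    [/\ joins G vw.1 vw.2 q, (plen G q)%:R <= h
      & Dm vw.1 vw.2 * pw wv we q <= \sum_(p <- F | pr vw.1 vw.2 p) p.2 * W p.1].
  case: vw => v w /=; case: (ltP 0 (Dm v w)) => [dv|_]; last by exists [::].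
  have rr : \sum_(p <- F | pr v w p) p.2 = Dm v w by have := rF (inl v) (inl w).
  (* Some path of positive value costs at most the average; positivity is what gives the length
     bound h. *)
  have [||p [pF pp p0 pc]] := @weighted_min_seq R _ F (pr v w) snd (fun p => W p.1).
  - by move=> p /okF [].
  - by rewrite rr.
  have [sp _] := okF p pF.
  have jp : joins H (inl v) (inl w) p.1 by rewrite /joins sp; exact: pp.
  have [q [jq cq lq]] := conv v w p.1 jp; exists q => _; split=> //.
    by apply: le_trans (lF p pF p0); rewrite ler_nat.
  by rewrite rr in pc; apply: le_trans pc; rewrite ler_pM2l.
exists (fun v w => q (v, w)); split.
  by move=> v w dv; have [] := hq (v, w) dv.
have W0 P : 0 <= W P by apply: pw_ge0; [exact: cwv_ge0|exact: cwe_ge0].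
apply: (@le_trans _ _ (\sum_v \sum_w \sum_(p <- F | pr v w p) p.2 * W p.1)).
  apply: ler_sum => v _; apply: ler_sum => w _.
  have := Dm0 v w; rewrite le_eqVlt => /orP[/eqP <-|dv]; last by have [] := hq (v, w) dv.
  by rewrite mul0r big_seq_cond sumr_ge0 // => p /andP[/okF [_ p0] _]; rewrite mulr_ge0.
apply: (@le_trans _ _ (\sum_(p <- F) p.2 * W p.1)).
  have -> : \sum_v \sum_w \sum_(p <- F | pr v w p) p.2 * W p.1 =
     \sum_(p <- F) (\sum_v \sum_w (pr v w p)%:R) * (p.2 * W p.1).
    under eq_bigr do (under eq_bigr do rewrite big_mkcond /=).
    under eq_bigr do rewrite exchange_big /=.
    rewrite exchange_big /=; apply: eq_bigr => p _; rewrite mulr_suml; apply: eq_bigr => v _.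
    by rewrite mulr_suml; apply: eq_bigr => w _; case: ifP; rewrite ?mul1r ?mul0r.
  rewrite big_seq [leRHS]big_seq; apply: ler_sum => p /okF [_ p0].
  rewrite ler_piMl ?mulr_ge0 //.
  (* A path has one pair of ends, so it is counted for at most one demand. *)
  case: (pickP (fun vw : V * V => pr vw.1 vw.2 p)) => [[v w] /andP[/= /eqP e1 /eqP e2]|no].
    rewrite (bigD1 v) //= [X in _ + X]big1 ?addr0 => [|v' ne]; last first.
      apply: big1 => w' _; rewrite /pr e1 (inj_eq Some_inj) (inj_eq inl_inj) eq_sym (negbTE ne) //.
    rewrite (bigD1 w) //= [X in _ + X]big1 ?addr0 => [|w' ne]; first by rewrite lern1 leq_b1.
    by rewrite /pr e2; case: (_ =P Some (inl w')) => [[ww]|_]; [rewrite ww eqxx in ne|rewrite andbF].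
  by rewrite big1 // => v _; apply: big1 => w _; rewrite (no (v, w)).
apply: (le_trans (flow_weight (cwv_ge0 w0 Ps0) (cwe_ge0 w1) okF cF)).
rewrite mul1r cwsize mulrDl mul1r lerD2l.
apply: (@le_trans _ _ (\sum_(i < A) \sum_(j < B) 3 * (kap * wsize G wv we))).
  by apply: ler_sum => i _; apply: ler_sum => j _; rewrite ler_pM2l.
rewrite !sumr_const !card_ord -mulrnA -[X in X <= _]mulr_natl natrM.
by rewrite le_eqVlt; apply/orP; left; apply/eqP; ring.
Qed.

End Backward.

(** * Forward mapping *)

Section Windows.
Variables (R : realType) (V : finType) (x0 : V).

Lemma pw_window (wv : V -> R) we (p : seq V) a k : (a + k < size p)%N ->
  pw wv we (take k.+1 (drop a p)) =
  \sum_(a <= t < a + k) (wv (nth x0 p t) + we [set nth x0 p t; nth x0 p t.+1]) +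
  wv (nth x0 p (a + k)).
Proof.
elim: k a => [|k IH] a hk.
  rewrite addn0 in hk *; rewrite (drop_nth x0 hk) /= take0 pw_tw tw_nil big_geq //.
  by rewrite addr0 add0r.
have ha : (a < size p)%N by apply: leq_ltn_trans hk; rewrite leq_addr.
have ha1 : (a.+1 < size p)%N by apply: leq_ltn_trans hk; rewrite -addn1 leq_add2l.
rewrite (drop_nth x0 ha) [take _ _]/= (drop_nth x0 ha1) [take _ _]/=.
rewrite pw_tw tw_cons; have := IH a.+1; rewrite addSnnS => /(_ hk).
rewrite (drop_nth x0 ha1) [take _ _]/= pw_tw => e.
rewrite [in RHS]big_ltn ?addnS ?ltnS ?leq_addr // -[RHS]addrA.
rewrite addnS in e; rewrite -e; ring.
Qed.

Lemma pedges_nth (p : seq V) t : (t.+1 < size p)%N ->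
  [set nth x0 p t; nth x0 p t.+1] \in pedges p.
Proof.
case: p => // x p; rewrite /= ltnS; elim: p x t => [|y p IH] x [|t] //= h.
  by rewrite inE eqxx.
by rewrite inE IH ?orbT.
Qed.

Lemma vadj_nth (G : vcgraph V) (p : seq V) t : simple_path G p -> (t.+1 < size p)%N ->
  vadj G (nth x0 p t) (nth x0 p t.+1).
Proof. by move=> sp /pedges_nth; rewrite /vadj; apply: pedges_vedges. Qed.

End Windows.

Section PathForward.
Variables (R : realType) (V : finType) (G : vcgraph V) (A J C : nat).
Variables (D : 'I_A -> nat -> groups V) (lv : 'I_A -> nat -> level R V).
Variables (glen : 'I_A -> 'I_J.+1 -> nat) (i0 : 'I_A) (r : nat -> R) (Lc : R).
Hypotheses (wf : vc_wf G) (r0 : forall j, 0 < r j) (rS : forall j, r j.+1 = 4 * r j)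
  (Lc0 : 0 <= Lc)
  (glenU : forall j : 'I_J.+1, (glen i0 j)%:R <= Lc * r j.+1 + 1)
  (D00 : D i0 0 = vertex_groups G)
  (lv0 : forall j, nneg (lcv (lv i0 j)) /\ nneg (lce (lv i0 j)))
  (lstar : forall j x y W, joins G x y W -> (plen G W)%:R <= r j.+1 ->
        (exists k s, [/\ (k < C)%N, lcls (lv i0 j) k x = Some s & lcls (lv i0 j) k y = Some s]) \/
        1 <= pw (lcv (lv i0 j)) (lce (lv i0 j)) W /\ 1 < gtotal R (D i0 j))
  (lsd : forall j x, 0 < sd G (lcv (lv i0 j)) (lce (lv i0 j)) x -> grp (D i0 j.+1) x <> None)
  (lJ : gtotal R (D i0 J) <= 1).

Let cl (i : 'I_A) (j : 'I_J.+1) := lcls (lv i j).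
Let Dd (i : 'I_A) (j : 'I_J.+1) := D i j.
Let H := @shortcut V G A J.+1 C Dd cl glen.

Variables (N' : nat) (N'0 : (0 < N')%N).

(** Greedy price of position [t]: its vertex and the edge that follows. The sum along a stretch
    dominates the price of the subpath. *)
Definition dF (p : seq V) (j t : nat) (x : V) : R := lcv (lv i0 j) (nth x p t) +
  (if (t.+1 < size p)%N then lce (lv i0 j) [set nth x p t; nth x p t.+1] else 0).

(** The price in units of 1/N', rounded up. Zero stays zero, so that a point is attached only at
    vertices of positive demand, which have a group. *)
Definition nstep p j x t : nat :=
  if 0 < dF p j t x then (Num.truncn (N'%:R * dF p j t x)).+1 else 0%N.

Definition Ssum p j x t : nat := (\sum_(k < t) nstep p j x k)%N.

Definition Xat p th x (j t : nat) : bool :=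
  if j is j'.+1 then [&& (t < size p)%N, (j'.+1 <= J)%N & attach N' (Ssum p j' x) th t] else true.

Definition att (p : seq V) (th j : nat) (x : V) : bool :=
  (x \in p) && Xat p th (head x p) j (index x p).

Lemma dF_ge0 p j t x : 0 <= dF p j t x.
Proof. by have [h1 h2] := lv0 j; rewrite addr_ge0 //; case: ifP. Qed.

Lemma nstep_ge p j x t : (N'%:R : R) * dF p j t x <= (nstep p j x t)%:R.
Proof.
rewrite /nstep; case: ltP => h.
  by have /andP[_ /ltW] := truncn_itv (mulr_ge0 (ler0n R N') (ltW h)).
by rewrite (_ : dF p j t x = 0) ?mulr0 //; apply/le_anti; rewrite h dF_ge0.
Qed.

Lemma nstep_le p j x t : (nstep p j x t)%:R <= (N'%:R : R) * dF p j t x + ((0 < dF p j t x)%R : nat)%:R.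
Proof.
rewrite /nstep; case: ltP => h; last by rewrite addr0 mulr_ge0 ?dF_ge0.
have /andP[h1 _] := truncn_itv (mulr_ge0 (ler0n R N') (ltW h)).
by rewrite -natr1 lerD2r.
Qed.

Lemma SsumS p j x t : Ssum p j x t.+1 = (Ssum p j x t + nstep p j x t)%N.
Proof. by rewrite /Ssum big_ord_recr. Qed.

Lemma Ssum_mono p j x t : (Ssum p j x t <= Ssum p j x t.+1)%N.
Proof. by rewrite SsumS leq_addr. Qed.

Lemma sd_dF p j t x : simple_path G p -> (t < size p)%N -> 0 < dF p j t x ->
  0 < sd G (lcv (lv i0 j)) (lce (lv i0 j)) (nth x p t).
Proof.
move=> sp tp; have [h1 h2] := lv0 j; have [w1 [w2 w3]] := wf; rewrite /dF /sd => d0.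
have u0 : 0 < (vcap G (nth x p t))%:R :> R by rewrite ltr0n; case: (w2 (nth x p t)).
have s0 : 0 <= \sum_(e in vedges G | nth x p t \in e) (ecap G e)%:R * lce (lv i0 j) e.
  by rewrite sumr_ge0 // => e _; rewrite mulr_ge0.
case: (ltP 0 (lcv (lv i0 j) (nth x p t))) => c0.
  by apply: (@lt_le_trans _ _ ((vcap G (nth x p t))%:R * lcv (lv i0 j) (nth x p t))); rewrite ?mulr_gt0 // lerDl.
have cz : lcv (lv i0 j) (nth x p t) = 0 by apply/le_anti; rewrite c0 h1.
move: d0; rewrite cz mulr0 !add0r; case: ifP => [tp1 e0|]; last by rewrite ltxx.
have eV := vadj_nth x sp tp1; rewrite /vadj in eV.
rewrite (bigD1 [set nth x p t; nth x p t.+1]) /=; last by rewrite eV !inE eqxx.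
apply: ltr_wpDr; first by rewrite sumr_ge0 // => e _; rewrite mulr_ge0.
by rewrite mulr_gt0 // ltr0n; case: (w3 _ eV).
Qed.

Lemma Xat_grp p th x j t : simple_path G p -> (t < size p)%N -> Xat p th x j t ->
  exists g, grp (D i0 j) (nth x p t) = Some g.
Proof.
move=> sp tp; case: j => [|j] /=; first by rewrite D00; exists (nth x p t).
case/and3P=> _ _; rewrite /attach SsumS => h.
have n0 : (0 < nstep p j x t)%N.
  by rewrite lt0n; apply/eqP => e; rewrite e addn0 ltnn in h.
have : 0 < dF p j t x by move: n0; rewrite /nstep; case: ifP.
move/(sd_dF sp tp)/lsd; case: (grp _ _) => // g _; by exists g.
Qed.

Section OnePath.
Variables (v : V) (p' : seq V) (th : nat).
Let p := v :: p'.
Hypotheses (sp : simple_path G p).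
Let pos t := nth v p t.

(** Records that a group or hub is visited only on account of an attached vertex of the path;
    congestion is bounded through this. *)
Definition okz (z : V + 'I_(hsize V A J.+1 C)) : Prop :=
  hval (T := Prop) (fun x => x \in p)
    (fun i j g => i = i0 /\ exists x, att p th j x /\ grp (D i0 j) x = Some g)
    (fun i j k s => i = i0 /\ exists x g, att p th j x /\ grp (D i0 j) x = Some g) z.

Definition oke (e : {set V + 'I_(hsize V A J.+1 C)}) : Prop :=
  e \in newE C Dd cl \/ exists2 e0, e0 \in pedges p & e = lift_edge _ e0.

Definition pconn (a b : nat) (l : R) (t : nat) : Prop := exists q,
  [/\ path (vadj H) (inl (pos a)) q, last (inl (pos a)) q = inl (pos b),
      tw (lenv R H) (lene R H) (inl (pos a)) q <= l, (size q <= t)%N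
    & (forall z, z \in q -> okz z) /\ (forall e, e \in pedges (inl (pos a) :: q) -> oke e)].

(** Both ends of each edge are counted, so differences bound the length of a closed window. The
    total at most doubles. *)
Definition Mpre (t : nat) : R := \sum_(0 <= k < t)
  (lenv R G (pos k) + lene R G [set pos k; pos k.+1] + lenv R G (pos k.+1)).

Lemma MpreB a b : (a <= b)%N -> Mpre b - Mpre a = \sum_(a <= k < b)
  (lenv R G (pos k) + lene R G [set pos k; pos k.+1] + lenv R G (pos k.+1)).
Proof. by move=> ab; rewrite /Mpre (@big_cat_nat _ _ _ a) //= addrAC subrr add0r. Qed.

Lemma Mpre_mono a b : (a <= b <= size p')%N -> Mpre a <= Mpre b.
Proof.
case/andP=> ab _; rewrite -subr_ge0 MpreB // sumr_ge0 // => k _.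
by rewrite !addr_ge0 ?lenv_ge0 ?lene_ge0.
Qed.

Lemma plen_window a b : (a < b <= size p')%N ->
  (plen G (take (b - a).+1 (drop a p)))%:R <= Mpre b - Mpre a.
Proof.
case/andP=> ab bN; have e : (a + (b - a) = b)%N by rewrite subnKC // ltnW.
rewrite plen_pw (@pw_window _ _ v) e; last by rewrite /p /= ltnS.
rewrite MpreB ?(ltnW ab) // -/(pos b).
have -> : b = b.-1.+1 by rewrite prednK // (leq_ltn_trans _ ab).
set c := b.-1; have ac : (a <= c)%N by rewrite /c; case: (b) ab.
rewrite !big_nat_recr //= -addrA; apply: lerD; last exact: lexx.
apply: ler_sum => k _; by rewrite lerDl lenv_ge0.
Qed.

Lemma Mpre_total : Mpre (size p') <= 2 * (plen G p)%:R.
Proof.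
have -> : (plen G p)%:R = pw (lenv R G) (lene R G) (take (size p').+1 (drop 0 p)).
  by rewrite drop0 take_oversize // plen_pw.
rewrite (@pw_window _ _ v) ?add0n //= /Mpre.
have l0 k : 0 <= lenv R G (pos k) by apply: lenv_ge0.
have l1 k : 0 <= lene R G [set pos k; pos k.+1] by apply: lene_ge0.
have : \sum_(0 <= k < size p') lenv R G (pos k.+1) <=
   \sum_(0 <= k < size p') lenv R G (pos k) + lenv R G (pos (size p')).
  rewrite -(@big_nat_recr _ _ _ (size p') 0 (fun k => lenv R G (pos k))) //=.
  by rewrite [leRHS]big_nat_recl //= lerDr.
rewrite !big_split /= -/(pos _).
have : 0 <= \sum_(0 <= k < size p') lene R G [set pos k; pos k.+1] by rewrite sumr_ge0.
have := l0 (size p'); rewrite /pos; lra.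
Qed.

Lemma pconn_refl a : pconn a a 0 0.
Proof. by exists [::]; rewrite tw_nil. Qed.

Lemma pconn_trans a b c l1 t1 l2 t2 :
  pconn a b l1 t1 -> pconn b c l2 t2 -> pconn a c (l1 + l2) (t1 + t2).
Proof.
case=> q [q1 q2 q3 q4 [q5 q6]] [u [u1 u2 u3 u4 [u5 u6]]]; exists (q ++ u); split.
- by rewrite cat_path q1 q2.
- by rewrite last_cat q2.
- by rewrite tw_cat q2 lerD.
- by rewrite size_cat leq_add.
- split=> [z|e]; first by rewrite mem_cat => /orP[/q5|/u5].
  by rewrite pedges_cat q2 mem_cat => /orP[/q6|/u6].
Qed.

Lemma pconn_le a b l1 t1 l2 t2 : l1 <= l2 -> (t1 <= t2)%N -> pconn a b l1 t1 -> pconn a b l2 t2.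
Proof.
move=> h1 h2 [q [q1 q2 q3 q4 q5]]; exists q; split=> //; first exact: le_trans h1.
exact: leq_trans h2.
Qed.

Lemma pos_in a : (a <= size p')%N -> pos a \in p.
Proof. by move=> h; apply: mem_nth. Qed.

Lemma pconn_edge a : (a < size p')%N -> pconn a a.+1 (Mpre a.+1 - Mpre a) 1.
Proof.
move=> ha; have eP : [set pos a; pos a.+1] \in pedges p by apply: pedges_nth.
have eE : [set inl (pos a); inl (pos a.+1)] = lift_edge (hsize V A J.+1 C) [set pos a; pos a.+1].
  by rewrite lift_edge2.
exists [:: inl (pos a.+1)]; split=> //.
- by rewrite /= andbT; apply: vadj_lift; apply: vadj_nth.
- rewrite tw_cons tw_nil addr0 MpreB // big_nat1 eE {1}/lenv {1}/lene /=.
  rewrite lift_edge_notin (lift_edge_pre A J.+1 C) addrC.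
  by rewrite -addrA lerDr; apply: lenv_ge0.
- split=> [z|e]; first by rewrite inE => /eqP ->; rewrite /okz hvalE pos_in.
  by rewrite /= inE => /eqP ->; right; exists [set pos a; pos a.+1].
Qed.

Lemma att_pos j t : (t <= size p')%N -> Xat p th v j t -> att p th j (pos t).
Proof.
move=> tp Xt; rewrite /att pos_in // index_uniq //; by case/andP: sp.
Qed.

(** The walk vertex, group, hub, group, vertex. Four edges of length at most Lc r + 1, three new
    vertices of length 1 and the last vertex sum to at most (4 Lc + 8) r, as r >= 1. *)
Lemma star_walk j x y k s : (x < y <= size p')%N -> (j <= J)%N ->
  Xat p th v j x -> Xat p th v j y -> (k < C)%N ->
  lcls (lv i0 j) k (pos x) = Some s -> lcls (lv i0 j) k (pos y) = Some s ->
  1 <= r j.+1 -> lenv R G (pos y) <= r j.+1 ->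
  pconn x y ((4 * Lc + 8) * r j.+1) 4.
Proof.
move=> /andP[xy yN] jJ Xx Xy kC cx cy r1 ly.
have xN : (x <= size p')%N by apply: leq_trans (ltnW xy) yN.
pose jo : 'I_J.+1 := Ordinal (jJ : (j < J.+1)%N).
pose ko : 'I_C := Ordinal kC.
have [g gx] : exists g, grp (D i0 j) (pos x) = Some g by apply: Xat_grp Xx.
have [g' gy] : exists g, grp (D i0 j) (pos y) = Some g by apply: Xat_grp Xy.
have gx' : grp (Dd i0 jo) (pos x) = Some g := gx.
have gy' : grp (Dd i0 jo) (pos y) = Some g' := gy.
have cx' : cl i0 jo ko (pos x) = Some s := cx.
have cy' : cl i0 jo ko (pos y) = Some s := cy.
have n1 : hnew Dd cl (inl (pos x)) (grpn C i0 jo g).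
  by apply/hnewP; exact: (NewGroup cl erefl erefl gx').
have n2 : hnew Dd cl (grpn C i0 jo g) (hubn i0 jo ko s).
  by apply/hnewP; exact: (NewHub erefl erefl gx' cx').
have n3 : hnew Dd cl (grpn C i0 jo g') (hubn i0 jo ko s).
  by apply/hnewP; exact: (NewHub erefl erefl gy' cy').
have n4 : hnew Dd cl (inl (pos y)) (grpn C i0 jo g').
  by apply/hnewP; exact: (NewGroup cl erefl erefl gy').
have inE' z z' : hnew Dd cl z z' -> [set z; z'] \in newE C Dd cl by move=> h; apply/newEP; exists z, z'.
have len z z' : hnew Dd cl z z' -> (exists g, z = grpn C i0 jo g \/ z' = grpn C i0 jo g) ->
    lene R H [set z; z'] = (glen i0 jo)%:R.
  move=> h [h0 hz]; rewrite /lene /= (inE' _ _ h); have [i [j' [g0 [_ gin ->]]]] := newE_has_group (inE' _ _ h).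
  suff [-> -> _] : [/\ i = i0, j' = jo & g0 = h0] by [].
  move: gin; rewrite in_set2; case/hnewP: h => [x1 i1 j1 g1 e1 e2 _|x1 i1 j1 g1 k1 s1 e1 e2 _ _].
    rewrite e1 e2 => /orP[/eqP//|/eqP /grpn_inj [-> -> ->]].
    by case: hz => hz; [rewrite e1 in hz|rewrite e2 in hz; move/grpn_inj: hz].
  rewrite e1 e2 => /orP[/eqP /grpn_inj [-> -> ->]|/eqP /grpn_hubn //].
  by case: hz => hz; [rewrite e1 in hz; move/grpn_inj: hz|rewrite e2 in hz; move/esym/grpn_hubn: hz].
exists [:: grpn C i0 jo g; hubn i0 jo ko s; grpn C i0 jo g'; inl (pos y)]; split=> //.
- rewrite /= vadj_new //= vadj_new //= vadj_sym vadj_new //= vadj_sym vadj_new //.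
- rewrite !tw_cons tw_nil addr0.
  rewrite (len _ _ n1); last by exists g; right.
  rewrite (len _ _ n2); last by exists g; left.
  rewrite (setUC [set hubn i0 jo ko s]) (len _ _ n3); last by exists g'; left.
  rewrite (setUC [set grpn C i0 jo g']) (len _ _ n4); last by exists g'; right.
  have -> : lenv R H (grpn C i0 jo g) = 1 by [].
  have -> : lenv R H (hubn i0 jo ko s) = 1 by [].
  have -> : lenv R H (grpn C i0 jo g') = 1 by [].
  have -> : lenv R H (inl (pos y)) = lenv R G (pos y) by [].
  have := glenU jo; rewrite /=; lra.
- have ax := att_pos xN Xx; have ay := att_pos yN Xy.
  split=> [z|e].
    rewrite !inE => /or4P[] /eqP ->; rewrite /okz hvalE.
    + by split=> //; exists (pos x).
    + by split=> //; exists (pos x), g.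
    + by split=> //; exists (pos y).
    + exact: pos_in.
  rewrite /= !inE => /or4P[] /eqP ->; left; [exact: inE'|exact: inE'| |].
    by rewrite setUC; exact: inE'.
  by rewrite setUC; exact: inE'.
Qed.

(** A light subpath lies in a cluster and gives a star. A heavy one has greedy price at least 1, so
    the sampled sum grows by [N'] across it and some position is attached to level j + 1. At level J
    heavy subpaths are excluded by [lJ]. *)
Lemma path_star j x y : (x < y <= size p')%N -> Xat p th v j x -> Xat p th v j y ->
  Mpre y - Mpre x <= r j.+1 ->
  pconn x y ((4 * Lc + 8) * r j.+1) 4 \/ exists2 t, Xat p th v j.+1 t & (x <= t <= y)%N.
Proof.
move=> xy Xx Xy hM; have /andP[xy1 yN] := xy.
have jJ : (j <= J)%N by case: j Xx {Xy hM} => //= j /and3P[].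
have xs : (x <= y < size p)%N by rewrite (ltnW xy1) /= ltnS.
have jW := joins_sub v sp xs; rewrite -/(pos x) -/(pos y) in jW.
set W := take _ _ in jW.
have lW : (plen G W)%:R <= r j.+1 by apply: le_trans hM; apply: plen_window.
have l1 z : z \in W -> lenv R G z <= (plen G W)%:R.
  move=> zW; by rewrite plen_pw; apply: (pw_ge_vertex (@lenv_ge0 R V G) (@lene_ge0 R V G) zW).
have yW : pos y \in W.
  case/joins_pathP: jW => q [-> _ _ <-]; exact: mem_last.
have r1 : 1 <= r j.+1.
  apply: le_trans lW; apply: le_trans (l1 _ yW); rewrite /lenv ler1n.
  by case: wf => _ [h _]; case: (h (pos y)).
have [[k [s [kC cx cy]]]|[c1 gt]] := lstar jW lW.
  by left; apply: (star_walk xy jJ Xx Xy kC cx cy r1); apply: le_trans lW; apply: l1.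
right; have jJ' : (j < J)%N.
  rewrite ltn_neqAle jJ andbT; apply/eqP => e; have := lJ; rewrite -e; lra.
have Sxy : (Ssum p j v x + N' <= Ssum p j v y.+1)%N.
  rewrite -(ler_nat R) natrD -lerBrDl.
  have -> : (Ssum p j v y.+1)%:R - (Ssum p j v x)%:R = \sum_(x <= t < y.+1) (nstep p j v t)%:R :> R.
    rewrite /Ssum -!(big_mkord xpredT (nstep p j v)).
    rewrite (@big_cat_nat _ _ _ x) //=; last by rewrite ltnW // ltnS ltnW.
    by rewrite natrD addrAC subrr add0r natr_sum.
  apply: (@le_trans _ _ (\sum_(x <= t < y.+1) N'%:R * dF p j t v)); last first.
    by apply: ler_sum => t _; apply: nstep_ge.
  rewrite -mulr_sumr -[leLHS]mulr1 ler_wpM2l //; apply: (le_trans c1).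
  have e : (x + (y - x) = y)%N by rewrite subnKC // ltnW.
  rewrite /W (@pw_window _ _ v) e ?ltnS // big_nat_recr ?(ltnW xy1) //=.
  have [h1 h2] := lv0 j; apply: lerD; last by rewrite /dF lerDl; case: ifP.
  rewrite big_nat [leRHS]big_nat; apply: ler_sum => t /andP[_ ty].
  by rewrite /dF /= ltnS (leq_trans ty yN).
have xy2 : (x <= y.+1)%N by rewrite ltnW // ltnS ltnW.
have [t at_ /andP[xt ty]] := attach_window N'0 th xy2 Sxy.
exists t; last by rewrite xt -ltnS.
rewrite /= jJ' at_ !andbT ltnS; apply: leq_trans yN; by rewrite -ltnS.
Qed.

Lemma path_forward : 2 * (plen G p)%:R <= r J.+1 -> exists q,
  [/\ joins H (inl v) (inl (last v p')) q,
      (plen H q)%:R <= (plen G p)%:R + climb_a (4 * Lc + 8) J.+1 * (2 * (plen G p)%:R) +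
         climb_b (4 * Lc + 8) J.+1 * r J.+1,
      (psteps q <= climb_t J.+1)%N,
      forall z, z \in q -> okz z & forall e, e \in pedges q -> oke e].
Proof.
move=> hr; pose sg := 4 * Lc + 8; have sg0 : 0 <= sg by have := Lc0; rewrite /sg; lra.
have h0 : (0 <= size p' <= size p')%N by rewrite leqnn.
have hM : Mpre (size p') - Mpre 0 <= r J.+1.
  by rewrite MpreB // -/(Mpre _); apply: le_trans hr; apply: Mpre_total.
have M0 : Mpre 0 = 0 by rewrite /Mpre big_geq.
have := @climb_all R (size p') Mpre pconn (Xat p th v) r sg Mpre_mono pconn_refl pconn_trans
  pconn_le pconn_edge (fun=> isT) r0 rS sg0 path_star J.+1 0 (size p') h0 hM.
(* No position is attached to level J + 1, so the climb can only end with a complete connection. *)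
case=> [|[x [y [_ _ /andP[]]]]]; last by rewrite /= ltnn andbF.
case=> q [q1 q2 q3 q4 [q5 q6]].
have pe : pos (size p') = last v p' by rewrite /pos -[last v p']/(last v (v :: p')) -nth_last.
have p0 : pos 0 = v by [].
rewrite p0 in q1 q2 q3 q6; rewrite pe in q2.
have [u [ju su sv se]] := shorten_walk q1; rewrite q2 in ju.
exists (inl v :: u); split=> //.
- apply: (@le_trans _ _ (plen H (inl v :: q))%:R).
    rewrite !plen_pw; apply: (pw_sub (@lenv_ge0 R _ H) (@lene_ge0 R _ H)) => //.
    by case/joins_pathP: ju => ? [[->]].
  rewrite [leLHS]plen_pw [leLHS]pw_tw -[leRHS]addrA; apply: lerD.
    by rewrite plen_pw; apply: (pw_ge_vertex (@lenv_ge0 R V G) (@lene_ge0 R V G)); rewrite inE eqxx.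
  apply: (le_trans q3); rewrite lerD2r M0 subr0 ler_wpM2l ?Mpre_total //.
  exact: le_trans (climb_a_ge1 sg0 _).
- exact: leq_trans su q4.
- move=> z /sv; rewrite inE => /orP[/eqP->|/q5 //]; by rewrite /okz hvalE inE eqxx.
- by move=> e /se /q6.
Qed.

End OnePath.

Hypotheses
  (lcap : forall j g, used (D i0 j.+1) g ->
     \sum_(x | grp (D i0 j.+1) x == Some g) 2 * sd G (lcv (lv i0 j)) (lce (lv i0 j)) x
     <= (gcap (D i0 j.+1) g)%:R)
  (hN : forall j x, (j < J)%N -> 0 < sd G (lcv (lv i0 j)) (lce (lv i0 j)) x ->
     (vcap G x)%:R <= N'%:R * sd G (lcv (lv i0 j)) (lce (lv i0 j)) x).

(** Expected flow attached to level [j] at [x] under a uniform offset. *)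
Definition attmass (F : flow R V) j x : R :=
  \sum_(p <- F) \sum_(th < N') p.2 / N'%:R * (att p.1 th j x)%:R.

Definition massbound j x : R :=
  if j is j'.+1 then 2 * sd G (lcv (lv i0 j')) (lce (lv i0 j')) x else (vcap G x)%:R.

Lemma sd_ge0 j x : 0 <= sd G (lcv (lv i0 j)) (lce (lv i0 j)) x.
Proof.
have [h1 h2] := lv0 j; rewrite addr_ge0 ?mulr_ge0 // sumr_ge0 // => e _.
by rewrite mulr_ge0.
Qed.

(** With congestion 1, the vertex and edge prices contribute at most [sd] in expectation. Rounding
    up adds vcap / N', at most [sd] again by [hN]; this is the factor 2 in the group capacities. *)
Lemma attmass_le F j x : flow_ok G F -> congestion_le G F 1 -> (j <= J)%N ->
  attmass F j x <= massbound j x.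
Proof.
move=> okF [cF eF] jJ.
have N1 : 0 < N'%:R :> R by rewrite ltr0n.
have c1 y : \sum_(p <- F) (y \in p.1)%:R * p.2 <= (vcap G y)%:R.
  have := cF y; rewrite mul1r; apply: le_trans; rewrite [leRHS]big_mkcond.
  by apply: ler_sum => p _; case: ifP; rewrite ?mul1r ?mul0r.
case: j jJ => [|j] jJ.
  apply: le_trans (c1 x); apply: ler_sum => p _.
  under eq_bigr do rewrite /att /= andbT.
  rewrite sumr_const card_ord -[X in X <= _]mulr_natr.
  by rewrite mulrAC divfK ?gt_eqF // mulrC.
set s := sd G (lcv (lv i0 j)) (lce (lv i0 j)) x.
have [l1 l2] := lv0 j.
pose T p := \sum_(e in vedges G | x \in e) (e \in pedges p)%:R * lce (lv i0 j) e.
have per p : p \in F -> \sum_(th < N') p.2 / N'%:R * (att p.1 th j.+1 x)%:R <=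
    (0 < s)%R%:R * ((x \in p.1)%:R * p.2 * (lcv (lv i0 j) x + N'%:R^-1) + p.2 * T p.1).
  move=> pF; have [sp p0] := okF p pF; have p0' : 0 <= p.2 / N'%:R by rewrite divr_ge0.
  have T0 : 0 <= T p.1 by rewrite sumr_ge0 // => e _; rewrite mulr_ge0.
  case xp: (x \in p.1); last first.
    rewrite big1 => [|th _]; last by rewrite /att xp mulr0.
    by rewrite !mul0r add0r mulr_ge0 // mulr_ge0.
  set h := head x p.1; set t := index x p.1.
  have tp : (t < size p.1)%N by rewrite index_mem.
  have nt : nth h p.1 t = x by rewrite nth_index.
  rewrite -mulr_sumr.
  have cnt : \sum_(th < N') (att p.1 th j.+1 x)%:R <= (nstep p.1 j h t)%:R :> R.
    rewrite -natr_sum ler_nat; apply: leq_trans (_ : _ <= Ssum p.1 j h t.+1 - Ssum p.1 j h t)%N _; last first.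
      by rewrite SsumS addKn.
    apply: leq_trans (attach_count N'0 (Ssum_mono p.1 j h) t); apply: leq_sum => th _.
    by rewrite /att xp /= -/h -/t; case: (attach _ _ _ _); rewrite ?andbF // leq_b1.
  apply: (@le_trans _ _ (p.2 / N'%:R * (nstep p.1 j h t)%:R)); first by rewrite ler_wpM2l.
  have := nstep_le p.1 j h t; case d0: (0 < dF p.1 j t h); last first.
    rewrite addr0 (_ : dF p.1 j t h = 0); last by apply/le_anti; rewrite dF_ge0 leNgt d0.
    rewrite mulr0 => n0; apply: (@le_trans _ _ 0).
      by rewrite mulr_ge0_le0.
    by rewrite !mulr_ge0 // addr_ge0 // !mulr_ge0 // addr_ge0 // invr_ge0.
  have := sd_dF sp tp d0; rewrite nt -/s => s0 n0; rewrite s0 mul1r mul1r.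
  apply: (@le_trans _ _ (p.2 / N'%:R * (N'%:R * dF p.1 j t h + 1))); first by rewrite ler_wpM2l.
  have -> : p.2 / N'%:R * (N'%:R * dF p.1 j t h + 1) = p.2 * (dF p.1 j t h + N'%:R^-1).
    by field; rewrite gt_eqF.
  rewrite -mulrDr ler_wpM2l // /dF nt addrAC lerD2l.
  case: ifP => [t1|_]; last exact: T0.
  have eP := pedges_nth h t1; rewrite nt in eP.
  rewrite /T (bigD1 [set x; nth h p.1 t.+1]) /=; last first.
    by rewrite (pedges_vedges sp eP) !inE eqxx.
  by rewrite eP mul1r lerDl sumr_ge0 // => e _; rewrite mulr_ge0.
have tot : attmass F j.+1 x <= (0 < s)%R%:R *
    (\sum_(p <- F) (x \in p.1)%:R * p.2 * (lcv (lv i0 j) x + N'%:R^-1) + \sum_(p <- F) p.2 * T p.1).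
  rewrite /attmass -big_split /= mulr_sumr big_seq [leRHS]big_seq.
  by apply: ler_sum => p; apply: per.
apply: (le_trans tot); rewrite /= -/s; case: ltP => s0; last by rewrite mul0r mulr_ge0 ?sd_ge0.
rewrite mul1r -mulr_suml.
have E1 : \sum_(p <- F) p.2 * T p.1 <= \sum_(e in vedges G | x \in e) (ecap G e)%:R * lce (lv i0 j) e.
  rewrite /T; under eq_bigr do rewrite mulr_sumr.
  rewrite exchange_big /=; apply: ler_sum => e /andP[ee xe].
  under eq_bigr do rewrite mulrA; rewrite -mulr_suml ler_wpM2r //.
  have := eF e ee; rewrite mul1r; apply: le_trans; rewrite [leRHS]big_mkcond.
  by apply: ler_sum => p _; case: ifP; rewrite ?mulr1 ?mulr0.
have E2 : (\sum_(p <- F) (x \in p.1)%:R * p.2) * (lcv (lv i0 j) x + N'%:R^-1) <=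
    (vcap G x)%:R * (lcv (lv i0 j) x + N'%:R^-1).
  by rewrite ler_wpM2r // addr_ge0 // invr_ge0.
have E3 : (vcap G x)%:R * N'%:R^-1 <= s by rewrite ler_pdivrMr // mulrC; apply: hN.
rewrite mulrDr in E2.
have -> : 2 * s = s + s by ring.
rewrite {1}/s /sd; lra.
Qed.

Lemma group_mass F j g : flow_ok G F -> congestion_le G F 1 -> (j <= J)%N ->
  \sum_(x | grp (D i0 j) x == Some g) attmass F j x <= (gcap (D i0 j) g)%:R.
Proof.
move=> okF cF jJ; apply: (@le_trans _ _ (\sum_(x | grp (D i0 j) x == Some g) massbound j x)).
  by apply: ler_sum => x _; apply: attmass_le.
case: j {jJ} => [|j] /=.
  by rewrite D00 /= (big_pred1 g) // => x; rewrite (inj_eq Some_inj).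
case ug: (used (D i0 j.+1) g); first exact: lcap.
rewrite big_pred0 // => x; apply: contraFF ug => h.
by apply/existsP; exists x.
Qed.

(** Each flow path is split into [N'] equal copies, one per offset. The load of a group is then at
    most the expected mass attached at its members, which fits its capacity. *)
Lemma forward_flow (F : flow R V) (Dm : V -> V -> R) (Lmax : R) :
  flow_ok G F -> routes F Dm -> congestion_le G F 1 ->
  (forall p, p \in F -> 0 < p.2 -> 2 * (plen G p.1)%:R <= r J.+1 /\
     (plen G p.1)%:R + climb_a (4 * Lc + 8) J.+1 * (2 * (plen G p.1)%:R) +
         climb_b (4 * Lc + 8) J.+1 * r J.+1 <= Lmax) ->
  routable_t H (@lift_demand _ _ (hsize V A J.+1 C) Dm) 1 Lmax (climb_t J.+1).
Proof.
move=> okF rF cF lF.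
have N1 : 0 < N'%:R :> R by rewrite ltr0n.
(* Paths of value zero have no length bound and are dropped. *)
pose FP := [seq p <- F | 0 < p.2].
have FPin p : p \in FP -> [/\ p \in F, 0 < p.2 & simple_path G p.1].
  by rewrite mem_filter => /andP[p0 pF]; have [sp _] := okF p pF.
have FPsum (Q : pred (seq V * R)) : \sum_(p <- FP | Q p) p.2 = \sum_(p <- F | Q p) p.2.
  rewrite big_filter_cond [RHS]big_mkcond [LHS]big_mkcond big_seq [RHS]big_seq.
  apply: eq_bigr => p /okF [_ p0]; case: (Q p); rewrite ?andbF ?andbT //.
  by case: ltP => // h; apply/le_anti; rewrite h p0.
have okFP : flow_ok G FP by move=> p /FPin [pF _ _]; apply: okF.
have cFP : congestion_le G FP 1.
  by have [c1 c2] := cF; split=> [x|e ee]; rewrite FPsum; [apply: c1|apply: c2].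
have /boolp.choice [hp hhp] (pt : (seq V * R) * nat) : exists q, pt.1 \in FP ->
    forall v p', pt.1.1 = v :: p' -> [/\ joins H (inl v) (inl (last v p')) q,
      (plen H q)%:R <= Lmax, (psteps q <= climb_t J.+1)%N,
      forall z, z \in q -> okz v p' pt.2 z & forall e, e \in pedges q -> oke v p' e].
  case: pt => [[p f] th] /=; case: (boolP ((p, f) \in FP)) => [pin|_]; last by exists [::].
  have [/= pF f0 sp] := FPin _ pin; case: p sp pF pin => // v p' sp pF pin.
  have [lr lL] := lF _ pF f0.
  have [q [q1 q2 q3 q4 q5]] := path_forward th sp lr.
  by exists q => _ v' p'' [<- <-]; split=> //; apply: le_trans lL.
pose FH : flow R (V + 'I_(hsize V A J.+1 C))%type :=
  [seq (hp (p, nat_of_ord th), p.2 / N'%:R) | p <- FP, th <- enum 'I_N'].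
have FHin e : e \in FH -> exists p (th : 'I_N'), [/\ p \in FP, e.1 = hp (p, nat_of_ord th) & e.2 = p.2 / N'%:R].
  by case/allpairsP=> -[p th] /= [pin _ ->]; exists p, th.
have FHsum Q : \sum_(e <- FH | Q e.1) e.2 =
    \sum_(p <- FP) \sum_(th < N') (if Q (hp (p, nat_of_ord th)) then p.2 / N'%:R else 0).
  rewrite big_mkcond /FH big_allpairs_dep /=; apply: eq_bigr => p _; by rewrite big_enum.
have hpP p (th : 'I_N') : p \in FP -> exists v p', p.1 = v :: p' /\
    [/\ joins H (inl v) (inl (last v p')) (hp (p, nat_of_ord th)),
      (plen H (hp (p, nat_of_ord th)))%:R <= Lmax, (psteps (hp (p, nat_of_ord th)) <= climb_t J.+1)%N,
      forall z, z \in hp (p, nat_of_ord th) -> okz v p' th z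
    & forall e, e \in pedges (hp (p, nat_of_ord th)) -> oke v p' e].
  move=> pin; have [_ _ sp] := FPin p pin; have [v [p' e]] : exists v p', p.1 = v :: p'.
    by case: p.1 sp => // v p' _; exists v, p'.
  by exists v, p'; split=> //; apply: (hhp (p, nat_of_ord th)).
have avg (Q : pred (seq V * R)) : \sum_(p <- FP) \sum_(th < N') (if Q p then p.2 / N'%:R else 0) =
    \sum_(p <- FP | Q p) p.2.
  rewrite [RHS]big_mkcond; apply: eq_bigr => p _; case: (Q p); last by rewrite big1.
  by rewrite sumr_const card_ord -[LHS]mulr_natr divfK ?gt_eqF.
have load_le (Q : pred (seq (V + 'I_(hsize V A J.+1 C)))) (U : (seq V * R) -> nat -> R) :
    (forall p (th : 'I_N'), p \in FP -> 0 <= U p th) ->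
    (forall p (th : 'I_N'), p \in FP -> Q (hp (p, nat_of_ord th)) -> 1 <= U p th) ->
    \sum_(e <- FH | Q e.1) e.2 <= \sum_(p <- FP) \sum_(th < N') p.2 / N'%:R * U p th.
  move=> U0 U1; rewrite FHsum big_seq [leRHS]big_seq; apply: ler_sum => p pin.
  have [_ p0 _] := FPin p pin; have pN : 0 <= p.2 / N'%:R by rewrite divr_ge0 // ltW.
  apply: ler_sum => th _; case: ifP => [/(U1 _ _ pin) h|_]; last by rewrite mulr_ge0 ?U0.
  by rewrite ler_peMr.
have massE (Q : pred V) j : \sum_(p <- FP) \sum_(th < N') p.2 / N'%:R *
    (\sum_(x | Q x) (att p.1 th j x)%:R) = \sum_(x | Q x) attmass FP j x.
  rewrite /attmass [RHS]exchange_big /=; apply: eq_bigr => p _.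
  rewrite [RHS]exchange_big /=; apply: eq_bigr => th _; by rewrite mulr_sumr.
have att_ge1 (Q : pred V) p th j x : Q x -> att p th j x -> 1 <= \sum_(x | Q x) (att p th j x)%:R :> R.
  by move=> Qx ax; rewrite (bigD1 x) //= ax lerDl sumr_ge0.
have group_load i j g : \sum_(e <- FH | grpn C i j g \in e.1) e.2 <= (gcap (Dd i j) g)%:R.
  case: (eqVneq i i0) => [->|ne]; last first.
    rewrite big_seq_cond big1 // => e /andP[/FHin [p [th [pin -> _]]] h].
    have [v [p' [_ [_ _ _ /(_ _ h) + _]]]] := hpP p th pin.
    by rewrite /okz hvalE => -[e' _]; rewrite e' eqxx in ne.
  have jJ : (j <= J)%N by rewrite -ltnS.
  apply: le_trans (group_mass g okFP cFP jJ); rewrite -massE.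
  apply: (load_le (fun s => grpn C i0 j g \in s)
    (fun p th => \sum_(x | grp (D i0 j) x == Some g) (att p.1 th j x)%:R)) => [p th _|p th pin h]; first by rewrite sumr_ge0.
  have [v [p' [e [_ _ _ /(_ _ h) + _]]]] := hpP p th pin; rewrite /okz hvalE => -[_ [x [ax gx]]].
  by rewrite e; apply: att_ge1 ax; rewrite gx.
exists FH; split.
- move=> e /FHin [p [th [pin -> ->]]]; have [_ p0 _] := FPin p pin.
  have [v [p' [_ [j1 _ _ _ _]]]] := hpP p th pin.
  by split; [exact: joins_simple j1|rewrite divr_ge0 // ltW].
- move=> x y; rewrite (FHsum (fun s => (ohead s == Some x) && (ohead (rev s) == Some y))).
  have E p (th : 'I_N') : p \in FP ->
      (ohead (hp (p, nat_of_ord th)) == Some x) && (ohead (rev (hp (p, nat_of_ord th))) == Some y) =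
      if x is inl v then if y is inl w then
        (ohead p.1 == Some v) && (ohead (rev p.1) == Some w) else false else false.
    move=> pin; have [v [p' [e [/and3P[_ /eqP-> /eqP->] _ _ _ _]]]] := hpP p th pin.
    rewrite e ohead_rev /=; case: x => [a|a]; case: y => [c|c]; rewrite ?andbF //.
  transitivity (\sum_(p <- FP) \sum_(th < N')
     (if (if x is inl v then if y is inl w then
        (ohead p.1 == Some v) && (ohead (rev p.1) == Some w) else false else false)
      then p.2 / N'%:R else 0)).
    rewrite big_seq [RHS]big_seq; apply: eq_bigr => p pin; apply: eq_bigr => th _.
    by rewrite E.
  rewrite (avg (fun p => if x is inl v then if y is inl w then
        (ohead p.1 == Some v) && (ohead (rev p.1) == Some w) else false else false)) FPsum.
  by case: x {E} => [a|a]; case: y => [c|c]; rewrite /= ?big_pred0_eq //; apply: rF.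
- split=> [z|e].
    rewrite mul1r; case: (hnodeP z) => [v|i j g|i j k s].
    + have [c1 _] := cFP; have := c1 v; rewrite mul1r => cv; apply: le_trans cv.
      rewrite -avg (FHsum (fun s => inl v \in s)) big_seq [leRHS]big_seq; apply: ler_sum => p pin; apply: ler_sum => th _.
      have [_ p0 _] := FPin p pin; have pN : 0 <= p.2 / N'%:R by rewrite divr_ge0 // ltW.
      case: ifP => h; last by case: ifP.
      have [v' [p' [e [_ _ _ /(_ _ h) + _]]]] := hpP p th pin; by rewrite /okz hvalE e => ->.
    + apply: (le_trans (group_load i j g)).
      by rewrite /= /hncap -[inr _]/(grpn C i j g) hvalE ler_nat leq_maxr.
    + have -> : vcap H (hubn i j k s) = (\sum_g gcap (Dd i j) g).+1.
        by rewrite /= /hncap -[inr _]/(hubn i j k s) hvalE.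
      case: (eqVneq i i0) => [->|ne]; last first.
        rewrite big_seq_cond big1 // => e /andP[/FHin [p [th [pin -> _]]] h].
        have [v [p' [_ [_ _ _ /(_ _ h) + _]]]] := hpP p th pin.
        by rewrite /okz hvalE => -[e' _]; rewrite e' eqxx in ne.
      have jJ : (j <= J)%N by rewrite -ltnS.
      (* A hub is charged to all groups of its level. *)
      apply: (@le_trans _ _ (\sum_g (gcap (D i0 j) g)%:R)); last first.
        by rewrite -natr_sum ler_nat leqnSn.
      apply: (@le_trans _ _ (\sum_g \sum_(x | grp (D i0 j) x == Some g) attmass FP j x)); last first.
        by apply: ler_sum => g _; apply: group_mass.
      under [leRHS]eq_bigr do rewrite -massE.
      rewrite [leRHS]exchange_big /=; under [leRHS]eq_bigr do rewrite exchange_big /=.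
      under [leRHS]eq_bigr do (under eq_bigr do rewrite -mulr_sumr).
      apply: (load_le (fun s' => hubn i0 j k s \in s')
        (fun p th => \sum_g \sum_(x | grp (D i0 j) x == Some g) (att p.1 th j x)%:R)) => [p th _|p th pin h].
        by rewrite sumr_ge0 // => g _; rewrite sumr_ge0.
      have [v [p' [e [_ _ _ /(_ _ h) + _]]]] := hpP p th pin.
      rewrite /okz hvalE => -[_ [x [g [ax gx]]]]; rewrite e (bigD1 g) //=.
      apply: (@le_trans _ _ (\sum_(x | grp (D i0 j) x == Some g) (att (v :: p') th j x)%:R)).
        by apply: att_ge1 ax; rewrite gx.
      by rewrite lerDl sumr_ge0 // => g' _; rewrite sumr_ge0.
  rewrite mul1r inE => /orP[/imsetP [e0 ee ->]|eN].
    have -> : ecap H (lift_edge (hsize V A J.+1 C) e0) = ecap G e0.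
      by rewrite /= lift_edge_notin (lift_edge_pre A J.+1 C).
    have [_ c2] := cFP; have := c2 e0 ee; rewrite mul1r => cv; apply: le_trans cv.
    rewrite -avg (FHsum (fun s => lift_edge (hsize V A J.+1 C) e0 \in pedges s)) big_seq [leRHS]big_seq.
    apply: ler_sum => p pin; apply: ler_sum => th _.
    have [_ p0 _] := FPin p pin; have pN : 0 <= p.2 / N'%:R by rewrite divr_ge0 // ltW.
    case: ifP => h; last by case: ifP.
    have [v' [p' [pE [_ _ _ _ /(_ _ h)]]]] := hpP p th pin.
    case=> [|[e1 e1p e01]]; first by rewrite lift_edge_notin.
    have -> : e0 = e1 by rewrite -(lift_edge_pre A J.+1 C e0) e01 (lift_edge_pre A J.+1 C).
    by rewrite pE e1p.
  have [i [j [g [ug gin E]]]] := newE_has_group eN.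
  have -> : ecap H e = gcap (Dd i j) g by rewrite /= eN E.
  apply: le_trans (group_load i j g); rewrite big_mkcond [leRHS]big_mkcond.
  rewrite big_seq [leRHS]big_seq; apply: ler_sum => f /FHin [p [th [pin -> ->]]].
  (* A new edge has the capacity of its group, and a path using the edge visits the group node. *)
  have [_ p0 _] := FPin p pin; have pN : 0 <= p.2 / N'%:R by rewrite divr_ge0 // ltW.
  case: ifP => h; last by case: ifP.
  by rewrite (pedges_mem h gin).
- move=> e /FHin [p [th [pin -> _]]] _; by have [v [p' [_ [_ + _ _ _]]]] := hpP p th pin.
- move=> e /FHin [p [th [pin -> _]]] _; by have [v [p' [_ [_ _ + _ _]]]] := hpP p th pin.
Qed.

End PathForward.

(** * Putting the scales together *)

Section Assembly.
Variables (R : realType) (V : finType) (G : vcgraph V).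
Hypotheses (wf : vc_wf G) (V0 : (0 < #|V|)%N).
Variables (b q th D0 : R) (lam K C J Pm : nat).
Hypotheses (b0 : 0 < b) (hlam : (2 * #|V| + 1 <= 2 ^ lam)%N)
  (q1 : 1 <= q) (qK : #|V|%:R <= q ^+ K) (hC : #|V|%:R * (1 - q^-1) ^+ C < 1)
  (th0 : 0 < th) (th1 : th < 1) (D00 : 0 <= D0)
  (hD0 : ln (2 * capsum R G) + 2 * b <= b * D0)
  (hJ : th ^+ J * capsum R G <= 1)
  (hPm : forall p, simple_path G p -> (plen G p <= Pm)%N).

Let A := (up_log 2 Pm).+1.
Let Lc := lenlev b D0 K.
Let sg := 4 * Lc + 8.
(** Tower i is normalised at its top: level J + 1 has scale 2^(i + 1), and lower scales are obtained
    by dividing by 4. *)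
Let rs (i : 'I_A) (j : nat) : R := 2 ^+ i.+1 * 4 ^+ j / 4 ^+ J.+1.

Let rs0 i j : 0 < rs i j.
Proof. by rewrite divr_gt0 ?mulr_gt0 ?exprn_gt0. Qed.

Let rsS i j : rs i j.+1 = 4 * rs i j.
Proof. by rewrite /rs (exprS 4 j) [X in X / _]mulrCA -[LHS]mulrA. Qed.

Let rsJ i : rs i J.+1 = 2 ^+ i.+1.
Proof. by rewrite /rs mulfK // expf_neq0 // pnatr_eq0. Qed.

Lemma lenlev_ge0 : 0 <= Lc.
Proof.
have bi : 0 < b^-1 by rewrite invr_gt0.
have k0 : 0 <= cldiam R K by rewrite mulr_ge0.
by rewrite mulr_ge0 // addr_ge0 // addr_ge0 ?(ltW bi) // addr_ge0 // addr_ge0.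
Qed.

Lemma pow_up_log m : (0 < m)%N -> (2 ^ up_log 2 m <= 2 * m)%N.
Proof.
case: m => // -[|m] _; first by rewrite up_log1.
have /andP[h _] := @up_log_bounds 2 m.+2 isT isT.
have : (0 < up_log 2 m.+2)%N by rewrite up_log_gt0.
case: (up_log 2 m.+2) h => // k h _; rewrite expnS leq_mul2l /=; exact: ltnW.
Qed.

Lemma assembly : exists (k : nat) (E' : {set {set (V + 'I_k)%type}})
    (nlen ncap : 'I_k -> nat) (elen' ecap' : {set (V + 'I_k)%type} -> nat),
  let H := augment G E' nlen ncap elen' ecap' in
  [/\ vc_wf H, new_edges G E', (#|E'| <= A * J.+1 * #|V| * (1 + C))%N
    & flow_shortcut G H (climb_t J.+1) (1 + 2 * climb_a sg J.+1 + 16 * sg)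
        (1 + 3 * A%:R * J.+1%:R * kaplev G b th lam K)].
Proof.
have rsM i j : rs i j <= rs i j.+1 by rewrite rsS; have := rs0 i j; lra.
have chain i := level_chain wf V0 b0 hlam q1 qK hC th0 th1 hD0 (rs0 i) (rsM i).
have /boolp.choice [D hD] := chain; have /boolp.choice [lv hlv] := hD.
have Dok i j : groups_ok G (gLam R lam) (rs i j) (D i j) by have [_ h _] := hlv i.
have lok i j : level_ok G b th D0 lam K C (rs i j.+1) (D i j) (lv i j) (D i j.+1).
  by have [_ _ h] := hlv i.
have Di0 i : D i 0%N = vertex_groups G by have [h _ _] := hlv i.
have L0 := lenlev_ge0.
pose Len (i : 'I_A) (j : 'I_J.+1) : R := Lc * rs i j.+1.
pose glen i j := (Num.truncn (Len i j)).+1.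
have Len0 i j : 0 <= Len i j by rewrite mulr_ge0 // ltW.
have glenL i j : Len i j <= (glen i j)%:R by have /andP[_ /ltW] := truncn_itv (Len0 i j).
have glenU i (j : 'I_J.+1) : (glen i j)%:R <= Lc * rs i j.+1 + 1.
  by have /andP[h _] := truncn_itv (Len0 i j); rewrite /glen -natr1 lerD2r.
pose Dd (i : 'I_A) (j : 'I_J.+1) := D i j.
pose cl (i : 'I_A) (j : 'I_J.+1) := lcls (lv i j).
have gcap0 i j g : used (Dd i j) g -> (0 < gcap (Dd i j) g)%N.
  by move=> ug; have [h _ _ _] := Dok i j; have [] := h g ug.
have bp i j : backprop G (Dd i j) (cl i j) (kaplev G b th lam K) (Len i j).
  by have [] := lok i j.
exists (hsize V A J.+1 C), (newE C Dd cl), (fun=> 1%N), (hncap (C := C) Dd),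
  (gsum (fun i j _ => glen i j)), (gsum (fun i j g => gcap (Dd i j) g)); split.
- exact: (@shortcut_wf V G A J.+1 C Dd cl glen wf (fun _ _ => isT) gcap0).
- exact: shortcut_new.
- exact: card_newE.
split; last first.
  move=> Dm h dm rt; exact: (shortcut_backward gcap0 glenL bp dm rt).
move=> Dm h dm [F [okF rF cF lF]].
(* The tower is selected by the longest path actually used, not by [h]: this keeps the index below
   [A] even for huge [h]. *)
pose m := \max_(p <- F | 0 < p.2) plen G p.1.
have pm p : p \in F -> 0 < p.2 -> (plen G p.1 <= m)%N by move=> pF p0; apply: leq_bigmax_seq.
have mP : (m <= Pm)%N.
  by apply/bigmax_leqP_seq => p pF _; apply: hPm; have [] := okF p pF.
have mA : (up_log 2 m < A)%N by rewrite ltnS leq_up_log.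
pose i0 : 'I_A := Ordinal mA.
have lv0 j : nneg (lcv (lv i0 j)) /\ nneg (lce (lv i0 j)) by have [_ h1 _ _ _] := lok i0 j.
have lstar j x y W (jW : joins G x y W) (lW : (plen G W)%:R <= rs i0 j.+1) :
    (exists k s, [/\ (k < C)%N, lcls (lv i0 j) k x = Some s & lcls (lv i0 j) k y = Some s]) \/
        1 <= pw (lcv (lv i0 j)) (lce (lv i0 j)) W /\ 1 < gtotal R (D i0 j).
  by have [_ _ h1 _ _] := lok i0 j; apply: h1 jW lW.
have lsd j x : 0 < sd G (lcv (lv i0 j)) (lce (lv i0 j)) x -> grp (D i0 j.+1) x <> None.
  by have [_ _ _ [h1 _] _] := lok i0 j; apply: h1.
have lcap j g : used (D i0 j.+1) g ->
     \sum_(x | grp (D i0 j.+1) x == Some g) 2 * sd G (lcv (lv i0 j)) (lce (lv i0 j)) x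
     <= (gcap (D i0 j.+1) g)%:R.
  by have [_ _ _ [_ h1] _] := lok i0 j; apply: h1.
have lJ : gtotal R (D i0 J) <= 1 := chain_total th0 th1 (Di0 i0) (lok i0) hJ.
pose s j x := sd G (lcv (lv i0 j)) (lce (lv i0 j)) x.
have s0 j x : 0 <= s j x.
  have [h1 h2] := lv0 j; rewrite addr_ge0 ?mulr_ge0 // sumr_ge0 // => e _.
  by rewrite mulr_ge0.
(* [N'] must exceed every ratio of capacity to positive demand; ratios with zero demand are 0 by the
   convention on division. *)
pose S := \sum_(j < J) \sum_x (vcap G x)%:R / s j x.
have S0 : 0 <= S by rewrite sumr_ge0 // => j _; rewrite sumr_ge0 // => x _; rewrite divr_ge0.
pose N' := (Num.truncn S).+1.
have hN j x : (j < J)%N -> 0 < sd G (lcv (lv i0 j)) (lce (lv i0 j)) x ->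
     (vcap G x)%:R <= N'%:R * sd G (lcv (lv i0 j)) (lce (lv i0 j)) x.
  move=> jJ sp; rewrite -ler_pdivrMr //; have /andP[_ /ltW] := truncn_itv S0; apply: le_trans.
  rewrite /S (bigD1 (Ordinal jJ)) //= (bigD1 x) //= -addrA lerDl.
  rewrite addr_ge0 // sumr_ge0 // => [y _|j' _]; first by rewrite divr_ge0.
  by rewrite sumr_ge0 // => y _; rewrite divr_ge0.
apply: (forward_flow wf (rs0 i0) (rsS i0) L0 (glenU i0) (Di0 i0) lv0 lstar lsd lJ
  (ltn0Sn _ : (0 < N')%N) lcap hN okF rF cF) => p pF p0.
have lp := lF p pF p0; have [sp _] := okF p pF; have pmp := pm p pF p0.
have p1 : (0 < plen G p.1)%N.
  case: p.1 sp => // x t _; rewrite /plen big_cons -addnA ltn_addr //.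
  by case: wf => _ [h1 _]; case: (h1 x).
have h0 : 0 <= h by apply: le_trans lp.
have mh : m%:R <= h.
  rewrite -truncn_ge_nat //; apply/bigmax_leqP_seq => p' pF' p0'.
  by rewrite truncn_ge_nat // lF.
have m0 : (0 < m)%N by apply: leq_trans pmp.
have r1 : rs i0 J.+1 = 2 * (2 ^ up_log 2 m)%:R by rewrite rsJ exprS natrX.
have r2 : (2 ^ up_log 2 m)%:R <= 2 * m%:R :> R by rewrite -natrM ler_nat pow_up_log.
have r3 : m%:R <= (2 ^ up_log 2 m)%:R :> R by rewrite ler_nat up_logP.
have lm : (plen G p.1)%:R <= m%:R :> R by rewrite ler_nat.
rewrite r1; split; first by lra.
have sg0 : 0 <= sg by rewrite /sg; lra.
have ca := climb_a_ge1 sg0 J.+1; have cb := climb_b_le sg0 J.+1; have cb0 := climb_b_ge0 sg0 J.+1.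
rewrite -/sg; set al := climb_a sg J.+1 in ca *; set be := climb_b sg J.+1 in cb cb0 *.
have f1 : al * (plen G p.1)%:R <= al * h by rewrite ler_wpM2l //; lra.
(* The top scale is at most 4 m, hence at most 4 h: m is rounded up to a power of 2 and doubled for
   [Mpre_total]. This gives the summand 16 sg. *)
have f2 : be * (2 * (2 ^ up_log 2 m)%:R) <= 4 * sg * (4 * h).
  by apply: ler_pM => //; [rewrite mulr_ge0|lra].
lra.
Qed.

End Assembly.

(** * Numerical bounds *)

Lemma plen_gt0 (V : finType) (G : vcgraph V) p : vc_wf G -> simple_path G p -> (0 < plen G p)%N.
Proof.
case=> _ [wv _]; case: p => // x p _; rewrite /plen big_cons -addnA ltn_addr //.
by case: (wv x).
Qed.

Lemma flow_shortcut_le (R : realType) (V : finType) (k : nat) (G : vcgraph V)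
    (H : vcgraph (V + 'I_k)%type) (t : nat) (lam kap lam' kap' : R) :
  vc_wf H -> 0 <= lam -> lam <= lam' -> kap <= kap' ->
  flow_shortcut G H t lam kap -> flow_shortcut G H t lam' kap'.
Proof.
move=> wfH lam0 lle kle [fw bw]; split=> D h D0.
  move/(fw D h D0) => [F [okF rF cF lF sF]]; exists F; split=> // p pF p0.
  have lp := lF p pF p0; have [sp _] := okF p pF.
  (* For negative h the inequality lam h <= lam' h may fail, but then no path has positive value
     because lengths are positive. *)
  apply: (le_trans lp); case: (leP 0 h) => hh; first by rewrite ler_wpM2r.
  have : (plen H p.1)%:R <= 0 :> R by apply: (le_trans lp); rewrite mulr_ge0_le0 // ltW.
  by rewrite lern0 eqn0Ngt (plen_gt0 wfH sp).
move/(bw D h D0) => [F [okF rF [c1 c2] lF]]; exists F; split=> //.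
by split=> [x|e ee]; [apply: le_trans (c1 x) _|apply: le_trans (c2 e ee) _]; rewrite ler_wpM2r.
Qed.

Section Bounds.
Variables (R : realType) (V : finType) (G : vcgraph V) (cN : nat).
Hypotheses (wf : vc_wf G) (n2 : (2 <= #|V|)%N) (bd : vc_bounded G (#|V| ^ cN)).
Let n := #|V|.
Let L : R := ln n%:R.

Lemma plen_bound p : simple_path G p -> (plen G p <= n ^ cN.+2)%N.
Proof.
move=> sp; have /andP[s0 sn] := simple_path_size sp; have [bv be] := bd.
have h1 : (\sum_(x <- p) vlen G x <= n * n ^ cN)%N.
  apply: (@leq_trans (\sum_(x <- p) n ^ cN)); first by apply: leq_sum => x _; case: (bv x).
  by rewrite big_const_seq count_predT iter_addn_0 mulnC leq_mul2r sn orbT.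
have h2 : (\sum_(e <- pedges p) elen G e <= n * n ^ cN)%N.
  apply: (@leq_trans (\sum_(e <- pedges p) n ^ cN)).
    rewrite big_seq [leqRHS]big_seq; apply: leq_sum => e ep.
    by case: (be e (pedges_vedges sp ep)).
  rewrite big_const_seq count_predT iter_addn_0 mulnC leq_mul2r; apply/orP; right.
  apply: leq_trans sn; case: (p) => // x t; by rewrite /= size_pairmap.
rewrite /plen; apply: (leq_trans (leq_add h1 h2)).
by rewrite addnn -mul2n !expnS leq_mul2r n2 orbT.
Qed.

Lemma capsum_bounds : 1 <= capsum R G <= n%:R ^+ cN.+1.
Proof.
have [bv _] := bd; have [_ [wv _]] := wf; apply/andP; split.
  have /card_gt0P [v _] : (0 < #|V|)%N by apply: ltnW.
  apply: (@le_trans _ _ (vcap G v)%:R); first by rewrite ler1n; case: (wv v).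
  by rewrite /capsum (bigD1 v) //= lerDl sumr_ge0.
rewrite -natrX expnS /capsum -natr_sum ler_nat -sum_nat_const.
by apply: leq_sum => x _; case: (bv x).
Qed.

Lemma nR_gt0 : 0 < n%:R :> R.
Proof. by rewrite ltr0n; apply: ltnW. Qed.

Lemma ln2_gt0 : 0 < ln 2 :> R.
Proof. by rewrite ln_gt0 // ltr1n. Qed.

Lemma L_ge : ln 2 <= L.
Proof. by rewrite ler_ln ?posrE ?nR_gt0 // ler_nat. Qed.

Lemma ln_pow k : ln (n%:R ^+ k) = k%:R * L.
Proof. by rewrite lnXn ?nR_gt0 // mulr_natl. Qed.

Lemma ln_capsum2 : ln (2 * capsum R G) <= cN.+2%:R * L.
Proof.
have /andP[u1 u2] := capsum_bounds; have u0 : 0 < capsum R G by apply: lt_le_trans u1.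
rewrite lnM ?posrE // -(natr1 cN.+1) mulrDl mul1r addrC; apply: lerD; last exact: L_ge.
by rewrite -ln_pow ler_ln ?posrE ?exprn_gt0 ?nR_gt0.
Qed.

Lemma lnU_le : lnU R G <= cN.+2%:R * L.
Proof.
have /andP[u1 u2] := capsum_bounds; apply: le_trans ln_capsum2.
by rewrite ler_ln ?posrE; lra.
Qed.

Lemma up_log_le m k : (m <= n ^ k)%N -> (0 < m)%N -> (up_log 2 m)%:R * ln 2 <= k%:R * L + ln 2.
Proof.
move=> mk m0; have := pow_up_log m0; rewrite -(ler_nat R) natrX natrM => h.
have : ln ((2 : R) ^+ up_log 2 m) <= ln (2 * m%:R) by rewrite ler_ln ?posrE ?exprn_gt0 ?mulr_gt0 ?ltr0n.
rewrite lnXn // lnM ?posrE ?ltr0n // -[_ *+ up_log 2 m]mulr_natl => h1; apply: (le_trans h1).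
rewrite addrC lerD2r -ln_pow ler_ln ?posrE ?exprn_gt0 ?ltr0n //; last exact: ltnW.
by rewrite -natrX ler_nat.
Qed.

Lemma two_n1_le : (2 * n + 1 <= n ^ 3)%N.
Proof.
have n2' : (2 <= n)%N by [].
rewrite !expnS expn0 muln1; have : (2 * n <= n * n)%N by rewrite leq_mul2r n2' orbT.
have : (2 * (n * n) <= n * (n * n))%N by rewrite leq_mul2r n2' orbT.
move: n2'; move: (n * n)%N => m; move: (n * m)%N; lia.
Qed.

Lemma powRE x : powR (n%:R : R) x = expR (x * L).
Proof. by rewrite /powR gt_eqF ?nR_gt0. Qed.

End Bounds.

Lemma ler_pM4 (R : numDomainType) (a b c d a' b' c' d' : R) :
  0 <= a -> 0 <= b -> 0 <= c -> 0 <= d -> a <= a' -> b <= b' -> c <= c' -> d <= d' ->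
  a * b * c * d <= a' * b' * c' * d'.
Proof. by move=> *; do !(apply: ler_pM => //; rewrite ?mulr_ge0 //). Qed.

Theorem theorem5p2 (R : realType) (cN : nat) (c0 : R) (hc0 : 0 < c0) :
  exists (aL aK bK aT aS bS : R),
    [/\ 0 < aL, 0 < aK, 0 < bK & 0 < aT] /\ (0 < aS /\ 0 < bS) /\
    forall (V : finType) (G : vcgraph V) (eps : R),
      let n := #|V| in
      (2 <= n)%N -> vc_wf G -> vc_bounded G (n ^ cN) ->
      c0 / ln (n%:R : R) <= eps -> eps <= 1 ->
      exists (k : nat) (E' : {set {set (V + 'I_k)%type}})
             (nlen ncap : 'I_k -> nat) (elen' ecap' : {set (V + 'I_k)%type} -> nat)
             (t : nat),
        let H := augment G E' nlen ncap elen' ecap' in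
        [/\ vc_wf H, new_edges G E',
            (t%:R <= powR 2 (aT / eps)),
            (#|E'|%:R <= aS * powR (n%:R) (1 + bS * eps) * ln (n%:R) / eps ^+ 2)
          & flow_shortcut G H t (aL / eps ^+ 3)
              (aK * powR (n%:R) (bK * eps) * ln (n%:R) ^+ 3 / eps ^+ 2)].
Proof.
pose a : R := cN.+2%:R; pose l2 : R := ln 2.
have a0 : 0 < a by rewrite ltr0n.
have l20 : 0 < l2 := ln2_gt0 R.
have il2 : 0 < l2^-1 by rewrite invr_gt0.
have ic0 : 0 < c0^-1 by rewrite invr_gt0.
(* In [lenlev], the diameter gives 12, [D0] gives a + 2 and 1/b gives 1/c0, in units of y^2; with
   the constants 2 and 1 the sum is 17 + a + 1/c0. *)
pose Cl := 2 * (17 + a + c0^-1); pose Cs := 4 * Cl + 8.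
have Cl0 : 0 < Cl by rewrite /Cl; lra.
have Cs0 : 0 < Cs by rewrite /Cs; lra.
(* 104 is 26 times the 4 of [lamL]. *)
pose c1 := 104 * l2^-1; pose c2 := a + l2^-1.
pose c3 := 2 * (c1 * c2 + 5 * c1 * a + l2^-1); pose c4 := c1 + 8 * c3.
have c10 : 0 < c1 by rewrite mulr_gt0.
have c20 : 0 < c2 by rewrite /c2; lra.
have c30 : 0 < c3 by rewrite mulr_gt0 // !addr_gt0 // !mulr_gt0.
have c40 : 0 < c4 by rewrite /c4; lra.
pose CA := (a + 2) * l2^-1.
have CA0 : 0 < CA by rewrite mulr_gt0 //; lra.
pose c5 := l2^-1 ^+ 2 + 3 * CA * (a + 2) * c4.
have a2 : 0 < a + 2 by lra.
have c50 : 0 < c5 by rewrite addr_gt0 ?exprn_gt0 // !mulr_gt0.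
exists (3 + 8 * (a + 2) * Cs + 16 * Cs), (c5 / c0), 31, (5 * (a + 2)),
  (CA * (a + 2) * (1 + 2 * l2^-1)), 2.
split; first by split; rewrite ?divr_gt0 ?mulr_gt0 // ?addr_gt0 ?mulr_gt0.
split; first by split=> //; rewrite !mulr_gt0 // addr_gt0 // mulr_gt0.
move=> V G eps /= n2 wf bd he eps1.
set n := #|V|; pose L : R := ln n%:R.
have Ll : l2 <= L := L_ge R n2.
have L0 : 0 < L by apply: lt_le_trans Ll.
have e0 : 0 < eps by apply: lt_le_trans he; rewrite divr_gt0.
have cL : c0 <= eps * L by rewrite ler_pdivrMr // in he.
pose y := eps^-1; have y0 : 0 < y by rewrite invr_gt0.
have ey : eps * y = 1 by rewrite mulfV // gt_eqF.
have y1 : 1 <= y by rewrite invf_ge1.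
have epsE : eps = y^-1 by rewrite invrK.
have y12 : y <= y ^+ 2 by rewrite expr2 ler_peMl // ltW.
have y2 : 1 <= y ^+ 2 by apply: le_trans y12.
have y20 : 0 < y ^+ 2 by apply: lt_le_trans y2.
have yL : c0 * y <= L by rewrite -ler_pdivlMr // /y invrK mulrC.
pose c := eps * L; have c00 : 0 < c by rewrite mulr_gt0.
pose q : R := expR c; have q0 : 0 < q by apply: expR_gt0.
have qc : 1 + c <= q by apply: expR_ge1Dx.
have q1 : 1 <= q by lra.
have LE : L = c * y by rewrite /c mulrAC ey mul1r.
(* With cluster diameter O(y), b times it is O(eps L), so [bp_ratio] is n^O(eps); the price is 1/b =
   y^2 / L in length and congestion. *)
pose b := eps ^+ 2 * L; have b0 : 0 < b by rewrite mulr_gt0 ?exprn_gt0.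
have bi : b^-1 = y ^+ 2 / L by rewrite /b epsE; field; rewrite !gt_eqF.
pose K := (Num.truncn y).+1.
have /andP[K1 /ltW K2] := truncn_itv (ltW y0).
have Ky : K%:R <= 2 * y by rewrite /K -natr1; lra.
have ay0 : 0 <= a * y by rewrite mulr_ge0 // ltW.
pose J := (Num.truncn (a * y)).+1.
have /andP[J1 /ltW J2] := truncn_itv ay0.
have Jy : J.+1%:R <= (a + 2) * y by rewrite /J -natr1 -natr1; lra.
have qL0 : 0 <= q * L by rewrite mulr_ge0 // ltW.
pose C := (Num.truncn (q * L)).+1.
have /andP[C1 C2] := truncn_itv qL0.
pose lam := up_log 2 (2 * n + 1).
have hlam : (2 * #|V| + 1 <= 2 ^ lam)%N by apply: up_logP.
have lamL : lam%:R <= 4 * L * l2^-1.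
  rewrite ler_pdivlMr //; apply: (le_trans (up_log_le R n2 (two_n1_le n2) _)); first by rewrite addn1.
  by rewrite -/L -/l2; lra.
pose Pm := (n ^ cN.+2)%N.
have Pm0 : (0 < Pm)%N by rewrite expn_gt0 ltnW.
pose A := (up_log 2 Pm).+1.
have AL : A%:R <= CA * L.
  rewrite /CA mulrAC ler_pdivlMr // /A -natr1 mulrDl mul1r.
  have := up_log_le R n2 (leqnn Pm) Pm0; rewrite -/L -/l2 -/a; lra.
(* This makes b D0 equal to a L + 2 b, with a L an upper bound for ln(2 U). *)
pose D0 : R := a * y ^+ 2 + 2.
have D00 : 0 <= D0 by rewrite /D0 addr_ge0 // mulr_ge0 // ltW.
have hD0 : ln (2 * capsum R G) + 2 * b <= b * D0.
  have -> : b * D0 = a * L + 2 * b by rewrite /D0 /b epsE; field; rewrite gt_eqF.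
  by rewrite lerD2r; apply: ln_capsum2.
have nE : n%:R = expR L :> R by rewrite lnK // posrE (nR_gt0 R n2).
have qK : n%:R <= q ^+ K.
  rewrite nE -expRM_natl ler_expR {1}LE mulrC ler_pM2r //; exact: K2.
have hC : n%:R * (1 - q^-1) ^+ C < 1.
  apply: (@le_lt_trans _ _ (expR L * expR (C%:R * - q^-1))).
    rewrite nE ler_pM2l ?expR_gt0 // expRM_natl; apply: lerXn2r; rewrite ?nnegrE ?expR_ge0 //.
      by rewrite subr_ge0 invf_le1.
    exact: expR_ge1Dx.
  rewrite -expRD -[ltRHS]expR0 ltr_expR mulrN subr_lt0 ltr_pdivlMr // mulrC; exact: C2.
pose th : R := expR (- c).
have th0 : 0 < th by apply: expR_gt0.
have th1 : th < 1 by rewrite -[ltRHS]expR0 ltr_expR oppr_lt0.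
have thE : th = q^-1 by rewrite /th expRN.
have /andP[u1 u2] := capsum_bounds R wf n2 bd.
have hJ : th ^+ J * capsum R G <= 1.
  apply: (@le_trans _ _ (expR (J%:R * - c) * expR (a * L))).
    rewrite expRM_natl ler_pM2l ?exprn_gt0 //; apply: (le_trans u2).
    rewrite -/n nE -expRM_natl ler_expR ler_pM2r // ler_nat //.
  rewrite -expRD -[leRHS]expR0 ler_expR mulrN addrC subr_le0 LE mulrCA [X in _ <= X]mulrC ler_pM2l //.
have hPm p : simple_path G p -> (plen G p <= Pm)%N by apply: plen_bound.
have V0 : (0 < #|V|)%N by apply: ltnW.
have [k [E' [nlen [ncap [elen' [ecap' [wfH newH cardE fs]]]]]]] :=
  assembly wf V0 b0 hlam q1 qK hC th0 th1 D00 hD0 hJ hPm.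
rewrite -/A in cardE fs.
have CqL : C%:R <= q * L + 1 by rewrite /C -(natr1 (Num.truncn _)) lerD2r.
have kd0 : 0 <= kapder G b th lam by apply: kapder_ge0.
clear hlam qK hC hJ hPm K1 K2 J1 J2 C1 C2 u1 u2 hD0.
clearbody K J C A lam; clear Pm Pm0.
exists k, E', nlen, ncap, elen', ecap', (climb_t J.+1).
have lenB : lenlev b D0 K <= Cl * y ^+ 2.
  have ib : b^-1 <= c0^-1 * y ^+ 2.
    rewrite bi mulrC ler_pM2r // lef_pV2 ?posrE //; apply: (le_trans cL).
    by rewrite ler_piMl // ltW.
  have : cldiam R K <= 12 * y ^+ 2 by rewrite /cldiam -(natr1 K); move: (K%:R : R) Ky => z Kz; lra.
  by rewrite /lenlev /D0 /Cl; lra.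
set Lc := lenlev b D0 K in fs lenB.
have Lc0 : 0 <= Lc by apply: lenlev_ge0.
have sgB : 4 * Lc + 8 <= Cs * y ^+ 2 by rewrite /Cs; lra.
set sg := 4 * Lc + 8 in fs sgB.
have sg0 : 0 <= sg by rewrite /sg; lra.
have ieps k' : (eps ^+ k')^-1 = y ^+ k' by rewrite -exprVn.
split=> //.
- apply: (@le_trans _ _ (2 ^+ (5 * J.+1))).
    rewrite exprM (_ : 2 ^+ 5 = 32%:R :> R); last by ring.
    rewrite -natrX ler_nat; apply: (leq_trans (climb_t_le J.+1)); exact: leq_exp2r.
  rewrite /powR pnatr_eq0 /= -[X in X ^+ _]lnK ?posrE // -expRM_natl ler_expR ler_pM2r //.
  by rewrite natrM -/y -[leRHS]mulrA ler_pM2l.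
- rewrite ieps (powRE n2) -/L (_ : (1 + 2 * eps) * L = L + (c + c)); last by rewrite /c; ring.
  rewrite !expRD -nE -/q.
  apply: (@le_trans _ _ (A%:R * J.+1%:R * n%:R * (1 + C)%:R)).
    by rewrite -!natrM ler_nat.
  have C3 : (1 + C)%:R <= (1 + 2 * l2^-1) * (q * L).
    rewrite natrD; have : 2 <= 2 * l2^-1 * (q * L); last by lra.
    rewrite -[leLHS]mulr1 -mulrA ler_pM2l //.
    rewrite mulrC ler_pdivlMr // mul1r; apply: (le_trans Ll); by rewrite ler_peMl // ltW.
  apply: (@le_trans _ _ (CA * L * ((a + 2) * y) * n%:R * ((1 + 2 * l2^-1) * (q * L)))).
    exact: ler_pM4.
  have -> : CA * L * ((a + 2) * y) * n%:R * ((1 + 2 * l2^-1) * (q * L)) =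
    CA * (a + 2) * (1 + 2 * l2^-1) * (n%:R * q * L) * (L * y) by ring.
  have -> : CA * (a + 2) * (1 + 2 * l2^-1) * (n%:R * (q * q)) * L * y ^+ 2 =
    CA * (a + 2) * (1 + 2 * l2^-1) * (n%:R * q * L) * (q * y ^+ 2) by ring.
  have x1 : 0 < 1 + 2 * l2^-1 by lra.
  rewrite ler_wpM2l //.
    apply: mulr_ge0; first by rewrite ltW // !mulr_gt0.
    by rewrite mulr_ge0 ?(ltW L0) // mulr_ge0 // ltW.
  (* A surplus factor L is traded for c y, and c <= q: this is the second factor n^eps in the
     size. *)
  rewrite {1}LE -mulrA -expr2 ler_pM2r //; lra.
have q31 m : 1 <= q ^+ m by apply: exprn_ege1.
apply: flow_shortcut_le fs => //.
- have := climb_a_ge1 sg0 J.+1; lra.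
- rewrite ieps; have ca := climb_a_le sg0 J.+1.
  have y3 : y ^+ 2 <= y ^+ 3 by rewrite [leRHS]exprS ler_peMl // ltW.
  have h1 : J.+1%:R * (4 * sg) <= (a + 2) * y * (4 * (Cs * y ^+ 2)).
    by apply: ler_pM => //; lra.
  have h2 : (a + 2) * y * (4 * (Cs * y ^+ 2)) = 4 * (a + 2) * Cs * y ^+ 3 by ring.
  have h3 : Cs * y ^+ 2 <= Cs * y ^+ 3 by rewrite ler_pM2l.
  rewrite h2 in h1; lra.
have W1 : l2^-1 * L >= 1 by rewrite mulrC ler_pdivlMr // mul1r.
pose X := q * L * y ^+ 2.
have LyX : L * y ^+ 2 <= X by rewrite /X -mulrA ler_peMl // mulr_ge0 // ltW.
have glB : gLam R lam <= c1 * L by rewrite /gLam /c1; lra.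
have luB : lnU R G <= a * L by apply: lnU_le.
have lu0 := lnU_ge0 R G; have gl0 : 0 <= gLam R lam by rewrite mulr_ge0.
have k1 : kapmin G b th lam <= c1 * c2 * X.
  rewrite /kapmin thE.
  have -> : gLam R lam * (lnU R G + 1) / (b / q) = gLam R lam * (lnU R G + 1) * (q * b^-1).
    by field; rewrite !gt_eqF.
  have -> : c1 * c2 * X = (c1 * L) * (c2 * L) * (q * b^-1).
    by rewrite bi /X; field; rewrite gt_eqF.
  rewrite ler_wpM2r //; first by rewrite mulr_ge0 ?ltW ?invr_gt0.
  apply: ler_pM => //; first by lra.
  rewrite /c2; lra.
have k2 : 5 * gLam R lam * lnU R G / b <= 5 * c1 * a * X.
  apply: (@le_trans _ _ (5 * c1 * a * (L * y ^+ 2))); last first.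
    by rewrite ler_wpM2l // !mulr_ge0 // ltW.
  have -> : 5 * c1 * a * (L * y ^+ 2) = 5 * (c1 * L) * (a * L) * b^-1.
    by rewrite bi; field; rewrite gt_eqF.
  rewrite ler_wpM2r ?invr_ge0 ?(ltW b0) //; apply: ler_pM => //; first by rewrite mulr_ge0.
  by rewrite ler_pM2l.
have k3 : 1 <= l2^-1 * X.
  apply: (le_trans W1); rewrite ler_pM2l //; apply: le_trans LyX.
  by rewrite ler_peMr // ltW.
have kd : kapder G b th lam <= c3 * X by rewrite /kapder /c3; lra.
have br : bp_ratio b (cldiam R K) <= 4 * q ^+ 30.
  (* The diameter plus 3 is at most 8 y + 7, hence at most 15 y, and 2 b 15 y = 30 c. The 31st
     factor q comes from 1/th in [kapmin]. *)
  rewrite /bp_ratio ler_pM2l // -expRM_natl ler_expR /cldiam.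
  have -> : 30%:R * c = 2 * b * (15 * y) by rewrite /b /c epsE; field; rewrite gt_eqF.
  rewrite ler_pM2l ?mulr_gt0 // -(natr1 K); move: (K%:R : R) Ky => z Kz; lra.
have kl : kaplev G b th lam K <= c4 * (q ^+ 31 * L * y ^+ 2).
  rewrite /kaplev.
  have h1 : bp_ratio b (cldiam R K) * kapder G b th lam <= 4 * q ^+ 30 * (c3 * X).
    by apply: ler_pM => //; rewrite /bp_ratio mulr_ge0 ?expR_ge0.
  have h2 : 4 * q ^+ 30 * (c3 * X) = 4 * c3 * (q ^+ 31 * L * y ^+ 2).
    by rewrite /X [q ^+ 31]exprS; ring.
  have h3 : c1 * L <= c1 * (q ^+ 31 * L * y ^+ 2).
    rewrite ler_pM2l // -mulrA; apply: (@le_trans _ _ (L * y ^+ 2)); first by rewrite ler_peMr // ltW.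
    by rewrite ler_peMl // mulr_ge0 // ltW.
  rewrite h2 in h1; rewrite /c4; lra.
have kl0 : 0 <= kaplev G b th lam K.
  by rewrite addr_ge0 // mulr_ge0 // mulr_ge0 // /bp_ratio mulr_ge0 ?expR_ge0.
rewrite ieps (powRE n2) -/L.
have -> : expR (31 * eps * L) = q ^+ 31.
  by rewrite -expRM_natl; congr expR; rewrite /c mulrA.
pose W := q ^+ 31 * L ^+ 2 * y ^+ 3.
have h1 : 3 * A%:R * J.+1%:R * kaplev G b th lam K <=
    3 * (CA * L) * ((a + 2) * y) * (c4 * (q ^+ 31 * L * y ^+ 2)).
  exact: ler_pM4.
have h2 : 3 * (CA * L) * ((a + 2) * y) * (c4 * (q ^+ 31 * L * y ^+ 2)) =
    3 * CA * (a + 2) * c4 * W by rewrite /W; ring.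
have h3 : 1 <= l2^-1 ^+ 2 * W.
  have -> : l2^-1 ^+ 2 * W = (l2^-1 * L) ^+ 2 * (q ^+ 31 * y ^+ 3) by rewrite /W; ring.
  by apply: mulr_ege1; [exact: exprn_ege1|apply: mulr_ege1 => //; exact: exprn_ege1].
apply: (@le_trans _ _ (c5 * W)); first by rewrite h2 in h1; rewrite /c5; lra.
(* The number of levels leaves a y^3; one factor y is exchanged for L / c0, by the lower bound on
   eps. *)
have -> : c5 * W = c5 / c0 * (q ^+ 31 * L ^+ 2 * y ^+ 2) * (c0 * y).
  by rewrite /W; field; rewrite gt_eqF.
have -> : c5 / c0 * q ^+ 31 * L ^+ 3 * y ^+ 2 = c5 / c0 * (q ^+ 31 * L ^+ 2 * y ^+ 2) * L by ring.
rewrite ler_wpM2l // !mulr_ge0 ?exprn_ge0 ?ltW //.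
Qed.
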